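(* Let $p>1$ and let $u$ be a nonzero solution with finite energy to the defocusing wave equation $u_{tt}-u_{xx}=-|u|^{p-1}u$ on $\mathbb{R}_x\times\mathbb{R}_t$. Then for any given real number $\eta$ we have \[ \lim_{t\to+\infty}\int_{|x|<t-\eta}\left(\frac12|u_x(x,t)|^2+\frac12|u_t(x,t)|^2+\frac{1}{p+1}|u(x,t)|^{p+1}\right)dx>0. \]
   Context: Functions are real-valued. A solution with finite energy to the defocusing equation $u_{tt}-u_{xx}=-|u|^{p-1}u$ with initial data $(u(\cdot,0),u_t(\cdot,0))=(u_0,u_1)\in(\dot H^1(\mathbb{R})\cap L^{p+1}(\mathbb{R}))\times L^2(\mathbb{R})$ means the unique global solution $u\in C(\mathbb{R}_x\times\mathbb{R}_t)$ with $(u(\cdot,t),u_t(\cdot,t))\in C(\mathbb{R}_t;(\dot H^1\cap L^{p+1})\times L^2)$ satisfying D'Alembert's formula \[ u(x,t)=\tfrac12\Big[u_0(x-t)+u_0(x+t)+\int_{x-t}^{x+t}u_1(x')\,dx'\Big]-\tfrac12\int_0^t\int_{x-t+t'}^{x+t-t'}|u|^{p-1}u(x',t')\,dx'\,dt'. \] The energy $E=\int_{\mathbb{R}}\big(\frac12|u_x(x,t)|^2+\frac12|u_t(x,t)|^2+\frac1{p+1}|u(x,t)|^{p+1}\big)dx$ is finite and constant in $t$. Nonzero means not identically zero. *)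

(* Defs.v *)
From mathcomp Require Import all_boot all_order all_algebra.
From mathcomp Require Import all_classical all_reals all_analysis.
Set Implicit Arguments.
Unset Strict Implicit.
Unset Printing Implicit Defensive.
Import Order.TTheory GRing.Theory Num.Theory.
Import numFieldNormedType.Exports.
Local Open Scope classical_set_scope.
Local Open Scope ring_scope.

Notation leb R := (@lebesgue_measure R).

(* The integral from a to b with the usual sign convention when b < a;
   D'Alembert's formula is used for negative times as well. *)
Definition oriented_integral {R : realType} (a b : R) (f : R -> R) : R :=
  if a <= b then \int[leb R]_(x in `[a, b]) f x
  else - \int[leb R]_(x in `[b, a]) f x.

Definition test_function {R : realType} (phi : R -> R) : Prop :=
  (forall n x, derivable (derive1n n phi) x 1) /\
  exists M, forall x, M < `|x| -> phi x = 0.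

(* Functions of (x, t) are curried: v x t. C^n means that all iterated partial
   derivatives of order at most n exist and are jointly continuous. *)
Fixpoint Cn2 {R : realType} (n : nat) (phi : R -> R -> R) : Prop :=
  continuous (fun z : R * R => phi z.1 z.2) /\
  match n with
  | 0%N => True
  | m.+1 =>
      [/\ forall x t, derivable (phi^~ t) x 1,
          forall x t, derivable (phi x) t 1,
          Cn2 m (fun x t => derive1 (phi^~ t) x) &
          Cn2 m (fun x t => derive1 (phi x) t)]
  end.

Definition test_function2 {R : realType} (phi : R -> R -> R) : Prop :=
  (forall n, Cn2 n phi) /\
  exists M, forall x t, M < `|x| \/ M < `|t| -> phi x t = 0.

Definition weak_derivative {R : realType} (f g : R -> R) : Prop :=
  forall phi, test_function phi ->
    \int[leb R]_x (f x * derive1 phi x) = - \int[leb R]_x (g x * phi x).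

(* w is the t-derivative of v in the sense of distributions on R_x * R_t.
   The x-integral is innermost, so that for w in C(R_t; L^2) the pairing does
   not depend on the representatives chosen for the classes w(., t). *)
Definition weak_time_derivative {R : realType} (v w : R -> R -> R) : Prop :=
  forall phi, test_function2 phi ->
    \int[leb R]_t (\int[leb R]_x (v x t * derive1 (phi x) t)) =
    - \int[leb R]_t (\int[leb R]_x (w x t * phi x t)).

(* t |-> v(., t) belongs to C(R_t; L^q(R)). *)
Definition continuous_in_L {R : realType} (q : R) (v : R -> R -> R) : Prop :=
  (forall t, v^~ t \in Lfun (leb R) q%:E) /\
  (forall t, Lnorm (leb R) q%:E (fun x => (v x s - v x t)%:E) @[s --> t] --> 0%E).

(* The functions ux and ut carry (representatives of) the classes u_x(., t)
   and u_t(., t) in L^2. *)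
Record finite_energy_solution {R : realType} (p : R) (u0 u1 : R -> R)
    (u ux ut : R -> R -> R) : Prop := {
  u0_H1dot : exists2 g, weak_derivative u0 g & g \in Lfun (leb R) 2%:E;
  u0_L : u0 \in Lfun (leb R) (p + 1)%:E;
  u1_L2 : u1 \in Lfun (leb R) 2%:E;
  u_continuous : continuous (fun z : R * R => u z.1 z.2);
  ux_weak : forall t, weak_derivative (u^~ t) (ux^~ t);
  ut_weak : weak_time_derivative u ut;
  u_curve : continuous_in_L (p + 1) u;
  ux_curve : continuous_in_L 2 ux;
  ut_curve : continuous_in_L 2 ut;
  u_initial : forall x, u x 0 = u0 x;
  ut_initial : {ae leb R, forall x, ut x 0 = u1 x};
  dalembert : forall x t,
    u x t = 2^-1 * (u0 (x - t) + u0 (x + t)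
                    + oriented_integral (x - t) (x + t) u1)
            - 2^-1 * oriented_integral 0 t (fun t' =>
                oriented_integral (x - t + t') (x + t - t')
                  (fun x' => `|u x' t'| `^ (p - 1) * u x' t'))
}.

Definition energy_density {R : realType} (p : R) (u ux ut : R -> R -> R)
    (x t : R) : R :=
  2^-1 * `|ux x t| ^+ 2 + 2^-1 * `|ut x t| ^+ 2
  + (p + 1)^-1 * `|u x t| `^ (p + 1).

(* Main.v *)
Require Import Defs.
From mathcomp Require Import all_boot all_order all_algebra.
From mathcomp Require Import all_classical all_reals all_analysis.
From mathcomp Require Import ring lra measurable_realfun.
Import Order.TTheory GRing.Theory Num.Theory.
Import numFieldNormedType.Exports.
Local Open Scope classical_set_scope.
Local Open Scope ring_scope.
Set Implicit Arguments.
Unset Strict Implicit.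
Unset Printing Implicit Defensive.

(** In the null coordinates r = x - t and s = x + t the equation for
    w(r, s) = u(x, t) reads w_rs = f(w) / 4 with f(v) = |v|^(p-1) v.  With
    V(v) = |v|^(p+1) / (p+1) it implies the two conservation laws
      d_r (w_s^2) = d_s V(w) / 2   and   d_s (w_r^2) = d_r V(w) / 2.
    The energy density is w_s^2 + w_r^2 + V(w), and the energy crosses the lines
    of constant r and of constant s with densities w_s^2 + V(w) / 2 and
    w_r^2 + V(w) / 2; all of these are nonnegative because the equation is
    defocusing.

    The limit exists.  Integrating the conservation laws over the triangle below
    the slice |x| < t - eta shows that the energy of the slice is the flux
    through the two sides of the cone |x| < t' - eta, from the apex at time eta
    up to time t ([energy_past], [cone_energy]); so it is nondecreasing in t.
    Integrating over triangles above the slice at time eta bounds this flux by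
    the total energy at that time ([flux_r_bound], [flux_s_bound]).

    The limit is positive.  Otherwise no energy ever crosses the sides of the
    cone, so w vanishes on the half-lines r = -eta, s >= eta and
    s = eta, r <= -eta.  It also vanishes on the rest of these two lines
    ([vanish_future_s], [vanish_past_r]): the conservation law on a rectangle
    with one side on r = -eta shows that the integral of V(w) over a segment of
    the line s = eta is at most its integral over the translate of that segment
    to any later line of constant s.  But V(w) has a finite integral along each
    line of constant r, by the flux bound, so the integrals over the translates
    cannot stay above a positive constant ([averaging]).  Finally a solution that
    vanishes on the two crossing lines r = -eta and s = eta is zero
    ([goursat_zero]), while u is not.

    Solutions of finite energy are not differentiable, and the rest of the file
    justifies these computations for them.  A continuous function with a locally
    integrable weak derivative is absolutely continuous
    ([weak_derivative_primitive]); therefore D'Alembert's formula shows that w_s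
    is an L^2_loc function of s plus a continuous function, and symmetrically for
    w_r ([solution_is_null]).  This structure is all that is needed to integrate
    the conservation laws with Fubini's theorem and a chain rule for absolutely
    continuous functions ([half_rectangle], [half_past]).  The given u_x and u_t
    are weak derivatives; at every time they agree almost everywhere with
    w_s + w_r and w_s - w_r ([ux_identified], [ut_identified]). *)

(** * Oriented integrals of locally integrable functions *)

Notation oint := oriented_integral.

(** Tested on segments only: this is the form in which oriented integrals use it. *)
Definition loc_int {R : realType} (f : R -> R) :=
  forall a b, (leb R).-integrable `[a, b] (EFin \o f).

Section oriented_integral_theory.
Context {R : realType}.
Implicit Types (a b c : R) (f g : R -> R).

Lemma oint_le a b f : a <= b -> oint a b f = \int[leb R]_(x in `[a, b]) f x.
Proof. by rewrite /oriented_integral => ->. Qed.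

Lemma oint_same a f : oint a a f = 0.
Proof. by rewrite oint_le// set_itv1 Rintegral_set1. Qed.

Lemma ointC a b f : oint b a f = - oint a b f.
Proof.
rewrite /oriented_integral; case: ltgtP => [ab|ba|->]; rewrite ?opprK //.
by rewrite set_itv1 Rintegral_set1 oppr0.
Qed.

Lemma continuous_loc_int f : continuous f -> loc_int f.
Proof.
move=> cf a b; apply: continuous_compact_integrable; first exact: segment_compact.
exact: continuous_subspaceT.
Qed.

(** By antisymmetry each of the orders of a, b and c reduces to the sorted one. *)
Lemma oriented_additive (O : R -> R -> R) : (forall a b, O b a = - O a b) ->
  (forall x y z, x <= y -> y <= z -> O x y + O y z = O x z) ->
  forall a b c, O a b + O b c = O a c.
Proof.
move=> anti base a b c.
have := anti a b; have := anti b c; have := anti a c.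
have [ab|/ltW ba] := leP a b; have [bc|/ltW cb] := leP b c; have [ac|/ltW ca] := leP a c.
- have := base _ _ _ ab bc; lra.
- have := base _ _ _ ab bc; have := base _ _ _ bc ca; lra.
- have := base _ _ _ ac cb; lra.
- have := base _ _ _ ca ab; lra.
- have := base _ _ _ ba ac; lra.
- have := base _ _ _ bc ca; lra.
- have := base _ _ _ cb ba; have := base _ _ _ ba ac; lra.
- have := base _ _ _ cb ba; lra.
Qed.

Lemma oint_chasles f a b c : loc_int f -> oint a b f + oint b c f = oint a c f.
Proof.
move=> fi; apply: (@oriented_additive (fun x y => oint x y f)) => [x y|x y z xy yz].
  exact: ointC.
rewrite !oint_le ?(le_trans xy)//.
have /= := @Rintegral_itvB R f (BLeft x) (BRight z) y (fi _ _).
rewrite !bnd_simp => /(_ xy yz).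
rewrite Rintegral_itv_obnd_cbnd; first by move=> <-; rewrite addrC subrK.
by apply: integrableS (fi y z) => //; apply: subset_itvr; rewrite bnd_simp.
Qed.

Lemma eq_oint a b f g : (forall x, Num.min a b <= x <= Num.max a b -> f x = g x) ->
  oint a b f = oint a b g.
Proof.
rewrite /oriented_integral; case: leP => ab fg; [|congr (- _)];
  by apply: eq_Rintegral => x; rewrite inE/= in_itv/= => /fg.
Qed.

Lemma eq_oint_le a b f g : a <= b -> (forall x, a <= x <= b -> f x = g x) ->
  oint a b f = oint a b g.
Proof. by move=> ab fg; apply: eq_oint; rewrite minEle maxEle ab. Qed.

Lemma eq_ointT a b f g : (forall x, f x = g x) -> oint a b f = oint a b g.
Proof. by move=> fg; apply: eq_oint => x _; rewrite fg. Qed.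

Lemma loc_intD f g : loc_int f -> loc_int g -> loc_int (fun x => f x + g x).
Proof. by move=> fi gi a b; exact: (integrableD _ (fi a b) (gi a b)). Qed.

Lemma loc_intZ c f : loc_int f -> loc_int (fun x => c * f x).
Proof. by move=> fi a b; exact: (integrableZl _ c (fi a b)). Qed.

Lemma loc_intN f : loc_int f -> loc_int (fun x => - f x).
Proof. by move=> fi a b; exact: (integrableN (fi a b)). Qed.

Lemma loc_intB f g : loc_int f -> loc_int g -> loc_int (fun x => f x - g x).
Proof. by move=> fi gi; apply: loc_intD => //; exact: loc_intN. Qed.

Lemma loc_int_abs f : loc_int f -> loc_int (fun x => `|f x|).
Proof. by move=> fi a b; exact: (integrable_abse (fi a b)). Qed.

Lemma ointD a b f g : loc_int f -> loc_int g ->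
  oint a b (fun x => f x + g x) = oint a b f + oint a b g.
Proof.
move=> fi gi; rewrite /oriented_integral.
by case: ifP => _; rewrite RintegralD// opprD.
Qed.

Lemma ointZ a b c f : loc_int f -> oint a b (fun x => c * f x) = c * oint a b f.
Proof.
move=> fi; rewrite /oriented_integral.
by case: ifP => _; rewrite RintegralZl// mulrN.
Qed.

Lemma ointN a b f : loc_int f -> oint a b (fun x => - f x) = - oint a b f.
Proof.
move=> fi; rewrite -mulN1r -ointZ//.
by apply: eq_ointT => x; rewrite mulN1r.
Qed.

Lemma ointB a b f g : loc_int f -> loc_int g ->
  oint a b (fun x => f x - g x) = oint a b f - oint a b g.
Proof. by move=> fi gi; rewrite ointD ?ointN//; exact: loc_intN. Qed.

Lemma oint_cst a b c : oint a b (fun=> c) = c * (b - a).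
Proof.
have base x y : x <= y -> \int[leb R]_(_ in `[x, y]) c = c * (y - x).
  move=> xy; rewrite Rintegral_cst//; congr (_ * _).
  have /= := lebesgue_measure_itv `[x, y]; rewrite /= => ->.
  by rewrite lte_fin; case: ltgtP xy => // -> _; rewrite subrr.
rewrite /oriented_integral; have [ab|/ltW ba] := leP a b; first exact: base.
by rewrite base//; ring.
Qed.

Lemma oint_ge0 a b f : a <= b -> (forall x, a <= x <= b -> 0 <= f x) ->
  0 <= oint a b f.
Proof.
by move=> ab f0; rewrite oint_le//; exact: Rintegral_ge0.
Qed.

Lemma le_oint a b f g : a <= b -> loc_int f -> loc_int g ->
  (forall x, a <= x <= b -> f x <= g x) -> oint a b f <= oint a b g.
Proof.
by move=> ab fi gi fg; rewrite !oint_le//; exact: le_Rintegral.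
Qed.

Lemma le_norm_oint a b f : a <= b -> loc_int f ->
  `|oint a b f| <= oint a b (fun x => `|f x|).
Proof. by move=> ab fi; rewrite !oint_le//; exact: le_normr_Rintegral. Qed.

Lemma oint_subset a b c d f : loc_int f -> (forall x, 0 <= f x) ->
  c <= a -> a <= b -> b <= d -> oint a b f <= oint c d f.
Proof.
move=> fi f0 ca ab bd; rewrite -(oint_chasles c a d fi) -(oint_chasles a b d fi).
have := @oint_ge0 c a f ca (fun x _ => f0 x).
have := @oint_ge0 b d f bd (fun x _ => f0 x); lra.
Qed.

Lemma norm_oint_le a b f (M : R) : loc_int f ->
  (forall x, Num.min a b <= x <= Num.max a b -> `|f x| <= M) ->
  `|oint a b f| <= M * `|b - a|.
Proof.
have base x y : x <= y -> loc_int f -> (forall z, x <= z <= y -> `|f z| <= M) ->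
    `|oint x y f| <= M * `|y - x|.
  move=> xy fi fM; rewrite (le_trans (le_norm_oint xy fi))//.
  rewrite ger0_norm ?subr_ge0// -oint_cst; apply: le_oint => //.
    exact: loc_int_abs.
  by apply: continuous_loc_int; exact: cst_continuous.
move=> fi; case: (leP a b) => [ab|/ltW ba] fM; first exact: base.
by rewrite ointC normrN distrC; exact: base.
Qed.

(** With the base point moved to x - 1 the points near x lie to its right, where
    the theorem for integrals over segments applies. *)
Lemma FTC1_oint a f : continuous f -> forall x : R, is_derive x (1 : R) (fun y => oint a y f) (f x).
Proof.
move=> cf x; have fi := continuous_loc_int cf.
have x1 : x - 1 < x + 1 by lra.
have /= := @continuous_FTC1 R f (BLeft (x - 1)) x (x + 1) ltac:(lra) (fi _ _).
rewrite lte_fin => /(_ ltac:(lra) (cf x)) [dF F'].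
set G := fun _ => _ in dF F'.
suff nG : \forall y \near x, oint a y f = oint a (x - 1) f + G y.
  apply: (@near_eq_is_derive _ _ _ (fun y => oint a (x - 1) f + G y)).
    by move: nG; apply: filterS => y /= ->.
  by rewrite -[f x]add0r -F' derive1E; apply: is_deriveD => //; exact: DeriveDef.
near=> y; rewrite -(oint_chasles a (x - 1) y fi)//; congr (_ + _).
rewrite oint_le//; by near: y; apply: lt_le_nbhsr; lra.
Unshelve. all: by end_near. Qed.

Lemma continuous_oint a f : loc_int f -> continuous (fun y : R => oint a y f).
Proof.
move=> fi x; have x1 : x - 1 <= x + 1 by lra.
have /= cP := parameterized_integral_continuous x1 (fi _ _).
have cx : {for x, continuous (fun y => parameterized_integral (leb R) (x - 1) y f)}.
  by apply: (within_continuous_continuous _ cP); rewrite ?in_itv/=; lra.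
have xE : oint a x f = oint a (x - 1) f + parameterized_integral (leb R) (x - 1) x f.
  by rewrite -(oint_chasles a (x - 1) x fi) [oint (x - 1) x f]oint_le//; lra.
have nG : \forall y \near x,
    oint a (x - 1) f + parameterized_integral (leb R) (x - 1) y f = oint a y f.
  near=> y; rewrite -(oint_chasles a (x - 1) y fi) [oint (x - 1) y f]oint_le//.
  by near: y; apply: lt_le_nbhsr; lra.
rewrite /continuous_at xE; apply: cvg_trans (near_eq_cvg nG) _.
by apply: cvgD => //; exact: cvg_cst.
Unshelve. all: by end_near. Qed.

Lemma FTC2_oint a b (F : R -> R) f : continuous f -> (forall x : R, is_derive x (1 : R) F (f x)) ->
  oint a b f = F b - F a.
Proof.
move=> cf dF.
have h x : is_derive x (1 : R) (fun y => F y - oint a y f) 0.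
  rewrite -(subrr (f x)); apply: is_deriveB => //; exact: FTC1_oint.
by have := is_derive_0_is_cst b a h; rewrite oint_same; lra.
Qed.

End oriented_integral_theory.
Arguments eq_ointT {R a b f g}.

(** * Joint measurability and Fubini's theorem on a box *)

Notation jcont F := (continuous (fun z : _ * _ => F z.1 z.2)).
(** Joint measurability for the product of the Borel sigma-algebras, on which
    the product measure is defined. *)
Definition jmeas {R : realType} (F : R -> R -> R) :=
  measurable_fun setT (fun z : measurableTypeR R * measurableTypeR R => F z.1 z.2 : measurableTypeR R).

Section fubini.
Context {R : realType}.
Implicit Types (a b c : R) (f g : R -> R) (F : R -> R -> R).

(** The plane is second countable: an open set is the union of the countably
    many rational squares that it contains. *)
Lemma open_measurable_prod (O : set (R * R)) : open O ->
  measurable (O : set (measurableTypeR R * measurableTypeR R)).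
Proof.
move=> oO.
pose B (i : rat * rat * nat) : set (R * R) :=
  ball (ratr i.1.1 : R) (i.2.+1%:R^-1) `*` ball (ratr i.1.2 : R) (i.2.+1%:R^-1).
pose C i := if `[< B i `<=` O >] then B i else set0.
have -> : O = \bigcup_i C i.
  apply/seteqP; split=> [z Oz|z [i _]]; last first.
    by rewrite /C; case: asboolP => // h; exact: h.
  have /nbhs_ballP[e /= e0 zeO] : nbhs z O by exact: open_nbhs_nbhs.
  have e2 : 0 < e / 2 by lra.
  have [n n0] : exists n, n.+1%:R^-1 < e / 2 :> R.
    by have [N _ /(_ N (leqnn _))] := near_infty_natSinv_lt (PosNum e2); exists N.
  have i0 : 0 < n.+1%:R^-1 :> R by rewrite invr_gt0.
  have [d dE] : exists d : R, d = n.+1%:R^-1 by exists n.+1%:R^-1.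
  rewrite -dE in n0 i0.
  have ratd (x : R) : exists q : rat, `|ratr q - x| < d.
    have [|q] := @rat_in_itvoo R (x - d) (x + d); first lra.
    by rewrite in_itv/= => ?; exists q; rewrite ltr_norml; lra.
  have [p pz] := ratd z.1; have [q qz] := ratd z.2.
  exists (p, q, n) => //; rewrite /C; case: asboolP => [_|].
    by split; rewrite /= -dE -ball_normE.
  case=> y; rewrite /B /= -dE -!ball_normE /= => -[y1 y2]; apply: zeO.
  move: pz qz y1 y2; rewrite !ltr_norml => pz qz y1 y2.
  by split; rewrite -ball_normE /= ltr_norml; lra.
apply: countable_bigcupT_measurable => // -[[p q] n]; rewrite /C.
by case: asboolP => // _; apply: measurableX; exact: measurable_ball.
Qed.

Lemma jcont_jmeas F : jcont F -> jmeas F.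
Proof.
move=> cF; apply: (measurability _ (RGenOpens.measurableE R)).
move=> _ [_ [a [b ->] <-]]; rewrite setTI; apply: open_measurable_prod.
by apply: open_comp; [move=> z _; exact: cF|exact: interval_open].
Qed.

Lemma jmeas_snd f : measurable_fun setT f -> jmeas (fun _ y => f y).
Proof. by move=> mf; apply: measurableT_comp => //; exact: measurable_snd. Qed.

Lemma jmeasM F G : jmeas F -> jmeas G -> jmeas (fun x y => F x y * G x y).
Proof. by move=> mF mG; exact: measurable_funM. Qed.

Lemma jmeasD F G : jmeas F -> jmeas G -> jmeas (fun x y => F x y + G x y).
Proof. by move=> mF mG; exact: measurable_funD. Qed.

Lemma jmeas_flip F : jmeas F -> jmeas (fun x y => F y x).
Proof.
move=> mF.
have ms : measurable_fun setT (fun z : measurableTypeR R * measurableTypeR R => (z.2, z.1)).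
  by apply/measurable_fun_pairP; split; [exact: measurable_snd|exact: measurable_fst].
exact: (measurableT_comp mF ms).
Qed.

Lemma jmeas_tri F : jmeas F -> jmeas (fun x y => if y <= x then F x y else 0).
Proof.
move=> mF; apply: measurable_fun_ifT => //.
by apply: measurable_fun_ler; [exact: measurable_snd|exact: measurable_fst].
Qed.

Lemma jmeas_shift f : measurable_fun setT f -> jmeas (fun x y => f (x + y)).
Proof.
move=> mf; apply: measurableT_comp => //; apply: measurable_funD.
  exact: measurable_fst.
exact: measurable_snd.
Qed.

Lemma loc_int_meas f : loc_int f -> measurable_fun setT f.
Proof.
move=> fi.
have -> : (setT : set R) = \bigcup_n `[- n%:R, n%:R]%classic.
  apply/seteqP; split=> // x _.
  exists (Num.Def.archi_bound `|x|) => //=; rewrite in_itv/= -ler_norml ltW//.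
  by rewrite (le_lt_trans _ (archi_boundP _)).
apply/measurable_fun_bigcup => // n.
by have /integrableP[/measurable_EFinP] := fi (- n%:R) n%:R.
Qed.

Lemma integral_if_itv (h : R -> \bar R) c d :
  (\int[leb R]_y (if (c <= y <= d)%R then h y else 0) = \int[leb R]_(y in `[c, d]) h y)%E.
Proof.
rewrite [RHS]integral_mkcond; apply: eq_integral => y _.
by rewrite patchE mem_setE in_itv.
Qed.

Lemma EFin_oint f c d : c <= d -> loc_int f ->
  (\int[leb R]_(y in `[c, d]) (f y)%:E = (oint c d f)%:E)%E.
Proof.
move=> cd fi; rewrite oint_le// /Rintegral fineK//.
exact: integrable_fin_num.
Qed.

(** By Tonelli's theorem the uniform bound N on the integrals over the sections
    makes F integrable on the box. *)
Lemma box_fubini F a b c d (N : R) : a <= b -> c <= d -> jmeas F ->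
  (forall x, loc_int (F x)) -> (forall y, loc_int (F^~ y)) ->
  (forall x, a <= x <= b -> oint c d (fun y => `|F x y|) <= N) ->
  oint a b (fun x => oint c d (F x)) = oint c d (fun y => oint a b (F^~ y)).
Proof.
move=> ab cd mF iF iF' FN.
pose f (z : measurableTypeR R * measurableTypeR R) : \bar R :=
  if (a <= z.1 <= b) && (c <= z.2 <= d) then (F z.1 z.2)%:E else 0%E.
have mf : measurable_fun setT f.
  apply: measurable_fun_ifT => //; last exact/measurable_EFinP.
  by apply: measurable_and; apply: measurable_and; apply: measurable_fun_ler => //;
    do ?[exact: measurable_fst|exact: measurable_snd].
have fx x : (\int[leb R]_y f (x, y) =
   if (a <= x <= b)%R then (oint c d (F x))%:E else 0)%E.
  rewrite /f /=; case: ifPn => _ /=; last by rewrite integral0_eq.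
  by rewrite (integral_if_itv (fun y => (F x y)%:E)) EFin_oint.
have fy y : (\int[leb R]_x f (x, y) =
   if (c <= y <= d)%R then (oint a b (F ^~ y))%:E else 0)%E.
  rewrite /f /=; under eq_integral do rewrite andbC.
  case: ifPn => _ /=; last by rewrite integral0_eq.
  by rewrite (integral_if_itv (fun x => (F x y)%:E)) EFin_oint.
have fi : (leb R \x leb R)%E.-integrable setT f.
  apply/integrable12ltyP => //.
  have nfx x : (\int[leb R]_y `|f (x, y)| =
     if (a <= x <= b)%R then (oint c d (fun y => `|F x y|%R))%:E else 0)%E.
    rewrite /f /=; case: ifPn => _ /=; last by rewrite integral0_eq// => y _; rewrite normr0.
    rewrite -EFin_oint//; last exact: loc_int_abs.
    rewrite -(integral_if_itv (fun y => (`|F x y|)%:E)).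
    by apply: eq_integral => y _; case: ifP => _ //=; rewrite normr0.
  under eq_integral do rewrite nfx.
  rewrite (integral_if_itv (fun x => (oint c d (fun y => `|F x y|%R))%:E)).
  apply: (@le_lt_trans _ _ (\int[leb R]_(x in `[a, b]) N%:E)%E).
    apply: ge0_le_integral => //.
    - by move=> x _; rewrite lee_fin; apply: oint_ge0.
    - have := @measurable_fun_fubini_tonelli_F _ _ _ _ R (leb R) (abse \o f)
        (measurableT_comp (@abse_measurable _ _) mf) (fun z => abse_ge0 _).
      move=> /(measurable_funS measurableT (@subsetT _ `[a, b])).
      apply: eq_measurable_fun => x; rewrite inE /= in_itv/= => xab.
      by rewrite /fubini_F /= nfx xab.
  rewrite (integral_cst _ _ N%:E)//; have /= -> := lebesgue_measure_itv `[a, b].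
  by case: ifP => _; rewrite ?mule0 ?ltry// -EFinB -EFinM ltry.
have := Fubini fi.
under eq_integral do rewrite fx.
under [X in _ = X -> _]eq_integral do rewrite fy.
rewrite (integral_if_itv (fun x => (oint c d (F x))%:E)).
rewrite (integral_if_itv (fun y => (oint a b (F ^~ y))%:E)) => E.
by rewrite (oint_le _ ab) (oint_le _ cd) /Rintegral E.
Qed.

End fubini.

(** * Translations and reflections *)

Section change_of_variables.
Context {R : realType}.
Implicit Types (a b c : R) (f g : R -> R) (F : R -> R -> R).

(** Applied to translations and to the reflection, this transports integrability
    and the value of the integral at the same time. *)
Lemma measure_preserving_integral (phi : measurableTypeR R -> measurableTypeR R)
    (D : set (measurableTypeR R)) (f : measurableTypeR R -> R) :
  measurable_fun setT phi -> measurable D -> measurable_fun setT f ->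
  (forall A : set R, measurable A -> leb R (phi @^-1` A) = leb R A) ->
  (leb R).-integrable D (EFin \o f) ->
  (leb R).-integrable (phi @^-1` D) (EFin \o (f \o phi)) /\
  \int[leb R]_(x in phi @^-1` D) f (phi x) = \int[leb R]_(x in D) f x.
Proof.
move=> mphi mD mf phiE fi.
have mfE : measurable_fun setT (EFin \o f) by exact/measurable_EFinP.
have fphi : (leb R).-integrable (phi @^-1` D) ((EFin \o f) \o phi).
  apply/integrableP; split.
    apply: (@measurable_funS _ _ _ _ setT) => //.
    exact: (measurableT_comp mfE mphi).
  have := @ge0_integral_pushforward _ _ _ _ R _ mphi (leb R) D (abse \o (EFin \o f)) mD.
  move=> /(_ (measurable_funTS (measurableT_comp (@abse_measurable _ _) mfE)) (fun _ _ => abse_ge0 _)).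
  move=> /= <-.
  have -> : (\int[pushforward (leb R) phi]_(y in D) `|(f y)%:E| = \int[leb R]_(y in D) `|(f y)%:E|)%E.
    by apply: eq_measure_integral => A mA _; exact: phiE.
  by case/integrableP: fi.
split=> //; rewrite /Rintegral; congr (fine _).
rewrite -(@integral_pushforward _ _ _ _ R phi mphi (leb R) D (EFin \o f) mfE fphi mD).
by apply: eq_measure_integral => A mA _; exact: phiE.
Qed.

(** Lebesgue measure is determined by its values on half-open intervals, whose
    length is invariant. *)
Lemma lebesgue_shift c (A : set R) : measurable A ->
  leb R ((fun x => x + c) @^-1` A) = leb R A.
Proof.
move=> mA.
have ms : measurable_fun setT (fun x : measurableTypeR R => x + c : measurableTypeR R).
  by apply: measurable_funD => //.
apply/esym; apply: (@lebesgue_measure_unique R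
  (pushforward (leb R) (fun x : measurableTypeR R => x + c : measurableTypeR R))) => //=.
move=> _ [[a b]] _ <-; rewrite /pushforward.
have -> : (fun x => x + c) @^-1` `]a, b] = `](a - c), (b - c)]%classic.
  by apply/seteqP; split => x /=; rewrite !in_itv/=; lra.
have /= -> := lebesgue_measure_itv `]a, b].
have /= -> := lebesgue_measure_itv `]a - c, b - c].
by rewrite !lte_fin ltrD2r; case: ifP => // _; rewrite -!EFinB; congr EFin; ring.
Qed.

Lemma loc_int_shift f c : loc_int f -> loc_int (fun x => f (x + c)).
Proof.
move=> fi a b.
have := measure_preserving_integral (D := `[a + c, b + c]) _ _ (loc_int_meas fi) (@lebesgue_shift c) (fi _ _).
case=> //; first by apply: measurable_funD => //.
have -> : (fun x => x + c) @^-1` `[a + c, b + c] = `[a, b]%classic => //.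
by apply/seteqP; split => x /=; rewrite !in_itv/=; lra.
Qed.

Lemma oint_shift f a b c : loc_int f ->
  oint a b (fun x => f (x + c)) = oint (a + c) (b + c) f.
Proof.
move=> fi.
have base x y : \int[leb R]_(z in `[x, y]) f (z + c) = \int[leb R]_(z in `[x + c, y + c]) f z.
  have := measure_preserving_integral (D := `[x + c, y + c]) _ _
    (loc_int_meas fi) (@lebesgue_shift c) (fi _ _).
  case=> //; first by apply: measurable_funD => //.
  have -> // : (fun x => x + c) @^-1` `[x + c, y + c] = `[x, y]%classic.
  by apply/seteqP; split => z /=; rewrite !in_itv/=; lra.
by rewrite /oriented_integral lerD2r !base.
Qed.

Lemma loc_int_opp f : loc_int f -> loc_int (fun x => f (- x)).
Proof.
move=> fi a b.
have := measure_preserving_integral (D := `[- b, - a]) _ _ (loc_int_meas fi) (@lebesgue_measureN R) (fi _ _).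
case=> //.
have -> : (-%R) @^-1` `[- b, - a] = `[a, b]%classic => //.
by apply/seteqP; split => x /=; rewrite !in_itv/=; lra.
Qed.

Lemma oint_opp f a b : loc_int f ->
  oint a b (fun x => f (- x)) = oint (- b) (- a) f.
Proof.
move=> fi.
have base x y : \int[leb R]_(z in `[x, y]) f (- z) = \int[leb R]_(z in `[- y, - x]) f z.
  have := measure_preserving_integral (D := `[- y, - x]) _ _ (loc_int_meas fi) (@lebesgue_measureN R) (fi _ _).
  case=> //.
  have -> // : (-%R) @^-1` `[- y, - x] = `[x, y]%classic.
  by apply/seteqP; split => z /=; rewrite !in_itv/=; lra.
by rewrite /oriented_integral lerN2 !base.
Qed.

End change_of_variables.

(** * Continuous dependence on parameters *)

Section parameters.
Context {R : realType}.
Implicit Types (a b c : R) (f g : R -> R) (F : R -> R -> R).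

Lemma jcont_comp (T : topologicalType) F (p q : T -> R) :
  jcont F -> continuous p -> continuous q ->
  continuous (fun z => F (p z) (q z)).
Proof.
move=> cF cp cq z; apply: (@continuous_comp _ _ _ (fun z => (p z, q z)) (fun z => F z.1 z.2)).
  exact: (cvg_pair (cp z) (cq z)).
exact: cF.
Qed.

Lemma jcont1 F y : jcont F -> continuous (F ^~ y).
Proof. by move=> cF; apply: (jcont_comp cF) => z; [exact: cvg_id|exact: cvg_cst]. Qed.

Lemma jcont2 F x : jcont F -> continuous (F x).
Proof. by move=> cF; apply: (jcont_comp cF) => z; [exact: cvg_cst|exact: cvg_id]. Qed.

Lemma jcont_flip F : jcont F ->
  continuous (fun z : R * R => F z.2 z.1).
Proof. by move=> cF; apply: (jcont_comp cF) => z; [exact: cvg_snd|exact: cvg_fst]. Qed.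

Lemma jcont_bounded F a b c d : jcont F ->
  exists M : R, forall x y, a <= x <= b -> c <= y <= d -> `|F x y| <= M.
Proof.
move=> cF; have K := compact_setX (@segment_compact R a b) (@segment_compact R c d).
have [[x0 [y0 [x0i y0i]]]|e] := pselect (exists x y, a <= x <= b /\ c <= y <= d); last first.
  by exists 0 => x y xi yi; exfalso; apply: e; exists x, y.
have [||m _ Mm] := compact_EVT_max (f := fun z : R * R => `|F z.1 z.2|) _ K.
- by exists (x0, y0); split; rewrite /= in_itv.
- apply: continuous_subspaceT => z; apply: continuous_comp; first exact: cF.
  exact: norm_continuous.
exists (`|F m.1 m.2|) => x y xi yi; apply: (Mm (x, y)).
by rewrite inE; split; rewrite /= in_itv.
Qed.

(** Compactness of [a, b] makes the continuity in the second variable uniform in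
    the first. *)
Lemma unif_near F a b y0 (e : R) : jcont F -> 0 < e ->
  \forall y \near y0, forall x, a <= x <= b -> `|F x y - F x y0| < e.
Proof.
move=> cF e0.
have /compact_near_coveringP := @segment_compact R a b.
move=> /(_ R (nbhs y0) (fun y x => `|F x y - F x y0| < e) _) H.
have : \forall y \near y0, `[a, b]%classic `<=` (fun x => `|F x y - F x y0| < e).
  apply: H => x _.
  have e2 : 0 < e / 2 by lra.
  have /cvgrPdist_lt /(_ _ e2) := cF (x, y0) => -[[U V] /= [Ux Vy] UV].
  exists (U, V) => //= -[x' y'] [/= Ux' Vy'].
  have h1 := UV (x', y') (conj Ux' Vy').
  have h2 := UV (x', y0) (conj Ux' (nbhs_singleton Vy)).
  by move: h1 h2; rewrite /= !ltr_norml; lra.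
by apply: filterS => y + x xi; apply; rewrite /= in_itv.
Qed.

(** The variation is the sum of two errors: the change of the integrand, uniformly
    small on the segment, and the integral over the short segment by which the
    end point has moved. *)
Lemma jcont_oint F a : jcont F ->
  continuous (fun z : R * R => oint a z.1 (fun x => F x z.2)).
Proof.
move=> cF [x0 y0] /=.
have iF y : loc_int (F^~ y) by apply/continuous_loc_int/jcont1.
have [M FM] := jcont_bounded (x0 - 1) (x0 + 1) (y0 - 1) (y0 + 1) cF.
apply/cvgrPdist_lt => e e0.
have K0 : 0 < `|M| + 1 by rewrite ltr_pwDr.
have L0 : 0 < `|x0 - a| + 1 by rewrite ltr_pwDr.
(* d controls the moving end point and d' the integrand; each costs e / 2 *)
pose d := e / 2 / (`|M| + 1); pose d' := e / 2 / (`|x0 - a| + 1).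
have d0 : 0 < d by rewrite !divr_gt0.
have d'0 : 0 < d' by rewrite !divr_gt0.
have /= un := unif_near (Num.min a x0) (Num.max a x0) y0 cF d'0.
near=> z => /=.
have z1 : `|x0 - z.1| < d.
  near: z; apply: (@cvgr_dist_lt _ _ _ _ _ fst x0) => //; exact: cvg_fst.
have z1' : `|x0 - z.1| < 1.
  near: z; apply: (@cvgr_dist_lt _ _ _ _ _ fst x0) => //; exact: cvg_fst.
have z2 : `|y0 - z.2| < 1.
  near: z; apply: (@cvgr_dist_lt _ _ _ _ _ snd y0) => //; exact: cvg_snd.
have z2' : forall x, Num.min a x0 <= x <= Num.max a x0 -> `|F x z.2 - F x y0| < d'.
  by near: z; exact: (cvg_snd un).
rewrite -(oint_chasles a x0 z.1 (iF z.2)).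
have -> : oint a x0 (F^~ y0) - (oint a x0 (F^~ z.2) + oint x0 z.1 (F^~ z.2)) =
  - oint a x0 (fun x => F x z.2 - F x y0) - oint x0 z.1 (F^~ z.2).
  by rewrite ointB//; ring.
apply: (le_lt_trans (ler_normB _ _)); rewrite normrN.
have h1 : `|oint a x0 (fun x => F x z.2 - F x y0)| <= d' * `|x0 - a|.
  apply: norm_oint_le => [|x xi]; first exact: loc_intB.
  exact/ltW/z2'.
have h2 : `|oint x0 z.1 (F^~ z.2)| <= M * `|z.1 - x0|.
  apply: norm_oint_le => // x xi; apply: FM.
    by move: xi z1'; rewrite ltr_norml; case: (leP x0 z.1) => _; lra.
  by move: z2; rewrite ltr_norml; lra.
have h3 : M * `|z.1 - x0| < e / 2.
  apply: (@le_lt_trans _ _ (`|M| * d)).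
    rewrite distrC (le_trans (ler_wpM2r _ (ler_norm M)))// ler_wpM2l//.
    exact: ltW.
  have -> : e / 2 = (`|M| + 1) * d by rewrite /d; field; rewrite gt_eqF.
  by rewrite ltr_pM2r// ltrDl.
have h4 : d' * `|x0 - a| < e / 2.
  have -> : e / 2 = d' * (`|x0 - a| + 1) by rewrite /d'; field; rewrite gt_eqF.
  by rewrite ltr_pM2l// ltrDl.
lra.
Unshelve. all: by end_near. Qed.

End parameters.

(** * Triangles, integration by parts and the chain rule *)

Section triangles.
Context {R : realType}.
Implicit Types (a b c : R) (f g k : R -> R) (F : R -> R -> R).

Lemma loc_int_restrict f (D : set R) : measurable D -> loc_int f ->
  loc_int (f \_ D).
Proof.
move=> mD fi a b; rewrite -restrict_EFin.
apply/integrable_restrict => //.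
by apply: integrableS (fi a b) => //; exact: measurableI.
Qed.

Lemma ray_le (x : R) f : (fun y => if y <= x then f y else 0) = f \_ [set` `]-oo, x]].
Proof. by apply/funext => y; rewrite patchE mem_setE in_itv. Qed.

Lemma ray_ge (x : R) f : (fun y => if x <= y then f y else 0) = f \_ [set` `[x, +oo[].
Proof. by apply/funext => y; rewrite patchE mem_setE in_itv/= andbT. Qed.

Lemma oint_ray_le f a b x : a <= x -> x <= b ->
  oint a b (fun y => if y <= x then f y else 0) = oint a x f.
Proof.
move=> ax xb; rewrite !oint_le ?(le_trans ax)// ray_le -Rintegral_mkcondr.
congr (Rintegral _ _ _); apply/seteqP.
by split=> y /=; rewrite !in_itv/=; lra.
Qed.

Lemma oint_ray_ge f a b x : a <= x -> x <= b ->
  oint a b (fun y => if x <= y then f y else 0) = oint x b f.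
Proof.
move=> ax xb; rewrite !oint_le ?(le_trans ax)// ray_ge -Rintegral_mkcondr.
congr (Rintegral _ _ _); apply/seteqP.
by split=> y /=; rewrite !in_itv/= andbT; lra.
Qed.

(** The triangle is handled as a box, with the integrand cut off beyond the
    diagonal. *)
Lemma tri_fubini F a b (N : R) : a <= b -> jmeas F ->
  (forall x, loc_int (F x)) -> (forall y, loc_int (F^~ y)) ->
  (forall x, a <= x <= b -> oint a b (fun y => `|F x y|) <= N) ->
  oint a b (fun x => oint a x (F x)) = oint a b (fun y => oint y b (F^~ y)).
Proof.
move=> ab mF iF iF' FN.
have := @box_fubini R (fun x y => if y <= x then F x y else 0) a b a b N ab ab (jmeas_tri mF).
have i1 x : loc_int (fun y => if y <= x then F x y else 0).
  by rewrite ray_le; apply: loc_int_restrict.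
have i2 y : loc_int (fun x => if y <= x then F x y else 0).
  by rewrite (ray_ge y (F^~ y)); apply: loc_int_restrict.
move=> /(_ i1 i2) h.
transitivity (oint a b (fun x => oint a b (fun y => if y <= x then F x y else 0))).
  by apply: (eq_oint_le ab) => x /andP[ax xb]; rewrite oint_ray_le.
rewrite h.
  by apply: (eq_oint_le ab) => y /andP[ay yb]; rewrite (oint_ray_ge (F^~ y)).
move=> x xab; apply: le_trans (FN x xab).
apply: (le_oint ab (loc_int_abs (i1 x)) (loc_int_abs (iF x))) => y _.
by case: ifP => _; [exact: lexx|rewrite normr0; exact: normr_ge0].
Qed.

Lemma jcont_loc_int1 F y : jcont F -> loc_int (F^~ y).
Proof. by move=> cF; exact/continuous_loc_int/jcont1. Qed.

Lemma jcont_loc_int2 F x : jcont F -> loc_int (F x).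
Proof. by move=> cF; exact/continuous_loc_int/jcont2. Qed.

Lemma continuous_bounded f a b : continuous f ->
  exists M : R, 0 <= M /\ forall x, a <= x <= b -> `|f x| <= M.
Proof.
move=> cf.
have [|M FM] := @jcont_bounded R (fun x _ => f x) a b 0 0.
  by move=> z; apply: (@continuous_comp _ _ _ fst f); [exact: cvg_fst|exact: cf].
exists `|M|; split=> // x xab; apply: le_trans (ler_norm M).
by apply: (FM x 0) => //; rewrite lexx.
Qed.

Lemma loc_int_dom f g : measurable_fun setT f ->
  (forall a b, exists c, forall x, a <= x <= b -> `|f x| <= c * g x) ->
  loc_int g -> loc_int f.
Proof.
move=> mf fg gi a b; have [c fgc] := fg a b.
apply: (@le_integrable _ _ _ (leb R) `[a, b] _ (EFin \o f) (fun x => (c * g x)%:E)) => //.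
- by apply/measurable_EFinP; exact: measurable_funTS.
- move=> x; rewrite /= in_itv/= => xab; rewrite lee_fin.
  exact: le_trans (fgc _ xab) (ler_norm _).
- exact: (loc_intZ c gi).
Qed.

Lemma loc_intMc f g : loc_int f -> continuous g -> loc_int (fun x => f x * g x).
Proof.
move=> fi cg; apply: (@loc_int_dom _ (fun x => `|f x|)); last exact: loc_int_abs.
  by apply: measurable_funM; [exact: loc_int_meas|exact: continuous_measurable_fun].
move=> a b; have [M [M0 gM]] := continuous_bounded a b cg.
by exists M => x xab; rewrite normrM mulrC ler_wpM2r// gM.
Qed.

Lemma loc_int_cst c : loc_int (fun=> c : R).
Proof. by apply: continuous_loc_int => x; exact: cvg_cst. Qed.

(** In null coordinates the integrands are products of a rough function k of one
    variable with continuous functions, plus continuous functions.  The bound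
    required for Fubini's theorem holds since the continuous factors are bounded on
    boxes. *)
Section affine_integrand.
Variables (k : R -> R) (G H : R -> R -> R).
Hypotheses (ki : loc_int k) (cG : jcont G) (cH : jcont H).
Let F x y := k y * G x y + H x y.

Let mF : jmeas F.
Proof.
apply: jmeasD; last exact: jcont_jmeas.
by apply: jmeasM; [exact: (jmeas_snd (loc_int_meas ki))|exact: jcont_jmeas].
Qed.

Let iF x : loc_int (F x).
Proof. by apply: loc_intD; [apply: loc_intMc => //; exact: jcont2|exact: jcont_loc_int2]. Qed.

Let iF' y : loc_int (F ^~ y).
Proof. by apply: loc_intD; [apply/loc_intZ/jcont_loc_int1|exact: jcont_loc_int1]. Qed.

Let bF a b c d : c <= d ->
  exists N : R, forall x, a <= x <= b -> oint c d (fun y => `|F x y|) <= N.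
Proof.
move=> cd; have [M FM] := jcont_bounded a b c d cG; have [L HL] := jcont_bounded a b c d cH.
have aki := loc_int_abs ki.
have li : loc_int (fun y => M * `|k y| + L).
  by apply: loc_intD; [exact: loc_intZ|exact: loc_int_cst].
exists (oint c d (fun y => M * `|k y| + L)) => x xab.
apply: le_oint => //; first exact: loc_int_abs.
move=> y yab; apply: (le_trans (ler_normD _ _)); rewrite lerD ?HL// normrM mulrC.
by rewrite ler_wpM2r// FM.
Qed.

Lemma tri_fubini_affine a b : a <= b ->
  oint a b (fun x => oint a x (fun y => k y * G x y + H x y)) =
  oint a b (fun y => oint y b (fun x => k y * G x y + H x y)).
Proof.
move=> ab; have [N FN] := bF a b ab.
exact: (@tri_fubini F a b N).
Qed.

Lemma box_fubini_affine a b c d : a <= b -> c <= d ->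
  oint a b (fun x => oint c d (fun y => k y * G x y + H x y)) =
  oint c d (fun y => oint a b (fun x => k y * G x y + H x y)).
Proof.
move=> ab cd; have [N FN] := bF a b cd.
exact: (@box_fubini R F a b c d N).
Qed.

End affine_integrand.

Lemma tri_fubini_mul k F a b : a <= b -> loc_int k ->
  jcont F ->
  oint a b (fun x => oint a x (fun y => k y * F x y)) =
  oint a b (fun y => oint y b (fun x => k y * F x y)).
Proof.
move=> ab ki cF; have c0 : continuous (fun _ : R * R => 0 : R) by move=> z; exact: cvg_cst.
have := @tri_fubini_affine k F (fun _ _ => 0) ki cF c0 a b ab.
rewrite (eq_ointT (g := fun x => oint a x (fun y => k y * F x y))) => [->|x]; apply: eq_ointT => y.
  by apply: eq_ointT => x; rewrite addr0.
by rewrite addr0.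
Qed.

(** When b < a, reversing the inner and the outer integrals exchanges the roles of
    the two variables, so the case a <= b applies to the flipped function. *)
Lemma tri_fubini_cont F a b : jcont F ->
  oint a b (fun x => oint a x (F x)) = oint a b (fun y => oint y b (F^~ y)).
Proof.
have base (G : R -> R -> R) x0 y0 : x0 <= y0 -> jcont G ->
    oint x0 y0 (fun x => oint x0 x (G x)) = oint x0 y0 (fun y => oint y y0 (G^~ y)).
  move=> xy cG; have := tri_fubini_mul xy (loc_int_cst 1) cG.
  rewrite (eq_ointT (g := fun x => oint x0 x (G x))) => [->|x]; apply: eq_ointT => y.
    by apply: eq_ointT => x; rewrite mul1r.
  by rewrite mul1r.
move=> cF; have [ab|/ltW ba] := leP a b; first exact: base.
have E := base (fun x y => F y x) b a ba (jcont_flip cF).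
have cJ c : continuous (fun x => oint c x (F x)).
  have cJc := @jcont_oint R (fun y x => F x y) c (jcont_flip cF).
  by apply: (jcont_comp (F := fun u v => oint c u (F v)) cJc) => z; exact: cvg_id.
have cJ' c : continuous (fun y => oint c y (F^~ y)).
  have cJc := @jcont_oint R (fun x y => F x y) c cF.
  by apply: (jcont_comp (F := fun u v => oint c u (F^~ v)) cJc) => z; exact: cvg_id.
rewrite (ointC b a) [RHS](ointC b a).
rewrite (eq_ointT (f := fun x => oint a x (F x)) (g := fun x => - oint x a (F x))); last first.
  by move=> x; rewrite ointC.
rewrite (eq_ointT (f := fun y => oint y b (F^~ y)) (g := fun y => - oint b y (F^~ y))); last first.
  by move=> x; rewrite ointC.
rewrite !ointN.
- by rewrite -E.
- exact/continuous_loc_int/cJ'.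
apply: continuous_loc_int => x; rewrite /continuous_at.
under eq_fun do rewrite ointC.
by rewrite (ointC a x); apply: cvgN; exact: cJ.
Qed.

(** The function h is only absolutely continuous; the formula is Fubini's theorem
    on the triangle for k(y) beta'(x). *)
Lemma IBP_oint h k beta beta' A B : A <= B -> loc_int k ->
  (forall t, h t = h A + oint A t k) -> continuous beta' ->
  (forall x : R, is_derive x (1 : R) beta (beta' x)) ->
  oint A B (fun t => h t * beta' t) =
  h B * beta B - h A * beta A - oint A B (fun t => k t * beta t).
Proof.
move=> AB ki hE cb' db.
have cb : continuous beta.
  by move=> x; apply/differentiable_continuous/derivable1_diffP; have [] := db x.
have cF : continuous (fun z : R * R => beta' z.1).
  by move=> z; apply: (@continuous_comp _ _ _ fst beta'); [exact: cvg_fst|exact: cb'].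
have := tri_fubini_mul (F := fun x _ => beta' x) AB ki cF.
have ck : continuous (fun t => oint A t k) by exact: continuous_oint.
rewrite (eq_ointT (g := fun t => beta' t * oint A t k)); last first.
  move=> t; rewrite -ointZ//; apply: eq_ointT => y; exact: mulrC.
rewrite [RHS](eq_ointT (g := fun t => beta B * k t - k t * beta t)); last first.
  move=> t; rewrite ointZ; last exact: continuous_loc_int.
  by rewrite (FTC2_oint _ _ cb' db); ring.
rewrite ointB; [|exact: loc_intZ|exact: loc_intMc].
rewrite ointZ// => E.
rewrite (eq_ointT (g := fun t => h A * beta' t + beta' t * oint A t k)); last first.
  by move=> t; rewrite (hE t); ring.
rewrite ointD.
- rewrite E ointZ; last exact: continuous_loc_int.
  by rewrite (FTC2_oint _ _ cb' db) (hE B); ring.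
- exact/loc_intZ/continuous_loc_int.
- apply: continuous_loc_int => x; apply: cvgM; [exact: cb'|exact: ck].
Qed.

(** The radii are halved so that y, close to a point x' close to x, stays in the
    ball on which f is controlled by f x. *)
Lemma heine f a b (e : R) : continuous f -> 0 < e -> exists2 d, 0 < d &
  forall x y, a <= x <= b -> a <= y <= b -> `|x - y| < d -> `|f x - f y| < e.
Proof.
move=> cf e0.
have /compact_near_coveringP := @segment_compact R a b.
move=> /(_ R (0%R : R)^'+ (fun d x => forall y, `|x - y| < d -> `|f x - f y| < e) _) H.
have : \forall d \near (0:R)^'+, `[a, b]%classic `<=`
    (fun x => forall y, `|x - y| < d -> `|f x - f y| < e).
  apply: H => x _.
  have e2 : 0 < e / 2 by lra.
  have /cvgrPdist_lt /(_ _ e2) /nbhs_ballP[r /= r0 rx] := cf x.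
  exists (ball x (r / 2), [set d | d < r / 2]).
    split => /=; first by apply/nbhs_ballP; exists (r / 2) => //=; lra.
    by apply: nbhs_right_lt; lra.
  move=> -[x' d] [/= x'r dr] y x'y.
  have h1 : `|f x - f x'| < e / 2.
    by apply: rx; move: x'r; rewrite -!ball_normE/=; lra.
  have h2 : `|f x - f y| < e / 2.
    apply: rx; move: x'r x'y; rewrite -!ball_normE/=.
    by rewrite !ltr_norml; lra.
  by move: h1 h2; rewrite !ltr_norml; lra.
move=> h; have [d [hd d0]] := filter_ex (filterI h (@nbhs_right_gt R 0)).
exists d => // x y xab yab; apply: hd.
by rewrite /= in_itv.
Qed.

(** This replaces the vanishing of a derivative when only absolute continuity is
    available: adding up the increments over a fine subdivision bounds
    |H b - H a| by e (M b - M a) for every e > 0. *)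
Lemma small_increments_constant (H M : R -> R) a b : a <= b ->
  (forall x y, a <= x -> x <= y -> y <= b -> M x <= M y) ->
  (forall e : R, 0 < e -> exists2 d, 0 < d & forall x y, a <= x -> x <= y -> y <= b ->
     y - x < d -> `|H y - H x| <= e * (M y - M x)) ->
  H b = H a.
Proof.
move=> ab Mmono Hsmall.
have key e : 0 < e -> `|H b - H a| <= e * (M b - M a).
  move=> e0; have [d d0 Hd] := Hsmall e e0.
  have [n nd] : exists n, (b - a) / n.+1%:R < d.
    have ba0 : 0 < d / (b - a + 1) by rewrite divr_gt0//; lra.
    have [N _ /(_ N (leqnn _))/= N1] := near_infty_natSinv_lt (PosNum ba0).
    exists N; have N0 : 0 < N.+1%:R^-1 :> R by rewrite invr_gt0.
    apply: (@le_lt_trans _ _ ((b - a + 1) * N.+1%:R^-1)).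
      by rewrite ler_wpM2r ?ltW//; lra.
    by rewrite mulrC -ltr_pdivlMr//; lra.
  set w := (b - a) / _ in nd.
  pose p (i : nat) := a + (b - a) * (i%:R / n.+1%:R).
  have n0 : 0 < n.+1%:R :> R by rewrite ltr0n.
  have pS i : p i.+1 = p i + w.
    by rewrite /p /w -(natr1 i); field; rewrite gt_eqF.
  have pa i : a <= p i by rewrite /p lerDl mulr_ge0 ?divr_ge0// ?ler0n//; lra.
  have pb i : (i <= n.+1)%N -> p i <= b.
    move=> iN; have : i%:R / n.+1%:R <= 1 :> R by rewrite ler_pdivrMr// mul1r ler_nat.
    have ba0 : 0 <= b - a by lra.
    by move=> /(ler_wpM2l ba0); rewrite /p mulr1; set t := (b - a) * _; lra.
  have step i : (i <= n.+1)%N -> `|H (p i) - H a| <= e * (M (p i) - M a).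
    elim: i => [_|i IH iN]; first by rewrite /p mul0r mulr0 addr0 !subrr normr0 mulr0.
    have ba0 : 0 <= w by rewrite divr_ge0// ?ler0n//; lra.
    have h1 := IH (ltnW iN).
    have h2 : `|H (p i.+1) - H (p i)| <= e * (M (p i.+1) - M (p i)).
      have pbi := pb _ iN; have pai := pa i; rewrite pS in pbi *.
      by apply: Hd => //; lra.
    have -> : H (p i.+1) - H a = (H (p i.+1) - H (p i)) + (H (p i) - H a) by ring.
    by apply: (le_trans (ler_normD _ _)); lra.
  have := step n.+1 (leqnn _).
  by have -> : p n.+1 = b by rewrite /p divff ?gt_eqF//; ring.
apply/eqP; rewrite -subr_eq0 -normr_le0; apply/eqP.
apply/eqP; rewrite leNgt; apply/negP => h0.
have Mab := Mmono a b (lexx _) ab (lexx _).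
(* K + 1 and not K below, as M may be constant *)
have K0 : 0 < M b - M a + 1 by lra.
have := key _ (divr_gt0 h0 (mulr_gt0 (ltr0Sn R 1) K0)).
set h := `|H b - H a| in h0 *; set K := M b - M a in K0 *.
have -> : h / (2 * (K + 1)) * K = h / 2 * (K / (K + 1)) by field; rewrite gt_eqF.
have : K / (K + 1) <= 1 by rewrite ler_pdivrMr//; lra.
have : 0 <= h / 2 by lra.
move=> h2 /(ler_wpM2l h2); lra.
Qed.

Lemma mvt_between (V f : R -> R) p q : (forall x : R, is_derive x (1 : R) V (f x)) ->
  exists2 c, Num.min p q <= c <= Num.max p q & V q - V p = f c * (q - p).
Proof.
have base x y : (forall x : R, is_derive x (1 : R) V (f x)) -> x <= y ->
    exists2 c, x <= c <= y & V y - V x = f c * (y - x).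
  move=> dV; rewrite le_eqVlt => /predU1P[->|xy].
    by exists y; rewrite ?lexx// !subrr mulr0.
  have cV : {within `[x, y], continuous V}.
    by apply: derivable_within_continuous => z _; case: (dV z).
  have [c cxy E] := MVT xy (fun z _ => dV z) cV.
  by exists c => //; move: cxy; rewrite in_itv/= => /andP[/ltW -> /ltW ->].
move=> dV; case: (leP p q) => [pq|/ltW qp]; first exact: base.
by have [c cqp E] := base _ _ dV qp; exists c => //; lra.
Qed.

(** On a short segment [x, y] the mean value theorem writes the increment of V o w
    as f(xi) (w y - w x), and by the intermediate value theorem xi is a value of
    w on the segment.  So f(xi) is uniformly close to f o w there, and the error
    is at most e times the integral of |k|. *)
Lemma chain_oint (V f w k : R -> R) a b :
  continuous f -> (forall x : R, is_derive x (1 : R) V (f x)) -> loc_int k ->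
  (forall x y, w y - w x = oint x y k) ->
  oint a b (fun s => k s * f (w s)) = V (w b) - V (w a).
Proof.
move=> cf dV ki wE.
have cw : continuous w.
  move=> x; rewrite /continuous_at.
  have -> : w = (fun y => w 0 + oint 0 y k) by apply/funext => y; rewrite -wE; ring.
  by apply: cvgD; [exact: cvg_cst|exact: continuous_oint].
have cfw : continuous (f \o w) by move=> x; apply: continuous_comp; [exact: cw|exact: cf].
have fwi : loc_int (fun s => k s * f (w s)) by apply: loc_intMc => //; exact: cfw.
have aki := loc_int_abs ki.
have base x0 y0 : x0 <= y0 -> oint x0 y0 (fun s => k s * f (w s)) = V (w y0) - V (w x0).
  move=> xy.
  have := @small_increments_constant (fun s => V (w s) - oint x0 s (fun s => k s * f (w s)))
     (fun s => oint x0 s (fun s => `|k s|)) x0 y0 xy.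
  rewrite oint_same => h.
  suff : V (w y0) - oint x0 y0 (fun s => k s * f (w s)) = V (w x0) - 0 by lra.
  apply: h => [x y xx xy' _|e e0].
    rewrite -(oint_chasles x0 x y aki) lerDl; exact: oint_ge0.
  have [d d0 hd] := heine x0 y0 cfw e0.
  exists d => // x y x0x xy' yy0 yxd.
  rewrite -(oint_chasles x0 x y aki) -(oint_chasles x0 x y fwi).
  rewrite [X in e * X](_ : _ = oint x y (fun s => `|k s|)); last by ring.
  have [xi xiw E] := mvt_between (w x) (w y) dV.
  have [s sxy ws] : exists2 s, s \in `[x, y] & w s = xi.
    by apply: IVT => //; exact: continuous_subspaceT.
  rewrite in_itv/= in sxy.
  rewrite (_ : _ - _ - _ = oint x y (fun s' => f xi * k s' - k s' * f (w s'))); last first.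
    rewrite ointB//; last exact: loc_intZ.
    rewrite ointZ// -wE -E; ring.
  have gi : loc_int (fun s' => f xi * k s' - k s' * f (w s')).
    by apply: loc_intB => //; exact: loc_intZ.
  apply: le_trans (le_norm_oint xy' gi) _.
  rewrite -ointZ//; apply: le_oint => //; [exact: loc_int_abs|exact: loc_intZ|].
  move=> t txy; rewrite (_ : _ - _ = (f xi - f (w t)) * k t); last by ring.
  rewrite normrM ler_wpM2r// -ws ltW//; apply: hd; [lra|lra|].
  by rewrite ltr_norml; lra.
have [ab|/ltW ba] := leP a b; first exact: base.
by rewrite ointC base//; ring.
Qed.

Lemma continuous_diff (F f : R -> R) : (forall x : R, is_derive x (1 : R) F (f x)) ->
  continuous F.
Proof.
by move=> dF x; apply/differentiable_continuous/derivable1_diffP; have [] := dF x.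
Qed.

(** Lebesgue's differentiation theorem, applied to the primitives of k based at
    the points -n, which all vanish. *)
Lemma oint0_ae0 k : loc_int k -> (forall a b, oint a b k = 0) ->
  {ae leb R, forall x, k x = 0}.
Proof.
move=> ki k0.
have lk : locally_integrable setT k.
  split; [exact: loc_int_meas|exact: openT|move=> K _ cK].
  have [M [Mr KM]] := compact_bounded cK.
  have Ksub : K `<=` `[- (M + 1), M + 1].
    move=> x Kx; rewrite /= in_itv/= -ler_norml.
    by apply: KM => //; rewrite ltrDl.
  have /integrableP[_] := ki (- (M + 1)) (M + 1).
  apply: le_lt_trans; apply: ge0_subset_integral => //.
    exact: compact_measurable.
  apply/measurable_EFinP; apply: measurableT_comp => //.
  exact: (measurable_funS measurableT _ (loc_int_meas ki)).
have aen (n : nat) : {ae leb R, forall x, - n%:R < x -> k x = 0}.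
  have := FTC1 (a := BLeft (- n%:R)) (ki (- n%:R)) lk.
  apply: filterS; first exact: (ae_filter_ringOfSetsType (leb R)).
  move=> x h nx; have [] := h _; first by rewrite lte_fin.
  have -> : (fun x0 => \int[leb R]_(t in `[- n%:R, x0]) k t) = cst 0.
    apply/funext => y; have [yn|/ltW ny] := leP (- n%:R) y; first by rewrite -oint_le ?k0.
    move: ny; rewrite le_eqVlt => /predU1P[->|yn]; first by rewrite set_itv1 Rintegral_set1.
    by rewrite set_itv_ge ?Rintegral_set0// bnd_simp -ltNge.
  by rewrite derive1_cst.
have := ae_foralln aen; apply: filterS.
move=> x h; apply: (h (Num.Def.archi_bound `|x|)).
rewrite ltrNl (le_lt_trans (ler_norm _))// normrN.
exact: archi_boundP.
Qed.

End triangles.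

(** * Smooth bumps and steps *)

Section smooth.
Context {R : realType}.
Implicit Types (a b c : R) (f g k : R -> R).

(** The recursive form turns closure under sums, products and affine
    substitutions into inductions on n with f generalized. *)
Fixpoint Ck (n : nat) f : Prop :=
  if n is m.+1 then (forall x, derivable f x 1) /\ Ck m (derive1 f) else True.

Lemma CkS n f g : (forall x : R, is_derive x (1 : R) f (g x)) -> Ck n g -> Ck n.+1 f.
Proof.
move=> dfg Cg; split; first by move=> x; case: (dfg x).
have -> : derive1 f = g; last by [].
by apply/funext => x; rewrite derive1E; case: (dfg x).
Qed.

Lemma Ck_is_derive n f : Ck n.+1 f ->
  (forall x : R, is_derive x (1 : R) f (derive1 f x)) /\ Ck n (derive1 f).
Proof. by case=> df Cf; split=> // x; rewrite derive1E; exact: derivableP. Qed.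

Lemma Ck_le n f : Ck n.+1 f -> Ck n f.
Proof. by elim: n f => // n IH f [df Cf]; split => //; exact: IH. Qed.

Lemma Ck_cst n c : Ck n (fun=> c).
Proof.
elim: n c => // n IH c; apply: (@CkS _ _ (fun=> 0)) => // x; exact: is_derive_cst.
Qed.

Lemma CkD n f g : Ck n f -> Ck n g -> Ck n (fun x => f x + g x).
Proof.
elim: n f g => // n IH f g /Ck_is_derive[df Cf] /Ck_is_derive[dg Cg].
by apply: (CkS (g := fun x => derive1 f x + derive1 g x)); exact: IH.
Qed.

Lemma CkM n f g : Ck n f -> Ck n g -> Ck n (fun x => f x * g x).
Proof.
elim: n f g => // n IH f g Cf Cg.
have [df Cdf] := Ck_is_derive Cf; have [dg Cdg] := Ck_is_derive Cg.
apply: (CkS (g := fun x => f x * derive1 g x + g x * derive1 f x)).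
by apply: CkD; apply: IH => //; exact: Ck_le.
Qed.

Lemma is_derive_affine f df a b : (forall x : R, is_derive x (1 : R) f (df x)) ->
  forall x : R, is_derive x (1 : R) (fun x => f (a * x + b)) (a * df (a * x + b)).
Proof.
move=> dfE x; rewrite mulrC; apply: (@is_derive1_comp _ f (fun x => a * x + b)) => //.
by apply: is_derive_eq; rewrite addr0; exact: mulr1.
Qed.

Lemma Ck_affine n f a b : Ck n f -> Ck n (fun x => f (a * x + b)).
Proof.
elim: n f => // n IH f /Ck_is_derive[df Cf].
apply: (CkS (g := fun x => a * derive1 f (a * x + b))); first exact: is_derive_affine.
by apply: CkM; [exact: Ck_cst|exact: IH].
Qed.

Lemma smooth_derive1n f : (forall n, Ck n f) <->
  (forall n x, derivable (derive1n n f) x 1).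
Proof.
split=> [Cf n|df n].
  have Cfn m : Ck m (derive1n n f).
    elim: n m => // n IH m; have := IH m.+1 => /=; case=> _.
    by rewrite -derive1nS.
  by have [] := Cfn 1%N.
elim: n f df => // n IH f df; split; first exact: (df 0%N).
by apply: IH => m x; rewrite -derive1Sn; exact: df.
Qed.

(** The function x^-j exp(-1/x), extended by 0.  Derivatives of members of this
    family are combinations of members of the family, so one induction proves
    that all of them are smooth. *)
Definition flat (j : nat) (x : R) := if 0 < x then x^-1 ^+ j * expR (- x^-1) else 0.

Lemma flat_ge0 j x : 0 <= flat j x.
Proof.
rewrite /flat; case: ifP => // x0.
by rewrite mulr_ge0 ?expR_ge0// exprn_ge0// invr_ge0 ltW.
Qed.

(** With m = n + 1: exp y = (exp (y / m))^m >= (y / m)^m. *)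
Lemma pow_exp_bounded n (y : R) : 0 <= y -> y ^+ n.+1 * expR (- y) <= n.+1%:R ^+ n.+1.
Proof.
move=> y0; have n0 : 0 < n.+1%:R :> R by rewrite ltr0n.
rewrite expRN ler_pdivrMr ?expR_gt0//.
have -> : expR y = expR (y / n.+1%:R) ^+ n.+1.
  by rewrite -expRM_natl mulrC divfK// gt_eqF.
rewrite -exprMn lerXn2r ?nnegrE ?mulr_ge0 ?expR_ge0 ?(ltW n0)//.
have := expR_ge1Dx (y / n.+1%:R); rewrite -(ler_pM2l n0) => h; apply: le_trans h.
by rewrite mulrDr mulrCA divff ?gt_eqF// !mulr1; lra.
Qed.

(** Quadratic decay at 0 forces the derivative there to vanish. *)
Lemma flat_sqr j : exists C, forall x, `|flat j x| <= C * x ^+ 2.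
Proof.
exists (j.+2%:R ^+ j.+2) => x; rewrite ger0_norm ?flat_ge0// /flat.
case: ifPn => [x0|_]; last by rewrite mulr_ge0 ?sqr_ge0// exprn_ge0.
have xi0 : 0 <= x^-1 by rewrite invr_ge0 ltW.
have /(ler_wpM2r (sqr_ge0 x)) := @pow_exp_bounded j.+1 x^-1 xi0.
apply: le_trans; rewrite le_eqVlt; apply/orP; left; apply/eqP.
rewrite -[j.+2]addn2 exprD; set E := expR _; by field; rewrite gt_eqF.
Qed.

Lemma is_derive_flat0 j : is_derive (0 : R) (1 : R) (flat j) 0.
Proof.
have [C FC] := flat_sqr j.
have f0 : flat j 0 = 0 by rewrite /flat ltxx.
have C0 : 0 < `|C| + 1 by rewrite ltr_pwDr.
have lim0 : h^-1 *: ((flat j \o shift 0) (h *: 1) - flat j 0) @[h --> 0^'] --> (0 : R).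
  apply/cvgr0Pnorm_lt => e e0; near=> h.
  have hn0 : h != 0 by near: h; exact: nbhs_dnbhs_neq.
  rewrite /= f0 subr0 addr0 normrM normfV [h *: 1]mulr1.
  rewrite mulrC ltr_pdivrMr ?normr_gt0//.
  apply: (le_lt_trans (FC h)); rewrite -real_normK ?num_real// expr2 mulrA ltr_pM2r ?normr_gt0//.
  apply: (@le_lt_trans _ _ ((`|C| + 1) * `|h|)).
    by rewrite ler_wpM2r// (le_trans (ler_norm C))// lerDl.
  rewrite mulrC -ltr_pdivlMr//; near: h; apply: dnbhs0_lt; exact: divr_gt0.
by apply: DeriveDef; [apply/cvg_ex; exists 0|exact: cvg_lim].
Unshelve. all: by end_near. Qed.

Lemma is_derive_flat j (x : R) :
  is_derive x (1 : R) (flat j) (flat j.+2 x - j%:R * flat j.+1 x).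
Proof.
have [x0|x0|->] := ltgtP x 0; last first.
- by rewrite /flat ltxx mulr0 subr0; exact: is_derive_flat0.
- apply: (@near_eq_is_derive _ R^o R^o (fun y : R => y^-1 ^+ j * expR (- y^-1)) (flat j)).
    near=> y; rewrite /flat ifT//; near: y; exact: lt_nbhsr.
  have xn0 : x != 0 by rewrite gt_eqF.
  have dV : is_derive x (1 : R) (fun y : R => y^-1) (- x^-1 ^+ 2).
    apply: (is_derive_eq (@is_deriveV R id x 1 1 xn0 (is_derive_id x 1))).
    by rewrite exprVn; exact: mulr1.
  have dNV : is_derive x (1 : R) (fun y : R => - y^-1) (x^-1 ^+ 2).
    by apply: (is_derive_eq (is_deriveN dV)); rewrite opprK.
  have dE : is_derive x (1 : R) (fun y : R => expR (- y^-1)) (x^-1 ^+ 2 * expR (- x^-1)).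
    by rewrite mulrC; exact: (@is_derive1_comp _ expR (fun y => - y^-1)).
  have dX : is_derive x (1 : R) (fun y : R => y^-1 ^+ j) (- (j%:R * x^-1 ^+ j.+1)).
    elim: (j) => [|i IH]; first by rewrite mul0r oppr0; exact: is_derive_cst.
    have -> : (fun y : R => y^-1 ^+ i.+1) = (fun y => y^-1 * y^-1 ^+ i).
      by apply/funext => y; rewrite exprS.
    apply: (is_derive_eq (is_deriveM dV IH)).
    rewrite /GRing.scale /= -(natr1 i) !exprS; ring.
  rewrite /flat x0; apply: (is_derive_eq (is_deriveM dX dE)).
  rewrite /GRing.scale /= !exprS; ring.
apply: (@near_eq_is_derive _ R^o R^o (fun y => 0) (flat j)).
  near=> y; rewrite /flat ltNge (_ : y <= 0)// ltW//; near: y; exact: lt_nbhsl.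
rewrite /flat ltNge (ltW x0) /= mulr0 subr0; exact: is_derive_cst.
Unshelve. all: by end_near. Qed.

Lemma Ck_flat n j : Ck n (flat j).
Proof.
elim: n j => // n IH j; apply: (CkS (is_derive_flat j)).
have -> : (fun x => flat j.+2 x - j%:R * flat j.+1 x) =
  (fun x => flat j.+2 x + (- j%:R) * flat j.+1 x) by apply/funext => x; rewrite mulNr.
by apply: CkD; [exact: IH|apply: CkM; [exact: Ck_cst|exact: IH]].
Qed.

Definition bump (x : R) := flat 0 (1 * x + 1) * flat 0 (- 1 * x + 1).

Lemma Ck_bump n : Ck n bump.
Proof. by apply: CkM; apply: Ck_affine; exact: Ck_flat. Qed.

Lemma bump_ge0 x : 0 <= bump x.
Proof. by rewrite mulr_ge0 ?flat_ge0. Qed.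

Lemma bump_out x : 1 <= `|x| -> bump x = 0.
Proof.
rewrite /bump /flat ler_normr => /orP[x1|x1].
  by rewrite [X in _ * X]ifF ?mulr0//; apply/negbTE; rewrite -leNgt; lra.
by rewrite [X in X * _]ifF ?mul0r//; apply/negbTE; rewrite -leNgt; lra.
Qed.

Lemma continuous_bump : continuous bump.
Proof. by have [db _] := Ck_is_derive (Ck_bump 1); exact: continuous_diff db. Qed.

(** If the integral vanished, the primitive of bump would be constant on [-1, 1],
    while its derivative at 0 is bump 0, which is positive. *)
Lemma bump_integral_gt0 : 0 < oint (- 1) 1 bump.
Proof.
rewrite lt_neqAle oint_ge0 ?andbT; [|lra|by move=> *; exact: bump_ge0].
apply/eqP => I0.
have bi := continuous_loc_int continuous_bump.
have z x : -1 <= x <= 1 -> oint (-1) x bump = 0.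
  move=> xi; apply/eqP; rewrite eq_le.
  have := @oint_subset R (-1) x (-1) 1 bump bi bump_ge0; rewrite -I0 => -> //; try lra.
  by apply: oint_ge0 => [|*]; [lra|exact: bump_ge0].
have d0 := FTC1_oint (- 1) continuous_bump 0.
have : is_derive (0 : R) (1 : R) (fun y => oint (-1) y bump) 0.
  apply: (@near_eq_is_derive _ R^o R^o (fun y => 0) (fun y => oint (-1) y bump)).
  near=> y; rewrite z//; apply/andP; split; near: y.
    by apply: lt_le_nbhsr; lra.
  by apply: lt_le_nbhsl; lra.
case=> _ E; case: d0 => _; rewrite E.
rewrite /bump /flat !mulr0 !add0r ltr01 !expr0 !mul1r => /esym/eqP.
by rewrite mulf_eq0 orbb gt_eqF ?expR_gt0.
Unshelve. all: by end_near. Qed.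

(** A smooth step from 0 to 1 across [-1, 1], and its derivative, a mollifier.
    The difference of two translated steps is a test function whose derivative
    compares the values of a function at two points. *)
Definition step (x : R) := oint (- 1) x bump / oint (- 1) 1 bump.
Definition mol (x : R) := bump x / oint (- 1) 1 bump.

Lemma is_derive_step (x : R) : is_derive x (1 : R) step (mol x).
Proof.
have := FTC1_oint (- 1) continuous_bump x => d; rewrite /mol mulrC.
have -> : step = (fun x => (oint (- 1) 1 bump)^-1 * oint (- 1) x bump).
  by apply/funext => y; rewrite /step mulrC.
by apply: is_deriveZ.
Qed.

Lemma Ck_mol n : Ck n mol.
Proof. by apply: CkM; [exact: Ck_bump|exact: Ck_cst]. Qed.

Lemma Ck_step n : Ck n step.
Proof. by case: n => // n; apply: (CkS is_derive_step); exact: Ck_mol. Qed.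

Lemma mol_ge0 x : 0 <= mol x.
Proof. by rewrite divr_ge0 ?bump_ge0// ltW// bump_integral_gt0. Qed.

Lemma mol_out x : 1 <= `|x| -> mol x = 0.
Proof. by move=> x1; rewrite /mol bump_out// mul0r. Qed.

Lemma step_left x : x <= - 1 -> step x = 0.
Proof.
move=> x1; rewrite /step (eq_oint (g := fun=> 0)).
  by rewrite oint_cst !mul0r.
move=> y; case: (leP (-1) x) => [x1'|_] yx; apply: bump_out; rewrite ler_normr; lra.
Qed.

Lemma step_right x : 1 <= x -> step x = 1.
Proof.
move=> x1; have bi := continuous_loc_int continuous_bump.
rewrite /step -(oint_chasles _ 1 _ bi) [X in _ + X](eq_oint (g := fun=> 0)).
  by rewrite oint_cst mul0r addr0 divff// gt_eqF// bump_integral_gt0.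
move=> y; case: (leP 1 x) => [_|x1'] yx; apply: bump_out; rewrite ler_normr; lra.
Qed.

End smooth.

(** * Weak derivatives and primitives *)

Section weak_derivatives.
Context {R : realType}.
Implicit Types (a b c : R) (f g h k : R -> R).

Lemma Rintegral_support f (M : R) : 0 <= M -> (forall x, M < `|x| -> f x = 0) ->
  \int[leb R]_x f x = oint (- M) M f.
Proof.
move=> M0 f0; rewrite oint_le; last lra.
rewrite [RHS]Rintegral_mkcond; apply: eq_Rintegral => x _.
rewrite patchE; case: ifPn => // /negP; rewrite inE /= in_itv/= -ler_norml => /negP.
by rewrite -ltNge => /f0.
Qed.

Definition smooth f := forall n, Ck n f.

Lemma test_functionE f : test_function f <->
  smooth f /\ exists M, forall x, M < `|x| -> f x = 0.
Proof. by rewrite /test_function; split=> -[/smooth_derive1n]. Qed.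

Lemma smooth_derive f : smooth f ->
  (forall x : R, is_derive x (1 : R) f (derive1 f x)) /\ smooth (derive1 f).
Proof.
move=> sf; split; first by have [] := Ck_is_derive (sf 1%N).
by move=> n; have [] := Ck_is_derive (sf n.+1).
Qed.

Lemma smooth_continuous f : smooth f -> continuous f.
Proof. by case/smooth_derive => df _; exact: continuous_diff df. Qed.

Lemma derive1_support f (M : R) : (forall x, M < `|x| -> f x = 0) ->
  forall x, M < `|x| -> derive1 f x = 0.
Proof.
move=> f0 x xM.
have : is_derive x (1 : R) f 0.
  apply: (@near_eq_is_derive _ R^o R^o (fun y => 0) f).
  near=> y; apply/esym/f0; near: y.
  apply: (cvgr_gt `|x|) => //; exact: norm_continuous.
by move=> d; rewrite derive1E; case: d.
Unshelve. all: by end_near. Qed.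

Lemma test_function_support f : test_function f ->
  exists M : R, [/\ 0 <= M, forall x, M < `|x| -> f x = 0 &
    forall x, M < `|x| -> derive1 f x = 0].
Proof.
move=> /test_functionE[sf [M fM]].
have f0 x : `|M| < `|x| -> f x = 0 by move=> Mx; apply: fM; exact: le_lt_trans (ler_norm M) Mx.
by exists `|M|; split=> //; exact: derive1_support.
Qed.

Section mollify.
Variables (k : R -> R) (a N : R).
Hypothesis ck : continuous k.

Let m (l x : R) := l * mol (l * x - l * a).

Lemma is_derive_stepl (l x : R) : is_derive x (1 : R) (fun x => step (l * x - l * a)) (m l x).
Proof. exact: (is_derive_affine l (- (l * a)) (@is_derive_step R)). Qed.

Lemma continuous_molc l : continuous (m l).
Proof.
have c : continuous (fun x => l * mol (l * x + (- (l * a)))).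
  have sm : smooth (fun x => l * mol (l * x + - (l * a))).
    by move=> n; apply: CkM; [exact: Ck_cst|apply: Ck_affine; exact: Ck_mol].
  exact: smooth_continuous sm.
exact: c.
Qed.

(** The weight m l has integral 1 and is concentrated on the points at distance
    at most 1 / l from a; the condition on l (N - |a|) places them in [-N, N]. *)
Lemma mollify_near (e : R) : 0 < e -> exists2 l0, 0 < l0 & forall l, l0 <= l ->
  1 <= l * (N - `|a|) ->
  `|oint (- N) N (fun x => k x * m l x) - k a| <= e.
Proof.
move=> e0; have /cvgrPdist_lt /(_ _ e0) /nbhs_ballP[d /= d0 hd] := @ck a.
exists (2 / d); first by rewrite divr_gt0.
move=> l ld lN.
have l0 : 0 < l by apply: lt_le_trans ld; rewrite divr_gt0.
have N0 : 0 < N - `|a| by rewrite -(pmulr_rgt0 _ l0); lra.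
have [aN1 aN2] : a <= `|a| /\ - a <= `|a| by rewrite ler_norm -normrN ler_norm.
have cm : continuous (m l) by exact: continuous_molc.
have m1 : oint (- N) N (m l) = 1.
  rewrite (FTC2_oint _ _ cm (is_derive_stepl l)) step_right ?step_left ?subr0//.
    have : 0 <= l * (`|a| + a) by rewrite mulr_ge0; lra.
    by lra.
  have : 0 <= l * (`|a| - a) by rewrite mulr_ge0; lra.
  by lra.
have mi := continuous_loc_int cm.
have kmi : loc_int (fun x => k x * m l x).
  by apply: loc_intMc cm; exact: continuous_loc_int.
have NN : - N <= N by move: N0; have := normr_ge0 a; lra.
have -> : oint (- N) N (fun x => k x * m l x) - k a =
   oint (- N) N (fun x => k x * m l x - k a * m l x).
  by rewrite ointB ?(@ointZ _ _ _ (k a) (m l)) ?m1 ?mulr1//; exact: (@loc_intZ _ (k a) (m l)).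
apply: (le_trans (le_norm_oint NN _)); first by apply: loc_intB => //; exact: (@loc_intZ _ (k a) (m l)).
rewrite -[leRHS]mulr1 -m1 -(@ointZ _ _ _ e (m l))//; apply: le_oint => //.
- by apply/loc_int_abs/loc_intB => //; exact: (@loc_intZ _ (k a) (m l)).
- exact: (@loc_intZ _ e (m l)).
move=> x _; have m0 : 0 <= m l x by rewrite mulr_ge0 ?mol_ge0 ?ltW.
have [xa|xa] := ltP `|l * x - l * a| 1; last by rewrite /m mol_out// !mulr0 subrr normr0.
rewrite -mulrBl normrM (ger0_norm m0) ler_wpM2r// distrC ltW//; apply: hd.
rewrite -ball_normE /= distrC -(ltr_pM2l l0) -{1}(gtr0_norm l0) -normrM mulrBr.
apply: (lt_le_trans xa); move: ld; rewrite ler_pdivrMr//; lra.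
Qed.
End mollify.

Lemma scaled_right (l a N x : R) : 1 <= l -> 1 <= N - `|a| -> N <= x ->
  1 <= l * x - l * a.
Proof.
move=> l1 aN Nx; have := ler_norm a => aa.
by rewrite -mulrBr; apply: mulr_ege1 => //; lra.
Qed.

Lemma scaled_left (l a N x : R) : 1 <= l -> 1 <= N - `|a| -> N <= - x ->
  l * x - l * a <= -1.
Proof.
move=> l1 aN Nx; rewrite -normrN in aN.
have := scaled_right l1 aN Nx; lra.
Qed.

Lemma close_to_both (x y z e : R) : 0 < e ->
  `|z - x| <= e -> `|z - y| <= e -> `|y - x| < 4 * e.
Proof. by rewrite !ler_norml ltr_norml; lra. Qed.

Lemma scaled_mol_out (l z : R) : 1 <= z \/ z <= -1 -> l * mol z = 0.
Proof.
by move=> z1; rewrite mol_out ?mulr0// ler_normr; apply/orP; case: z1 => ?; [left|right]; lra.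
Qed.

(** The lemma of du Bois-Reymond: the difference k between h and a primitive of g
    has zero weak derivative.  Testing against the step at a minus the step at b,
    rescaled by l, says that the averages of k near a and near b coincide; these
    averages tend to k a and k b as l grows. *)
Lemma weak_derivative_primitive h g : continuous h -> loc_int g ->
  weak_derivative h g -> forall a b, h b - h a = oint a b g.
Proof.
move=> ch gi wd a b.
pose G x := oint 0 x g.
have cG : continuous G by exact: continuous_oint.
pose k x := h x - G x.
have ck : continuous k by move=> x; apply: cvgB; [exact: ch|exact: cG].
suff kab : k b = k a.
  by rewrite -(oint_chasles a 0 b gi) (ointC 0 a) /= ; move: kab; rewrite /k /G; lra.
apply/eqP; rewrite -subr_eq0 -normr_le0 leNgt; apply/negP => d0.
have [e e0 dE] : exists2 e, 0 < e & `|k b - k a| = 4 * e.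
  by exists (`|k b - k a| / 4); [rewrite divr_gt0|field].
have [N [N0 aN bN]] : exists N, [/\ 0 <= N, 1 <= N - `|a| & 1 <= N - `|b|].
  exists (`|a| + `|b| + 1); have := normr_ge0 a; have := normr_ge0 b.
  by split; lra.
have [la la0 Ha] := mollify_near a N ck e0.
have [lb lb0 Hb] := mollify_near b N ck e0.
pose l := la + lb + 1.
have l1 : 1 <= l by rewrite /l; lra.
have {}Ha := Ha l ltac:(rewrite /l; lra) ltac:(exact: mulr_ege1).
have {}Hb := Hb l ltac:(rewrite /l; lra) ltac:(exact: mulr_ege1).
pose ma x := l * mol (l * x - l * a); pose mb x := l * mol (l * x - l * b).
pose chi x := step (l * x - l * a) - step (l * x - l * b).
have dchi (x : R) : is_derive x (1 : R) chi (ma x - mb x).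
  by apply: is_deriveB; exact: is_derive_stepl.
have chi' : derive1 chi = (fun x => ma x - mb x).
  by apply/funext => x; rewrite derive1E; case: (dchi x).
have cma : continuous ma by exact: continuous_molc.
have cmb : continuous mb by exact: continuous_molc.
have cmm : continuous (fun x => ma x - mb x).
  by move=> x; apply: cvgB; [exact: cma|exact: cmb].
have schi : smooth chi.
  move=> n; rewrite (_ : chi = fun x => step (l * x + - (l * a)) + (-1) * step (l * x + - (l * b))).
    by apply: CkD; [|apply: CkM; [exact: Ck_cst|]]; apply: Ck_affine; exact: Ck_step.
  by apply/funext => x; rewrite mulN1r.
have sgn x : N <= `|x| -> (1 <= l * x - l * a /\ 1 <= l * x - l * b) \/
    (l * x - l * a <= -1 /\ l * x - l * b <= - 1).
  rewrite ler_normr => /orP[Nx|Nx]; [left|right].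
    by split; [exact: scaled_right aN Nx|exact: scaled_right bN Nx].
  by split; [exact: scaled_left aN Nx|exact: scaled_left bN Nx].
have chi0 x : N <= `|x| -> chi x = 0.
  by rewrite /chi => /sgn[] [h1 h2]; rewrite ?(step_right h1) ?(step_right h2)
    ?(step_left h1) ?(step_left h2) subrr.
have chi'0 x : N <= `|x| -> ma x - mb x = 0.
  by rewrite /ma /mb => /sgn[] [h1 h2]; rewrite !scaled_mol_out ?subrr//; [left|left|right|right].
have tchi : test_function chi.
  by apply/test_functionE; split=> //; exists N => x /ltW /chi0.
have := wd chi tchi; rewrite chi'.
rewrite (Rintegral_support N0); last by move=> x /ltW/chi'0 ->; rewrite mulr0.
rewrite (Rintegral_support N0); last by move=> x /ltW/chi0 ->; rewrite mulr0.
have NN : - N <= N by rewrite ge0_cp.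
have := @IBP_oint R G g chi (fun x => ma x - mb x) (- N) N NN gi _ cmm dchi.
rewrite !chi0 ?normrN ?ger0_norm// !mulr0 subr0 add0r => <-; last first.
  by move=> t; rewrite /G oint_chasles.
move=> E.
have i1 (u v : R -> R) : continuous u -> continuous v -> loc_int (fun x => u x * v x).
  by move=> cu cv; apply: loc_intMc => //; exact: continuous_loc_int.
have : oint (- N) N (fun x => k x * ma x) = oint (- N) N (fun x => k x * mb x).
  apply/eqP; rewrite -subr_eq0 -ointB; [|exact: i1|exact: i1].
  rewrite (eq_ointT (g := fun x => h x * (ma x - mb x) - G x * (ma x - mb x))); last first.
    by move=> x; rewrite /k; ring.
  by rewrite ointB ?E ?subrr//; exact: i1.
move: Ha Hb; rewrite -/ma -/mb => Ha Hb E'.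
by rewrite E' in Ha; have := close_to_both e0 Ha Hb; rewrite dE ltxx.
Qed.

Lemma Cn2_tensor n f g : smooth f -> smooth g -> Cn2 n (fun x t => f x * g t).
Proof.
have cont f1 g1 : smooth f1 -> smooth g1 -> continuous (fun z : R * R => f1 z.1 * g1 z.2).
  move=> /smooth_continuous cf /smooth_continuous cg.
  have c1 : continuous (fun z : R * R => f1 z.1).
    by move=> z; apply: (@continuous_comp _ _ _ fst f1); [exact: cvg_fst|exact: cf].
  have c2 : continuous (fun z : R * R => g1 z.2).
    by move=> z; apply: (@continuous_comp _ _ _ snd g1); [exact: cvg_snd|exact: cg].
  by move=> z; apply: cvgM; [exact: c1|exact: c2].
elim: n f g => [|n IH] f g sf sg; split=> //; try exact: cont.
have [df sf'] := smooth_derive sf; have [dg sg'] := smooth_derive sg.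
have dx (x t : R) : is_derive x (1 : R) (fun x => f x * g t) (derive1 f x * g t).
  rewrite mulrC (_ : (fun x => f x * g t) = (fun x => g t * f x)); last first.
    by apply/funext => y; rewrite mulrC.
  by apply: is_deriveZ.
have dt (x t : R) : is_derive t (1 : R) (fun t => f x * g t) (f x * derive1 g t).
  by apply: is_deriveZ.
split.
- by move=> x t; case: (dx x t).
- by move=> x t; case: (dt x t).
- rewrite (_ : (fun x t => _) = (fun x t => derive1 f x * g t)); first exact: IH.
  by apply/funext => x; apply/funext => t; rewrite derive1E; case: (dx x t).
- rewrite (_ : (fun x t => _) = (fun x t => f x * derive1 g t)); first exact: IH.
  by apply/funext => x; apply/funext => t; rewrite derive1E; case: (dt x t).
Qed.

Lemma test_function2_tensor f g : test_function f -> test_function g ->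
  test_function2 (fun x t => f x * g t).
Proof.
move=> tf tg; have [M [_ fM _]] := test_function_support tf.
have [M' [_ gM _]] := test_function_support tg.
split=> [n|]; first by case/test_functionE: tf => sf _; case/test_functionE: tg => sg _; exact: Cn2_tensor.
exists (Num.max M M') => x t; rewrite !gt_max => -[/andP[xM _]|/andP[_ tM]].
  by rewrite fM ?mul0r.
by rewrite gM ?mulr0.
Qed.

(** The hypothesis says that k is the weak derivative of the constant 0, hence all
    its integrals vanish. *)
Lemma ae_eq_pairing k : loc_int k ->
  (forall phi, test_function phi -> \int[leb R]_x (k x * phi x) = 0) ->
  {ae leb R, forall x, k x = 0}.
Proof.
move=> ki k0; apply: oint0_ae0 => // a b.
have c0 : continuous (fun _ : R => 0 : R) by move=> x; exact: cvg_cst.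
rewrite -(weak_derivative_primitive c0 ki) ?subrr// => phi tphi.
rewrite k0// oppr0.
by under eq_Rintegral do rewrite mul0r; rewrite Rintegral_cst// mul0r.
Qed.

End weak_derivatives.

(** * The nonlinearity and its potential *)

Section nonlinearity.
Context {R : realType}.
Variables (p : R) (hp : 1 < p).

Definition nl (v : R) := `|v| `^ (p - 1) * v.
Definition pot (v : R) := (p + 1)^-1 * `|v| `^ (p + 1).

Let p1' : 0 < p + 1. Proof. by rewrite addr_gt0// (lt_trans ltr01 hp). Qed.
Let p1 : p + 1 != 0. Proof. by rewrite gt_eqF. Qed.

Lemma nlN v : nl (- v) = - nl v.
Proof. by rewrite /nl normrN mulrN. Qed.

Lemma potN v : pot (- v) = pot v.
Proof. by rewrite /pot normrN. Qed.

Lemma pot_ge0 v : 0 <= pot v.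
Proof. by rewrite mulr_ge0 ?powR_ge0// invr_ge0 ltW. Qed.

Lemma pot_eq0 v : pot v = 0 -> v = 0.
Proof.
move/eqP; rewrite mulf_eq0 invr_eq0 (negbTE p1) /= powR_eq0 normr_eq0.
by case/andP => /eqP.
Qed.

Lemma nl0 : nl 0 = 0.
Proof. by rewrite /nl mulr0. Qed.

Lemma pot0 : pot 0 = 0.
Proof. by rewrite /pot normr0 powR0// mulr0. Qed.

(** The linear bound on bounded sets on which the uniqueness argument relies. *)
Lemma nl_bounded (K : R) v : `|v| <= K -> `|nl v| <= K `^ (p - 1) * `|v|.
Proof.
have p_gt1 := hp.
move=> vK; rewrite /nl normrM (ger0_norm (powR_ge0 _ _)) ler_wpM2r//.
by apply: ge0_ler_powR => //; rewrite ?nnegrE// ?(le_trans _ vK)//; lra.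
Qed.

(** Away from 0 this is the power rule together with the parity of the two
    functions; at 0 it follows from |pot h| <= h^2 for |h| <= 1. *)
Lemma is_derive_pot v : is_derive v (1 : R) pot (nl v).
Proof.
have p_gt1 := hp.
have pos (y : R) : 0 < y -> is_derive y (1 : R) pot (nl y).
  move=> y0; apply: (@near_eq_is_derive _ R^o R^o (fun z => (p + 1)^-1 * z `^ (p + 1)) pot).
    by near=> z; rewrite /pot ger0_norm//; near: z; exact: lt_le_nbhsr.
  have d := is_deriveZ (p + 1)^-1 (is_derive1_powR (p + 1) y0).
  apply: (is_derive_eq d); rewrite /GRing.scale /= mulrA mulVf// mul1r /nl gtr0_norm//.
  rewrite (_ : p + 1 - 1 = p - 1 + 1); last ring.
  by rewrite powRD ?powRr1 ?ltW//; apply/implyP => _; rewrite gt_eqF.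
have [v0|v0|->] := ltgtP v 0; last first.
- have bnd (h : R) : `|h| <= 1 -> pot h <= h ^+ 2.
    move=> h1; rewrite /pot -[leRHS]mul1r.
    rewrite ler_pM ?powR_ge0 ?invr_ge0 ?(ltW p1')//.
      by rewrite invf_le1//; lra.
    rewrite -real_normK ?num_real// -powR_mulrn// .
    have [->|hn0] := eqVneq h 0; first by rewrite normr0 !powR0.
    rewrite (_ : p + 1 = 2 + (p - 1)); last ring.
    rewrite powRD; last by apply/implyP => _; rewrite normr_eq0.
    rewrite ler_piMr ?powR_ge0// [leRHS](_ : 1 = 1 `^ (p - 1)); last by rewrite powR1.
    by apply: ge0_ler_powR => //; rewrite ?nnegrE//; lra.
  have lim0 : h^-1 *: ((pot \o shift 0) (h *: 1) - pot 0) @[h --> 0^'] --> (0 : R).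
    apply/cvgr0Pnorm_lt => e e0; near=> h.
    have hn0 : h != 0 by near: h; exact: nbhs_dnbhs_neq.
    have h1 : `|h| < 1 by near: h; exact: dnbhs0_lt.
    have he : `|h| < e by near: h; exact: dnbhs0_lt.
    rewrite /= pot0 subr0 addr0 normrM normfV [h *: 1]mulr1.
    rewrite mulrC ltr_pdivrMr ?normr_gt0// (ger0_norm (pot_ge0 _)).
    apply: (le_lt_trans (bnd h (ltW h1))); rewrite -real_normK ?num_real// expr2.
    by rewrite ltr_pM2r ?normr_gt0.
  rewrite nl0; apply: DeriveDef; [by apply/cvg_ex; exists 0|exact: cvg_lim].
- exact: pos.
have d := @is_derive1_comp R pot (fun y => - y) v _ (-1) (pos (- v) _).
have dN : is_derive v (1 : R) (fun y : R => - y) (- 1) by exact: is_deriveN.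
have := d (ltac:(rewrite oppr_gt0; exact: v0)) dN.
rewrite nlN mulrN1 opprK (_ : pot \o _ = pot)//.
by apply/funext => y; rewrite /= potN.
Unshelve. all: by end_near. Qed.

Lemma continuous_pot : continuous pot.
Proof. exact: continuous_diff is_derive_pot. Qed.

Lemma continuous_nl : continuous nl.
Proof.
have pos (y : R) : 0 < y -> {for y, continuous nl}.
  move=> y0; have cp : {for y, continuous (fun z => z `^ (p - 1) * z)}.
    have c1 : {for y, continuous (fun z : R => z `^ (p - 1))}.
      apply/differentiable_continuous/derivable1_diffP.
      by have [] := is_derive1_powR (p - 1) y0.
    by apply: cvgM; [exact: c1|exact: cvg_id].
  have E : y `^ (p - 1) * y = nl y by rewrite /nl gtr0_norm.
  change (nl x @[x --> y] --> nl y); rewrite -E.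
  apply: cvg_trans cp.
  apply: near_eq_cvg; near=> z; rewrite /nl gtr0_norm//; near: z; exact: lt_nbhsr.
move=> v; have [v0|v0|->] := ltgtP v 0; last first.
- change (nl x @[x --> (0 : R)] --> nl 0); rewrite nl0.
  apply/cvgrPdist_lt => e e0; apply/nbhs_ballP.
  exists (Num.min 1 e); first by rewrite /= lt_min ltr01.
  move=> h; rewrite /ball_ /= sub0r normrN lt_min => /andP[/ltW h1 he].
  rewrite sub0r normrN.
  by apply: le_lt_trans he; rewrite (le_trans (nl_bounded h1))// powR1 mul1r.
- exact: pos.
have -> : nl = (fun v => - (nl \o -%R) v) by apply/funext => y; rewrite /= nlN opprK.
rewrite /continuous_at; apply: cvgN; apply: (@continuous_comp _ _ _ -%R nl).
  exact: continuousN.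
by apply: pos; lra.
Unshelve. all: by end_near. Qed.

End nonlinearity.

(** * D'Alembert's formula in null coordinates *)

(** Exchanges the two null coordinates: statements about the derivative in s become
    statements about the derivative in r. *)
Definition swap {R : realType} (F : R -> R -> R) (r s : R) := F s r.

(** A form of w_rs = f(w) / 4 adapted to finite energy.  The derivative ws in s is
    only defined up to null sets of s, but its variation in r is exact and
    continuous: a single function phi of s carries all the lack of regularity.
    The factor 1 / 4 comes from u_xx - u_tt = 4 w_rs. *)
Record half_null {R : realType} (f : R -> R) (w ws : R -> R -> R) : Prop := {
  half_split : exists phi h, [/\ loc_int phi, loc_int (fun s => phi s ^+ 2),
    jcont h & forall r s, ws r s = phi s + h r s];
  half_primitive : forall r a b, w r b - w r a = oint a b (ws r);
  half_source : forall a b s,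
    ws b s - ws a s = 4^-1 * oint a b (fun r => f (w r s)) }.

Record null_solution {R : realType} (f : R -> R) (w ws wr : R -> R -> R) : Prop := {
  null_continuous : jcont w;
  null_s : half_null f w ws;
  null_r : half_null f (swap w) (swap wr) }.

Section null_solution_theory.
Context {R : realType}.
Variable f : R -> R.
Hypothesis cf : continuous f.
Implicit Types (w ws wr : R -> R -> R).

Lemma continuous_affine (g : R -> R) (c d : R) : continuous g -> continuous (fun x : R => g (c * x + d)).
Proof.
move=> cg x; apply: (@continuous_comp _ _ _ (fun x => c * x + d) g); last exact: cg.
by apply: cvgD; [apply: cvgM; [exact: cvg_cst|exact: cvg_id]|exact: cvg_cst].
Qed.

Lemma continuous_scale (g : R -> R) (c : R) : continuous g -> continuous (fun x : R => c * g x).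
Proof. by move=> cg x; apply: cvgM; [exact: cvg_cst|exact: cg]. Qed.

Lemma oint_affine (g : R -> R) c d a b : continuous g ->
  oint a b (fun x => c * g (c * x + d)) = oint (c * a + d) (c * b + d) g.
Proof.
move=> cg.
have dF := is_derive_affine c d (FTC1_oint 0 cg).
rewrite (FTC2_oint _ _ _ dF).
  by have := oint_chasles 0 (c * a + d) (c * b + d) (continuous_loc_int cg); lra.
exact/continuous_scale/continuous_affine.
Qed.

(** For integrands that are merely integrable, only translations and reflections
    occur: null coordinates vary with slope 1 or -1 along horizontal and
    vertical lines. *)
Lemma oint_unit_affine (k : R -> R) c d a b : c = 1 \/ c = -1 -> loc_int k ->
  loc_int (fun x => k (c * x + d)) /\
  oint a b (fun x => c * k (c * x + d)) = oint (c * a + d) (c * b + d) k.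
Proof.
move=> [->|->] ki.
  rewrite (_ : (fun x => k (1 * x + d)) = (fun x => k (x + d))); last first.
    by apply/funext => x; rewrite mul1r.
  split; first exact: loc_int_shift.
  rewrite !mul1r -oint_shift//; apply: eq_ointT => x; by rewrite !mul1r.
have ki' := loc_int_shift d ki.
rewrite (_ : (fun x => k (- 1 * x + d)) = (fun x => k (- x + d))); last first.
  by apply/funext => x; rewrite mulN1r.
split; first exact: (loc_int_opp ki').
rewrite (eq_ointT (g := fun x => - k (- x + d))); last by move=> x; rewrite !mulN1r.
rewrite ointN; last exact: (loc_int_opp ki').
by rewrite (oint_opp _ _ ki') oint_shift// !mulN1r -ointC.
Qed.

(** The substitution x = 2 y + r - t' in the inner integral turns the backward
    light cone (for t >= 0) into the triangle 0 <= t' <= y <= t, on which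
    s = 2 y + r depends on y alone; after the integrals are exchanged, s and
    r' = s - 2 t' are the new variables. *)
Lemma cone_integral (g : R -> R -> R) r t : jcont g ->
  oint 0 t (fun t' => oint (r + t') (r + 2 * t - t') (fun x => g (x - t') (x + t'))) =
  2^-1 * oint r (r + 2 * t) (fun s => oint r s (g ^~ s)).
Proof.
move=> cg.
pose F x t' := 2 * g (2 * x + (r - 2 * t')) (2 * x + r).
have cF : jcont F.
  have c1 : continuous (fun z : R * R => 2 * z.1 + (r - 2 * z.2)).
    move=> z; apply: cvgD; first by apply: cvgM; [exact: cvg_cst|exact: cvg_fst].
    by apply: cvgB; [exact: cvg_cst|apply: cvgM; [exact: cvg_cst|exact: cvg_snd]].
  have c2 : continuous (fun z : R * R => 2 * z.1 + r).
    by move=> z; apply: cvgD; [apply: cvgM; [exact: cvg_cst|exact: cvg_fst]|exact: cvg_cst].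
  by move=> z; apply: cvgM; [exact: cvg_cst|exact: (jcont_comp cg c1 c2)].
have cgd t' : continuous (fun x => g (x - t') (x + t')).
  by apply: (jcont_comp cg) => x; [apply: cvgB|apply: cvgD]; (exact: cvg_id || exact: cvg_cst).
rewrite (eq_ointT (g := fun t' => oint t' t (F ^~ t'))); last first.
  move=> t'; transitivity (oint (2 * t' + (r - t')) (2 * t + (r - t')) (fun x => g (x - t') (x + t'))).
    by congr (oint _ _ _); ring.
  rewrite -(oint_affine 2 (r - t') _ _ (cgd t')); apply: eq_ointT => x; rewrite /F.
  by congr (2 * g _ _); ring.
rewrite -(tri_fubini_cont _ _ cF).
have cK : continuous (fun s => oint r s (g ^~ s)).
  by apply: (@jcont_comp R R (fun x y => oint r x (g ^~ y)) id id (@jcont_oint R g r cg)) => s; exact: cvg_id.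
have := @oint_affine (fun s => oint r s (g ^~ s)) 2 r 0 t cK.
rewrite mulr0 add0r (addrC _ r) => <-.
rewrite -ointZ; last first.
  by apply: continuous_loc_int; apply: continuous_scale; exact: (@continuous_affine _ 2 r cK).
apply: eq_ointT => x; rewrite mulrA mulVf// mul1r.
rewrite (eq_ointT (g := fun t' => - (-2 * g (-2 * t' + (2 * x + r)) (2 * x + r)))); last first.
  by move=> t'; rewrite /F; rewrite mulNr opprK; congr (2 * g _ _); ring.
have c0 := @jcont1 _ _ (2 * x + r) cg.
rewrite ointN.
  by rewrite (oint_affine (-2) (2 * x + r) _ _ c0) -ointC; congr (oint _ _ _); ring.
by apply: continuous_loc_int; apply: continuous_scale; exact: (@continuous_affine _ (-2) (2 * x + r) c0).
Qed.

Lemma oint_triangle (g : R -> R -> R) r s : jcont g ->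
  oint r s (fun s' => oint r s' (g ^~ s')) = oint r s (fun r' => oint r' s (g r')).
Proof. by move=> cg; exact: (@tri_fubini_cont R (fun x y => g y x) r s (jcont_flip cg)). Qed.

Lemma jcont_oint_diag (g : R -> R -> R) : jcont g ->
  continuous (fun z : R * R => oint z.1 z.2 (fun r => g r z.2)).
Proof.
move=> cg.
have -> : (fun z : R * R => oint z.1 z.2 (g^~ z.2)) =
   (fun z => oint 0 z.2 (g^~ z.2) - oint 0 z.1 (g^~ z.2)).
  apply/funext => z; have := oint_chasles 0 z.1 z.2 (jcont_loc_int1 z.2 cg); lra.
move=> z; apply: cvgB; last exact: (@jcont_oint R g 0 cg).
apply: (@jcont_comp R (R * R)%type (fun x y => oint 0 x (g ^~ y)) snd snd (@jcont_oint R g 0 cg)) => y;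
  exact: cvg_snd.
Qed.

(** The terms of D'Alembert's formula are functions of r alone, functions of s
    alone, and the source integral.  The latter can be integrated over its
    triangle in both orders, hence differentiated in s as well as in r; this gives
    w_s and w_r explicitly, with g0 standing for the derivative of u0. *)
Lemma dalembert_null (u0 u1 g0 : R -> R) w :
  jcont w ->
  loc_int g0 -> loc_int (fun x => g0 x ^+ 2) ->
  loc_int u1 -> loc_int (fun x => u1 x ^+ 2) ->
  (forall a b, u0 b - u0 a = oint a b g0) ->
  (forall r s, w r s = 2^-1 * (u0 r + u0 s + oint r s u1)
     - 4^-1 * oint r s (fun s' => oint r s' (fun r' => f (w r' s')))) ->
  null_solution f w
    (fun r s => 2^-1 * (g0 s + u1 s) - 4^-1 * oint r s (fun r' => f (w r' s)))
    (fun r s => 2^-1 * (g0 r - u1 r) + 4^-1 * oint r s (fun s' => f (w r s'))).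
Proof.
move=> cw g0i g0i2 u1i u1i2 u0E wE.
pose g r s := f (w r s).
have cg : jcont g.
  by move=> z; apply: continuous_comp; [exact: cw|exact: cf].
have sqi (c : R) : loc_int (fun s => (2^-1 * (g0 s + c * u1 s)) ^+ 2).
  apply: (@loc_int_dom _ _ (fun s => g0 s ^+ 2 + c ^+ 2 * u1 s ^+ 2)).
  - have [mg mu] := (loc_int_meas g0i, loc_int_meas u1i).
    apply: measurable_funX; apply: measurable_funM => //.
    by apply: measurable_funD => //; exact: measurable_funM.
  - move=> a b; exists 1 => x _; rewrite ger0_norm ?sqr_ge0// mul1r -exprMn.
    set X := g0 x; set Y := c * u1 x.
    have := sqr_ge0 (X - Y); have := sqr_ge0 (X + Y); have := sqr_ge0 X.
    rewrite !expr2; nra.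
  - by apply: loc_intD => //; exact: loc_intZ.
have cT := jcont_oint_diag cg.
have cT' : continuous (fun z : R * R => oint z.2 z.1 (g z.2)).
  have -> : (fun z : R * R => oint z.2 z.1 (g z.2)) = (fun z => - oint z.1 z.2 (g z.2)).
    by apply/funext => y; rewrite ointC.
  have h := @jcont_oint_diag (fun r s => g s r) (jcont_flip cg).
  by move=> z; apply: cvgN; exact: h.
split => //; split.
- exists (fun s => 2^-1 * (g0 s + u1 s)), (fun r s => - (4^-1 * oint r s (g^~ s))); split => //.
  + by apply: loc_intZ; exact: loc_intD.
  + have := sqi 1; congr loc_int; by apply/funext => x; rewrite mul1r.
  + move=> z; apply: cvgN; exact: (cvgM (cvg_cst _) (cT z)).
- move=> r a b.
  have cK : continuous (fun s => oint r s (g^~ s)) := @jcont2 _ (fun r s => oint r s (g^~ s)) r cT.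
  rewrite !wE ointB; last 2 first.
  + by apply: loc_intZ; exact: loc_intD.
  + exact/loc_intZ/continuous_loc_int.
  rewrite !ointZ; last 2 first.
  + exact/continuous_loc_int.
  + exact: loc_intD.
  rewrite ointD// -u0E.
  have := oint_chasles r a b u1i.
  have := oint_chasles r a b (continuous_loc_int cK); rewrite /g /=; lra.
- move=> a b s; have := oint_chasles a b s (jcont_loc_int1 s cg); rewrite /g; lra.
- exists (fun r => 2^-1 * (g0 r - u1 r)), (fun s r => (4^-1 * oint r s (g r))); split => //.
  + by apply: loc_intZ; exact: loc_intB.
  + have := sqi (-1); congr loc_int; by apply/funext => x; rewrite mulN1r.
  + move=> z; exact: (cvgM (cvg_cst _) (cT' z)).
- move=> s a b; rewrite /swap !wE.
  have cK : continuous (fun r => oint r s (g r)) := @jcont2 _ (fun s r => oint r s (g r)) s cT'.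
  rewrite ointD; last 2 first.
  + by apply: loc_intZ; exact: loc_intB.
  + exact/loc_intZ/continuous_loc_int.
  rewrite !ointZ; last 2 first.
  + exact: continuous_loc_int.
  + exact: loc_intB.
  rewrite ointB// -u0E !(oint_triangle _ _ cg).
  have := oint_chasles a b s u1i.
  have := oint_chasles a b s (continuous_loc_int cK); rewrite /g /=; lra.
- move=> a b r; have := oint_chasles r a b (jcont_loc_int2 r cg); rewrite /swap /g; lra.
Qed.

End null_solution_theory.

(** * Increments along oblique lines *)

Section null_lines.
Context {R : realType}.
Variable f : R -> R.
Hypothesis cf : continuous f.
Implicit Types (w ws wr : R -> R -> R).

Lemma continuous_affine_id (c d : R) : continuous (fun x : R => c * x + d).
Proof. exact: (@continuous_affine _ id c d (fun x => cvg_id)). Qed.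

Lemma loc_int_sqrD (phi g : R -> R) : loc_int phi -> loc_int (fun s => phi s ^+ 2) ->
  continuous g -> loc_int (fun s => (phi s + g s) ^+ 2).
Proof.
move=> pi pi2 cg.
apply: (@loc_int_dom _ _ (fun s => phi s ^+ 2 + g s ^+ 2)).
- by apply: measurable_funX; apply: measurable_funD; [exact: loc_int_meas|exact: continuous_measurable_fun].
- move=> a b; exists 2 => x _; rewrite ger0_norm ?sqr_ge0//.
  have := sqr_ge0 (phi x - g x); rewrite !expr2; nra.
- by apply: loc_intD => //; apply: continuous_loc_int => x; apply: cvgM; exact: cg.
Qed.

(** Along a line on which s moves with unit speed, ws is a translate or a
    reflection of the L^2_loc function phi, plus a continuous function. *)
Lemma half_line w ws (c d r s : R) : half_null f w ws -> d = 1 \/ d = -1 ->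
  loc_int (fun x => ws (c * x + r) (d * x + s)) /\
  loc_int (fun x => ws (c * x + r) (d * x + s) ^+ 2).
Proof.
move=> [[phi [h [pi pi2 ch wsE]]] _ _] d1.
have [pdi _] := oint_unit_affine s 0 0 d1 pi.
have [pdi2 _] := oint_unit_affine s 0 0 d1 pi2.
have chl : continuous (fun x => h (c * x + r) (d * x + s)).
  by apply: (jcont_comp ch); exact: continuous_affine_id.
split.
  rewrite (_ : (fun x => _) = (fun x => phi (d * x + s) + h (c * x + r) (d * x + s))).
    by apply: loc_intD => //; exact: continuous_loc_int.
  by apply/funext => x; rewrite wsE.
rewrite (_ : (fun x => _) = (fun x => (phi (d * x + s) + h (c * x + r) (d * x + s)) ^+ 2)).
  exact: loc_int_sqrD.
by apply/funext => x; rewrite wsE.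
Qed.

Lemma half_section w ws r : half_null f w ws ->
  loc_int (ws r) /\ loc_int (fun s => ws r s ^+ 2).
Proof.
move=> hw; have [] := @half_line w ws 0 1 r 0 hw (or_introl erefl).
rewrite (_ : (fun x => ws (0 * x + r) (1 * x + 0)) = ws r).
  rewrite (_ : (fun x => ws (0 * x + r) (1 * x + 0) ^+ 2) = (fun s => ws r s ^+ 2)) => //.
  by apply/funext => x; rewrite mul0r add0r mul1r addr0.
by apply/funext => x; rewrite mul0r add0r mul1r addr0.
Qed.

(** This Lipschitz bound in r, uniform in s, allows ws to be evaluated along
    oblique lines although it is only a class of functions of s. *)
Lemma source_bound w ws (B : R) : jcont w ->
  half_null f w ws ->
  exists2 K, 0 <= K & forall r1 r2 s, `|r1| <= B -> `|r2| <= B -> `|s| <= B ->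
    `|ws r2 s - ws r1 s| <= K * `|r2 - r1|.
Proof.
move=> cw hw.
have cg : continuous (fun z : R * R => f (w z.1 z.2)).
  by move=> z; apply: continuous_comp; [exact: cw|exact: cf].
have [K HK] := @jcont_bounded R (fun r s => f (w r s)) (- B) B (- B) B cg.
have nb (x : R) : `|x| <= B -> - B <= x <= B by rewrite ler_norml.
exists `|K| => // r1 r2 s /nb r1B /nb r2B /nb sB.
rewrite (half_source hw) normrM ger0_norm ?invr_ge0//.
have : `|oint r1 r2 (fun r => f (w r s))| <= `|K| * `|r2 - r1|.
  apply: norm_oint_le.
    exact: (@jcont_loc_int1 R (fun r s => f (w r s)) s cg).
  move=> x xr; apply: le_trans (ler_norm K); apply: HK => //.
  by move: xr; case: (leP r1 r2) => _; lra.
have := mulr_ge0 (normr_ge0 K) (normr_ge0 (r2 - r1)).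
lra.
Qed.

(** Over a short step, move along s first and then along r.  On these two segments
    the increments of w are exact integrals; they differ from the integral along
    the oblique line by the variation of ws in r and of wr in s, which is at most
    a constant times the square of the step. *)
Lemma null_line w ws wr (c d r s : R) a b : null_solution f w ws wr ->
  c = 1 \/ c = -1 -> d = 1 \/ d = -1 ->
  w (c * b + r) (d * b + s) - w (c * a + r) (d * a + s) =
  oint a b (fun x => c * wr (c * x + r) (d * x + s) + d * ws (c * x + r) (d * x + s)).
Proof.
move=> [cw hs hr] c1 d1.
have [wsi _] := half_line c r s hs d1.
have [wri _] := half_line d s r hr c1.
pose k x := c * wr (c * x + r) (d * x + s) + d * ws (c * x + r) (d * x + s).
have ki : loc_int k by apply: loc_intD; exact: loc_intZ.
have nc (e : R) : e = 1 \/ e = -1 -> `|e| = 1 by case=> ->; rewrite ?normrN normr1.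
have base x0 y0 : x0 <= y0 ->
    w (c * y0 + r) (d * y0 + s) - w (c * x0 + r) (d * x0 + s) = oint x0 y0 k.
  move=> xy.
  pose B := `|x0| + `|y0| + `|r| + `|s|.
  have inB (e q x : R) : e = 1 \/ e = -1 -> `|q| <= `|r| + `|s| -> x0 <= x <= y0 -> `|e * x + q| <= B.
    move=> e1 q1 xx; apply: (le_trans (ler_normD _ _)); rewrite normrM nc// mul1r.
    have : `|x| <= `|x0| + `|y0|.
      by have := ler_norm x0; have := ler_norm y0; have := ler_norm (- x0);
        have := ler_norm (- y0); rewrite !normrN ler_norml; lra.
    by rewrite /B; lra.
  have inBr e x := @inB e r x ^~ (ltac:(by rewrite lerDl)).
  have inBs e x := @inB e s x ^~ (ltac:(by rewrite lerDr)).
  have [K1 K10 H1] := source_bound B cw hs.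
  have [K2 K20 H2] := @source_bound (swap w) (swap wr) B (@jcont_flip R w cw) hr.
  have := @small_increments_constant R
    (fun x => w (c * x + r) (d * x + s) - oint x0 x k) id x0 y0 xy.
  rewrite oint_same => h.
  suff : w (c * y0 + r) (d * y0 + s) - oint x0 y0 k = w (c * x0 + r) (d * x0 + s) - 0 by lra.
  apply: h => // e e0.
  have K0 : 0 < K1 + K2 + 1 by lra.
  exists (e / (K1 + K2 + 1)); first by rewrite divr_gt0.
  move=> x y x0x xy' yy0; rewrite ltr_pdivlMr// => yxe.
  have xin : x0 <= x <= y0 by lra.
  have yin : x0 <= y <= y0 by lra.
  rewrite -(oint_chasles x0 x y ki).
  have [wrsi _] := half_section (d * y + s) hr.
  have [wsi' _] := half_section (c * x + r) hs.
  have [i1 E1] := oint_unit_affine r x y c1 wrsi.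
  have [i2 E2] := oint_unit_affine s x y d1 wsi'.
  have D1 := half_primitive hr (d * y + s) (c * x + r) (c * y + r).
  have D2 := half_primitive hs (c * x + r) (d * x + s) (d * y + s).
  rewrite -E1 in D1; rewrite -E2 in D2; rewrite /swap in D1 i1 E1 wrsi.
  rewrite (_ : _ - _ - _ = oint x y (fun t => c * wr (c * t + r) (d * y + s) +
     d * ws (c * x + r) (d * t + s) - k t)); last first.
    have I1 := loc_intZ c i1; have I2 := loc_intZ d i2.
    by rewrite (ointB _ _ (loc_intD I1 I2) ki) (ointD _ _ I1 I2); lra.
  rewrite -[leRHS](_ : e * `|y - x| = _); last by rewrite ger0_norm// subr_ge0.
  apply: norm_oint_le.
    by apply: loc_intB => //; apply: loc_intD; exact: loc_intZ.
  move=> t; case: (leP x y) xy' => // _ _ txy.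
  have tin : x0 <= t <= y0 by lra.
  rewrite (_ : _ - _ = c * (wr (c * t + r) (d * y + s) - wr (c * t + r) (d * t + s)) -
    d * (ws (c * t + r) (d * t + s) - ws (c * x + r) (d * t + s))); last by rewrite /k; ring.
  apply: (le_trans (ler_normB _ _)); rewrite !normrM (nc c c1) (nc d d1) !mul1r.
  have := H2 _ _ _ (inBs d t d1 tin) (inBs d y d1 yin) (inBr c t c1 tin).
  have := H1 _ _ _ (inBr c x c1 xin) (inBr c t c1 tin) (inBs d t d1 tin).
  rewrite /swap.
  have -> : d * y + s - (d * t + s) = d * (y - t) by ring.
  have -> : c * t + r - (c * x + r) = c * (t - x) by ring.
  rewrite !normrM (nc c c1) (nc d d1) !mul1r ger0_norm; last lra.
  rewrite ger0_norm; last lra.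
  have : K1 * (t - x) <= K1 * (y - x) by rewrite ler_wpM2l//; lra.
  have : K2 * (y - t) <= K2 * (y - x) by rewrite ler_wpM2l//; lra.
  lra.
have [ab|/ltW ba] := leP a b; first exact: base.
by rewrite ointC -base//; ring.
Qed.

End null_lines.

(** * Curves in Lebesgue spaces *)

Section Lebesgue_spaces.
Context {R : realType}.

Lemma integrable_oint_bound (g : R -> R) : (forall x, 0 <= g x) ->
  (leb R).-integrable setT (EFin \o g) ->
  loc_int g /\ forall a b, a <= b -> oint a b g <= \int[leb R]_x g x.
Proof.
move=> g0 gi.
have li : loc_int g by move=> a b; apply: integrableS gi.
split=> // a b ab; rewrite -lee_fin -EFin_oint//.
rewrite /Rintegral fineK; last exact: integrable_fin_num.
apply: ge0_subset_integral => //; last by move=> x _; rewrite lee_fin.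
by case/integrableP: gi.
Qed.

Lemma Lfun2_loc_int (f : R -> R) : f \in Lfun (leb R) 2%:E ->
  [/\ loc_int f, loc_int (fun x => f x ^+ 2) &
    exists C, forall a b, a <= b -> oint a b (fun x => f x ^+ 2) <= C].
Proof.
move=> f2; have fi := Lfun2_integrable_sqr f2.
have [li bd] := integrable_oint_bound (fun x => sqr_ge0 (f x)) fi.
have mf : measurable_fun setT f.
  by move: f2; rewrite inE => /andP[/[!inE]].
split=> //; last by eexists; exact: bd.
apply: (@loc_int_dom _ _ (fun x => 1 + f x ^+ 2)) => //.
  move=> a b; exists 1 => x _; rewrite mul1r -[f x ^+ 2]real_normK ?num_real//.
  by have := sqr_ge0 (`|f x| - 1); have := normr_ge0 (f x); rewrite !expr2; nra.
by apply: loc_intD => //; exact: loc_int_cst.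
Qed.

Lemma Lfun_powR_bound (f : R -> R) (q : R) : 1 <= q -> f \in Lfun (leb R) q%:E ->
  exists C, forall a b, a <= b -> oint a b (fun x => `|f x| `^ q) <= C.
Proof.
move=> q1 fq; have fi := Lfun_integrable q1 fq.
have [|_ bd] := @integrable_oint_bound (fun x => `|f x| `^ q) _ fi.
  by move=> x; exact: powR_ge0.
by eexists; exact: bd.
Qed.

(** The inequality |d| <= (e' + d^2 / e') / 2 bounds the integral of |d| over
    [-M, M] by the L^2 norm of d. *)
Lemma L2_curve_pairing (v : R -> R -> R) (a : R -> R) (M : R) : 0 <= M ->
  continuous_in_L 2 v -> continuous a ->
  continuous (fun t => oint (- M) M (fun x => v x t * a x)).
Proof.
move=> M0 [v2 vc] ca t.
have vi s : loc_int (v^~ s) by case: (Lfun2_loc_int (v2 s)).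
have vai s : loc_int (fun x => v x s * a x) by exact: loc_intMc.
have [A [A0 aA]] := continuous_bounded (- M) M ca.
apply/cvgrPdist_lt => e e0.
pose e' := e / (A + 1) / (M + 1).
have A1 : 0 < A + 1 by lra.
have M1 : 0 < M + 1 by lra.
have e'0 : 0 < e' by rewrite !divr_gt0.
have := vc t; move=> /fine_cvgP[vfin] /cvgrPdist_lt /(_ _ e'0) h.
near=> s => /=.
have nfin : (Lnorm (leb R) 2%:E (fun x => (v x s - v x t)%:E)) \is a fin_num.
  by near: s.
have nlt : `|0 - fine (Lnorm (leb R) 2%:E (fun x => (v x s - v x t)%:E))| < e'.
  by near: s.
pose d x := v x s - v x t.
have di : loc_int d by exact: loc_intB.
have d2i : loc_int (fun x => d x ^+ 2).
  have [_ v2s _] := Lfun2_loc_int (v2 s); have [_ v2t _] := Lfun2_loc_int (v2 t).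
  apply: (@loc_int_dom _ _ (fun x => v x s ^+ 2 + v x t ^+ 2)).
  - by apply: measurable_funX; exact: loc_int_meas.
  - move=> b c; exists 2 => x _; rewrite ger0_norm ?sqr_ge0// /d.
    have := sqr_ge0 (v x s + v x t); rewrite !expr2; nra.
  - exact: loc_intD.
have MM : - M <= M by lra.
have d2e : oint (- M) M (fun x => d x ^+ 2) <= e' ^+ 2.
  apply: (@le_trans _ _ (fine (Lnorm (leb R) 2%:E (fun x => (v x s - v x t)%:E)) ^+ 2)).
    rewrite -lee_fin -EFin_oint//.
    have := @poweR_Lnorm _ _ _ (leb R) (fun x => (v x s - v x t)%:E) 2 ltac:(by []).
    rewrite -{1}(fineK nfin) poweR_EFin powR_mulrn ?fine_ge0 ?Lnorm_ge0// => ->.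
    have -> : (\int[leb R]_x (`|(v x s - v x t)%:E| `^ 2) = \int[leb R]_x (d x ^+ 2)%:E)%E.
      by apply: eq_integral => x _; rewrite /= powR_mulrn// real_normK ?num_real.
    apply: ge0_subset_integral => //; last by move=> x _; rewrite lee_fin sqr_ge0.
    by apply/measurable_EFinP; exact: loc_int_meas.
  rewrite lerXn2r ?nnegrE ?fine_ge0 ?Lnorm_ge0// ?(ltW e'0)//.
  by move: nlt; rewrite sub0r normrN => /(le_lt_trans (ler_norm _))/ltW.
rewrite -ointB//.
apply: (@le_lt_trans _ _ (oint (- M) M (fun x => A * (2^-1 * (e' + e'^-1 * d x ^+ 2))))).
  apply: (le_trans (le_norm_oint MM _)); first exact: loc_intB.
  apply: le_oint => //; first by apply: loc_int_abs; exact: loc_intB.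
    by apply/loc_intZ/loc_intZ/loc_intD; [exact: loc_int_cst|exact: loc_intZ].
  move=> x xM; rewrite -mulrBl normrM.
  rewrite (_ : `|v x t - v x s| = `|d x|); last by rewrite distrC.
  rewrite mulrC; apply: ler_pM => //; first exact: aA.
  rewrite -[d x ^+ 2]real_normK ?num_real//.
  have : 0 <= (e' - `|d x|) ^+ 2 * e'^-1 by rewrite mulr_ge0 ?sqr_ge0// invr_ge0 ltW.
  have -> : (e' - `|d x|) ^+ 2 * e'^-1 = e' - 2 * `|d x| + e'^-1 * `|d x| ^+ 2.
    by field; rewrite gt_eqF.
  lra.
have ii : loc_int (fun x => e'^-1 * d x ^+ 2) by exact: loc_intZ.
rewrite ointZ; last by apply/loc_intZ/loc_intD => //; exact: loc_int_cst.
rewrite ointZ; last by apply: loc_intD => //; exact: loc_int_cst.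
rewrite ointD//; last exact: loc_int_cst.
rewrite oint_cst ointZ//.
have h1 : e'^-1 * oint (- M) M (fun x => d x ^+ 2) <= e'.
  by rewrite mulrC ler_pdivrMr// -expr2.
apply: (@le_lt_trans _ _ (A * (e' * (M + 1)))).
  by rewrite ler_wpM2l//; lra.
rewrite /e' divfK ?gt_eqF// mulrA ltr_pdivrMr// mulrC ltr_pM2l//; lra.
Unshelve. all: by end_near. Qed.

End Lebesgue_spaces.

(** * Superpositions of travelling waves *)

Section traveling_waves.
Context {R : realType}.
Variables (phi psi : R -> R) (c : R -> R -> R).
Hypotheses (phii : loc_int phi) (psii : loc_int psi).
Hypothesis cc : jcont c.

(** The shape of u_t: data carried along the two families of characteristics, plus
    the continuous contribution of the source. *)
Definition wave (x t : R) := phi (x + t) - psi (x - t) + c x t.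

Lemma jmeas_sub (f : R -> R) : measurable_fun setT f -> jmeas (fun x y => f (x - y)).
Proof.
move=> mf; apply: measurableT_comp => //; apply: measurable_funB.
  exact: measurable_fst.
exact: measurable_snd.
Qed.

Lemma jmeasB (F G : R -> R -> R) : jmeas F -> jmeas G -> jmeas (fun x y => F x y - G x y).
Proof. by move=> mF mG; exact: measurable_funB. Qed.

Lemma jmeas_wave : jmeas wave.
Proof.
apply: jmeasD; last exact: jcont_jmeas.
apply: (jmeasB (F := fun x t => phi (x + t)) (G := fun x t => psi (x - t))).
  exact: (jmeas_shift (loc_int_meas phii)).
exact: (jmeas_sub (loc_int_meas psii)).
Qed.

Lemma loc_int_out (f : R -> R) x : loc_int f -> loc_int (fun t => f (x + t)).
Proof.
move=> fi; have [] := oint_unit_affine x 0 0 (or_introl erefl) fi.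
by rewrite (_ : (fun y => _) = (fun t => f (x + t)))// ; apply/funext => t; rewrite mul1r addrC.
Qed.

Lemma loc_int_in (f : R -> R) x : loc_int f -> loc_int (fun t => f (x - t)).
Proof.
move=> fi; have [] := oint_unit_affine x 0 0 (or_intror erefl) fi.
by rewrite (_ : (fun y => _) = (fun t => f (x - t)))// ; apply/funext => t; rewrite mulN1r addrC.
Qed.

Lemma oint_out (f : R -> R) x a b : loc_int f ->
  oint a b (fun t => f (x + t)) = oint (x + a) (x + b) f.
Proof.
move=> fi; have [_] := oint_unit_affine x a b (or_introl erefl) fi.
rewrite !mul1r !(addrC _ x) => <-; apply: eq_ointT => t.
by rewrite !mul1r addrC.
Qed.

Lemma oint_in (f : R -> R) x a b : loc_int f ->
  oint a b (fun t => f (x - t)) = oint (x - b) (x - a) f.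
Proof.
move=> fi; have [li] := oint_unit_affine x a b (or_intror erefl) fi.
rewrite ointZ// !mulN1r !(addrC _ x) (ointC (x - b)) => /oppr_inj <-.
by apply: eq_ointT => t; rewrite mulN1r addrC.
Qed.

Lemma loc_int_wave_t x : loc_int (wave x).
Proof.
apply: loc_intD; last exact: (jcont_loc_int2 x cc).
by apply: loc_intB; [exact: loc_int_out|exact: loc_int_in].
Qed.

Lemma loc_int_wave_x t : loc_int (wave ^~ t).
Proof.
apply: loc_intD; last exact: (jcont_loc_int1 t cc).
by apply: loc_intB; [exact: loc_int_shift|exact: (loc_int_shift (- t) psii)].
Qed.

(** The translates of phi and psi that occur involve only a bounded segment of
    their arguments, whence a bound uniform in x. *)
Lemma wave_fubini (a : R -> R) A B t1 t2 : A <= B -> t1 <= t2 -> continuous a ->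
  oint A B (fun x => oint t1 t2 (fun t => a x * wave x t)) =
  oint t1 t2 (fun t => oint A B (fun x => a x * wave x t)).
Proof.
move=> AB t12 ca.
have [K [K0 aK]] := continuous_bounded A B ca.
have [C cC] := jcont_bounded A B t1 t2 cc.
have aphi := loc_int_abs phii; have apsi := loc_int_abs psii.
pose N := K * (oint (A + t1) (B + t2) (fun y => `|phi y|) +
  oint (A - t2) (B - t1) (fun y => `|psi y|) + C * (t2 - t1)).
apply: (@box_fubini R (fun x t => a x * wave x t) A B t1 t2 N) => //.
- apply: jmeasM; last exact: jmeas_wave.
  exact: (jmeas_flip (jmeas_snd (continuous_measurable_fun ca))).
- by move=> x; apply: loc_intZ; exact: loc_int_wave_t.
- move=> t; rewrite (_ : (fun x => _) = (fun x => wave x t * a x)).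
    by apply: loc_intMc => //; exact: loc_int_wave_x.
  by apply/funext => x; rewrite mulrC.
move=> x xAB.
have i1 := loc_int_out x aphi; have i2 := loc_int_in x apsi.
have iC := loc_int_cst C.
apply: (@le_trans _ _ (oint t1 t2 (fun t => K * (`|phi (x + t)| + `|psi (x - t)| + C)))).
  apply: le_oint => //.
  - by apply/loc_int_abs/loc_intZ/loc_int_wave_t.
  - by apply: loc_intZ; apply: loc_intD => //; exact: loc_intD.
  move=> t tt; rewrite normrM ler_pM// ?aK//.
  rewrite /wave (le_trans (ler_normD _ _))// lerD ?cC//.
  exact: ler_normB.
rewrite ointZ; last by apply: loc_intD => //; exact: loc_intD.
rewrite ointD//; last exact: loc_intD.
rewrite ointD// oint_cst ler_wpM2l//.
rewrite (oint_out x t1 t2 aphi) (oint_in x t1 t2 apsi) lerD2r lerD//.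
- by apply: oint_subset => //; lra.
- by apply: oint_subset => //; lra.
Qed.

(** Integration by parts moves the derivative to a and replaces phi and psi by
    their primitives, which depend continuously on t. *)
Lemma wave_pairing_continuous (a : R -> R) (N : R) : 0 <= N -> smooth a -> a N = 0 -> a (- N) = 0 ->
  continuous (fun t => oint (- N) N (fun x => a x * wave x t)).
Proof.
move=> N0 sa aN aN'.
have NN : - N <= N by lra.
have [da sa'] := smooth_derive sa.
have ca := smooth_continuous sa; have ca' := smooth_continuous sa'.
have ipart (f : R -> R) t : loc_int f ->
    oint (- N) N (fun x => f (x + t) * a x) = - oint (- N) N (fun x => oint 0 (x + t) f * derive1 a x).
  move=> fi.
  have := @IBP_oint R (fun x => oint 0 (x + t) f) (fun x => f (x + t)) a (derive1 a) (- N) N NN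
    (loc_int_shift t fi) _ ca' da.
  rewrite aN aN' !mulr0 subr0 add0r => ->; first by rewrite opprK.
  by move=> y; rewrite (oint_shift _ _ _ fi) oint_chasles.
have cpart (f : R -> R) (e : R) : loc_int f ->
    continuous (fun t => oint (- N) N (fun x => f (x + e * t) * a x)).
  move=> fi t.
  pose G (x s : R) := oint 0 (x + e * s) f * derive1 a x.
  have cG : jcont G.
    have c1 : continuous (fun z : R * R => oint 0 (z.1 + e * z.2) f).
      have c0 : continuous (fun z : R * R => z.1 + e * z.2).
        by move=> z; exact: (cvgD cvg_fst (cvgM (cvg_cst _) cvg_snd)).
      move=> z; apply: (@continuous_comp _ _ _ (fun z : R * R => z.1 + e * z.2) (fun y => oint 0 y f)).
        exact: c0.
      exact: continuous_oint.
    have c2 : continuous (fun z : R * R => derive1 a z.1).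
      by move=> z; apply: (@continuous_comp _ _ _ fst (derive1 a)); [exact: cvg_fst|exact: ca'].
    by move=> z; exact: (cvgM (c1 z) (c2 z)).
  have cI : continuous (fun s => oint (- N) N (G ^~ s)).
    exact: (@jcont2 R (fun x s => oint (- N) x (G ^~ s)) N (@jcont_oint R G (- N) cG)).
  rewrite /continuous_at ipart//.
  have -> : (fun t => oint (- N) N (fun x => f (x + e * t) * a x)) = (fun t => - oint (- N) N (G ^~ t)).
    by apply/funext => s; rewrite ipart.
  exact: (cvgN (cI t)).
have cpart1 := cpart phi 1 phii; have cpart2 := cpart psi (-1) psii.
have cac : continuous (fun z : R * R => a z.1 * c z.1 z.2).
  have c2 : continuous (fun z : R * R => a z.1).
    by move=> z; apply: (@continuous_comp _ _ _ fst a); [exact: cvg_fst|exact: ca].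
  by move=> z; apply: cvgM; [exact: c2|exact: cc].
have cpart3 : continuous (fun t => oint (- N) N (fun x => a x * c x t)).
  exact: (@jcont2 R (fun x s => oint (- N) x (fun x => a x * c x s)) N
    (@jcont_oint R (fun x s => a x * c x s) (- N) cac)).
have -> : (fun t => oint (- N) N (fun x => a x * wave x t)) =
   (fun t => oint (- N) N (fun x => phi (x + 1 * t) * a x) -
     oint (- N) N (fun x => psi (x + -1 * t) * a x) + oint (- N) N (fun x => a x * c x t)).
  apply/funext => t.
  have I1 := loc_intMc (loc_int_shift (1 * t) phii) ca.
  have I2 := loc_intMc (loc_int_shift (-1 * t) psii) ca.
  have I3 := @jcont_loc_int1 R (fun x t => a x * c x t) t cac.
  rewrite -ointB// -ointD//; last exact: loc_intB.
  by apply: eq_ointT => x; rewrite /wave mul1r mulN1r; ring.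
move=> t; exact: (cvgD (cvgB (cpart1 t) (cpart2 t)) (cpart3 t)).
Qed.

End traveling_waves.

(** * Finite energy solutions in null coordinates *)

Section reduction.
Context {R : realType}.
Variables (p : R) (u0 u1 : R -> R) (u ux ut : R -> R -> R).
Hypothesis (hp : 1 < p).
Hypothesis hu : finite_energy_solution p u0 u1 u ux ut.

(** The function v of (x, t) read in the coordinates r = x - t, s = x + t. *)
Definition in_null (v : R -> R -> R) (r s : R) := v ((r + s) / 2) ((s - r) / 2).

Lemma in_nullE v x t : in_null v (x - t) (x + t) = v x t.
Proof. by rewrite /in_null; congr v; field. Qed.

Lemma in_null_continuous v : jcont v ->
  continuous (fun z : R * R => in_null v z.1 z.2).
Proof.
move=> cv; apply: (jcont_comp cv) => z.
  exact: (cvgM (cvgD cvg_fst cvg_snd) (cvg_cst _)).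
exact: (cvgM (cvgB cvg_snd cvg_fst) (cvg_cst _)).
Qed.

(** The initial value u0 is absolutely continuous, being continuous with a weak
    derivative in L^2, so D'Alembert's formula has the form required above. *)
Lemma solution_is_null : exists ws wr, null_solution (nl p) (in_null u) ws wr.
Proof.
have cu := u_continuous hu.
have cw := in_null_continuous cu.
have [g0 wg0 g02] := u0_H1dot hu.
have [g0i g0i2 _] := Lfun2_loc_int g02.
have [u1i u1i2 _] := Lfun2_loc_int (u1_L2 hu).
have cu0 : continuous u0.
  have -> : u0 = u ^~ 0 by apply/funext => x; rewrite (u_initial hu).
  exact: jcont1.
have u0E := weak_derivative_primitive cu0 g0i wg0.
have cnl := continuous_nl hp.
eexists; eexists; apply: (dalembert_null cnl cw g0i g0i2 u1i u1i2 u0E).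
move=> r s; pose g r s := nl p (in_null u r s).
have cg : jcont g.
  by move=> z; apply: (@continuous_comp _ _ _ (fun z : R * R => in_null u z.1 z.2)); [exact: cw|exact: cnl].
have wE x t : u x t = 2^-1 * (u0 (x - t) + u0 (x + t) + oint (x - t) (x + t) u1) -
    4^-1 * oint (x - t) (x + t) (fun s' => oint (x - t) s' (g ^~ s')).
  have tE : x - t + 2 * t = x + t by ring.
  have := cone_integral (x - t) t cg; rewrite tE => E.
  apply: etrans (dalembert hu x t) _; apply: (congr1 (fun I => _ - I)).
  rewrite (_ : 4^-1 = 2^-1 * 2^-1); last by rewrite -invfM -natrM.
  rewrite -mulrA -E; apply: (congr1 (fun I => 2^-1 * I)).
  apply: eq_ointT => t'; apply: eq_ointT => y.
  by rewrite /g in_nullE.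
rewrite {1}/in_null wE.
have -> : (r + s) / 2 - (s - r) / 2 = r by field.
by have -> : (r + s) / 2 + (s - r) / 2 = s by field.
Qed.

Lemma loc_int_ux t : loc_int (ux ^~ t).
Proof. by case: (Lfun2_loc_int ((ux_curve hu).1 t)). Qed.

Lemma loc_int_ut t : loc_int (ut ^~ t).
Proof. by case: (Lfun2_loc_int ((ut_curve hu).1 t)). Qed.

Section identification.
Variables (ws wr : R -> R -> R).
Hypothesis sol : null_solution (nl p) (in_null u) ws wr.

(** The values of u_x and u_t that the chain rule predicts. *)
Definition wave_x x t := ws (x - t) (x + t) + wr (x - t) (x + t).
Definition wave_t x t := ws (x - t) (x + t) - wr (x - t) (x + t).

Lemma slice_loc_int t :
  [/\ loc_int (fun x => ws (x - t) (x + t)), loc_int (fun x => wr (x - t) (x + t)),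
      loc_int (fun x => ws (x - t) (x + t) ^+ 2) & loc_int (fun x => wr (x - t) (x + t) ^+ 2)].
Proof.
have [cw hs hr] := sol.
have [] := half_line 1 (- t) t hs (or_introl erefl).
have [] := half_line 1 t (- t) hr (or_introl erefl).
rewrite /swap.
rewrite (_ : (fun x => wr _ _) = (fun x => wr (x - t) (x + t))); last first.
  by apply/funext => x; rewrite mul1r.
rewrite (_ : (fun x => ws _ _) = (fun x => ws (x - t) (x + t))); last first.
  by apply/funext => x; rewrite mul1r.
rewrite (_ : (fun x => wr _ _ ^+ 2) = (fun x => wr (x - t) (x + t) ^+ 2)); last first.
  by apply/funext => x; rewrite mul1r.
rewrite (_ : (fun x => ws _ _ ^+ 2) = (fun x => ws (x - t) (x + t) ^+ 2)); last first.
  by apply/funext => x; rewrite mul1r.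
by [].
Qed.

Lemma u_space_increment t a b : u b t - u a t = oint a b (wave_x ^~ t).
Proof.
have := @null_line R (nl p) (continuous_nl hp) _ ws wr 1 1 (- t) t a b sol (or_introl erefl) (or_introl erefl).
rewrite !mul1r !in_nullE => ->; apply: eq_ointT => x.
by rewrite /wave_x !mul1r addrC.
Qed.

Lemma u_time_increment x a b : u x b - u x a = oint a b (wave_t x).
Proof.
have := @null_line R (nl p) (continuous_nl hp) _ ws wr (-1) 1 x x a b sol (or_intror erefl) (or_introl erefl).
rewrite !mul1r !mulN1r !(addrC _ x) !in_nullE => ->; apply: eq_ointT => t.
by rewrite /wave_t !mul1r !mulN1r !(addrC _ x); ring.
Qed.

Lemma ux_identified t : {ae leb R, forall x, ux x t = wave_x x t}.
Proof.
have [i1 i2 _ _] := slice_loc_int t.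
have wi : loc_int (wave_x ^~ t) by exact: loc_intD.
have cut : continuous (u ^~ t) by apply: jcont1; exact: (u_continuous hu).
have prim := weak_derivative_primitive cut (loc_int_ux t) (ux_weak hu t).
have z0 a b : oint a b (fun x => ux x t - wave_x x t) = 0.
  by rewrite (ointB _ _ (loc_int_ux t) wi) -prim u_space_increment subrr.
have := oint0_ae0 (loc_intB (loc_int_ux t) wi) z0.
apply: filterS; first exact: (ae_filter_ringOfSetsType (leb R)).
by move=> x /eqP; rewrite subr_eq0 => /eqP.
Qed.

Lemma wave_tE : exists phi psi c, [/\ loc_int phi, loc_int psi,
  jcont c & wave_t = wave phi psi c].
Proof.
have [cw hs hr] := sol.
have [phi [h [phii _ ch wsE]]] := half_split hs.
have [psi [k [psii _ ck wrE]]] := half_split hr.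
exists phi, psi, (fun x t => h (x - t) (x + t) - k (x + t) (x - t)); split => //.
  have c1 : continuous (fun z : R * R => z.1 - z.2) by move=> z; exact: (cvgB cvg_fst cvg_snd).
  have c2 : continuous (fun z : R * R => z.1 + z.2) by move=> z; exact: (cvgD cvg_fst cvg_snd).
  by move=> z; apply: cvgB; [exact: (jcont_comp ch c1 c2)|exact: (jcont_comp ck c2 c1)].
apply/funext => x; apply/funext => t.
have := wrE (x + t) (x - t); rewrite /swap /wave_t /wave wsE => ->; ring.
Qed.

(** The hypothesis on ut concerns the distribution u_t on the plane, so passing to
    a fixed time requires continuity in time.  Let U, W and S be the pairings of
    u, ut and wave_t with a test function a of x.  Testing against products
    a(x) b(t) shows that W is the weak derivative of U, while by Fubini's theorem
    the increments of U are the integrals of S.  Both W and S are continuous, so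
    they are equal at every time. *)
Lemma ut_identified t : {ae leb R, forall x, ut x t = wave_t x t}.
Proof.
have [i1 i2 _ _] := slice_loc_int t.
have wi : loc_int (wave_t ^~ t) by exact: loc_intB.
have [phi [psi [c [phii psii cc wE]]]] := wave_tE.
have cu := u_continuous hu.
have di : loc_int (fun x => ut x t - wave_t x t) by apply: loc_intB => //; exact: loc_int_ut.
suff pair0 a : test_function a -> \int[leb R]_x ((ut x t - wave_t x t) * a x) = 0.
  have := ae_eq_pairing di pair0.
  apply: filterS; first exact: (ae_filter_ringOfSetsType (leb R)).
by move=> x /eqP; rewrite subr_eq0 => /eqP.
move=> ta; have [M [M0 aM a'M]] := test_function_support ta.
have [sa _] := (test_functionE a).1 ta.
have ca := smooth_continuous sa.
pose N := M + 1.
have N0 : 0 <= N by rewrite /N; lra.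
have NN : - N <= N by lra.
have aN x : N <= `|x| -> a x = 0 by move=> Nx; apply: aM; rewrite /N in Nx; lra.
have aNl x : N < `|x| -> a x = 0 by move=> /ltW/aN.
pose U t := oint (- N) N (fun x => a x * u x t).
pose W t := oint (- N) N (fun x => ut x t * a x).
pose S t := oint (- N) N (fun x => a x * wave_t x t).
have cW : continuous W by apply: L2_curve_pairing => //; exact: (ut_curve hu).
have cS : continuous S.
  rewrite /S wE; apply: wave_pairing_continuous => //; first by rewrite aN// ger0_norm.
  by rewrite aN// normrN ger0_norm.
have cau : continuous (fun z : R * R => a z.1 * u z.1 z.2).
  have c2 : continuous (fun z : R * R => a z.1).
    by move=> z; apply: (@continuous_comp _ _ _ fst a); [exact: cvg_fst|exact: ca].
  by move=> z; apply: cvgM; [exact: c2|exact: cu].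
have cU : continuous U.
  exact: (@jcont2 R (fun x s => oint (- N) x (fun x => a x * u x s)) N
    (@jcont_oint R (fun x s => a x * u x s) (- N) cau)).
have USE t1 t2 : t1 <= t2 -> U t2 - U t1 = oint t1 t2 S.
  move=> t12; rewrite /S wE -(wave_fubini phii psii cc NN t12 ca) /U -ointB.
  - apply: eq_ointT => x; rewrite -mulrBr u_time_increment wE ointZ//.
    exact: loc_int_wave_t.
  - exact: (@jcont_loc_int1 R (fun x t => a x * u x t) t2 cau).
  - exact: (@jcont_loc_int1 R (fun x t => a x * u x t) t1 cau).
have wU : weak_derivative U W.
  move=> b tb; have := ut_weak hu (test_function2_tensor ta tb).
  rewrite (_ : \int[leb R]_t0 \int[leb R]_x (u x t0 * _) = \int[leb R]_t0 (U t0 * derive1 b t0)).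
    move=> ->; congr (- _); apply: eq_Rintegral => s _.
    rewrite (Rintegral_support N0); last by move=> x /aNl ->; rewrite mul0r mulr0.
    rewrite mulrC -ointZ; last by apply: loc_intMc => //; exact: loc_int_ut.
    by apply: eq_ointT => x; ring.
  apply: eq_Rintegral => s _.
  have [sb _] := (test_functionE b).1 tb; have [db _] := smooth_derive sb.
  have dE x : derive1 (fun t => a x * b t) s = a x * derive1 b s.
    by have [_] := is_deriveZ (a x) (db s); rewrite -[RHS]/(a x *: _) -derive1E.
  under eq_Rintegral do rewrite dE.
  rewrite (Rintegral_support N0); last by move=> x /aNl ->; rewrite mul0r mulr0.
  rewrite mulrC -ointZ; last exact: (@jcont_loc_int1 R (fun x t => a x * u x t) s cau).
  by apply: eq_ointT => x; ring.
have UWE := weak_derivative_primitive cU (continuous_loc_int cW) wU.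
have WS : W t = S t.
  have h (s : R) : is_derive s (1 : R) (fun s => oint t s (fun t => W t - S t)) (W s - S s).
    apply: FTC1_oint => y; exact: (cvgB (cW y) (cS y)).
  have h' : is_derive t (1 : R) (fun s => oint t s (fun t => W t - S t)) 0.
    have -> : (fun s => oint t s (fun t => W t - S t)) = cst 0; last exact: is_derive_cst.
    apply/funext => s; rewrite ointB; [|exact: continuous_loc_int|exact: continuous_loc_int].
    rewrite -UWE /=; have [ts|/ltW st] := leP t s; first by rewrite -USE ?subrr.
    by rewrite ointC -USE//; ring.
  have [_ E1] := h t; case: h' => _; rewrite E1 => /eqP.
  by rewrite subr_eq0 => /eqP.
rewrite (Rintegral_support N0); last by move=> x /aNl ->; rewrite mulr0.
rewrite (eq_ointT (g := fun x => ut x t * a x - a x * wave_t x t)); last by move=> x; ring.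
rewrite ointB.
- by rewrite -/(W t) -/(S t) WS subrr.
- by apply: loc_intMc => //; exact: loc_int_ut.
rewrite (_ : (fun x => _) = (fun x => wave_t x t * a x)); first exact: loc_intMc.
by apply/funext => x; rewrite mulrC.
Qed.

End identification.
End reduction.

(** * Energy identities *)

Section energy.
Context {R : realType}.
Variables (f V : R -> R).
Hypotheses (cf : continuous f) (dV : forall x : R, is_derive x (1 : R) V (f x)).
Hypothesis V0 : forall v, 0 <= V v.
Implicit Types (w ws wr : R -> R -> R).

Section half.
Variables (w ws : R -> R -> R).
Hypotheses (cw : jcont w) (hw : half_null f w ws).

Let cg : continuous (fun z : R * R => f (w z.1 z.2)).
Proof. by move=> z; apply: (@continuous_comp _ _ _ (fun z : R * R => w z.1 z.2)); [exact: cw|exact: cf]. Qed.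

Let cV : continuous V. Proof. exact: continuous_diff dV. Qed.

(** For fixed s the function ws is of class C^1 in r, and
    d_r (ws^2) = 2 ws w_rs = ws f(w) / 2. *)
Lemma square_increment r1 r2 s : ws r2 s ^+ 2 - ws r1 s ^+ 2 =
  oint r1 r2 (fun r => 2^-1 * (ws r s * f (w r s))).
Proof.
have cgs : continuous (fun r => f (w r s)) := @jcont1 R (fun r s => f (w r s)) s cg.
have wsE r : ws r s = ws 0 s + 4^-1 * oint 0 r (fun r => f (w r s)).
  by rewrite -(half_source hw); ring.
have dws (r : R) : is_derive r (1 : R) (ws ^~ s) (4^-1 * f (w r s)).
  have -> : ws ^~ s = (fun r => ws 0 s + 4^-1 * oint 0 r (fun r => f (w r s))).
    by apply/funext => y; exact: wsE.
  have d0 := FTC1_oint 0 cgs r.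
  by apply: (is_derive_eq (is_deriveD (is_derive_cst _ _ _) (is_deriveZ 4^-1 d0))); rewrite add0r.
have cws := continuous_diff dws.
have dsq (r : R) : is_derive r (1 : R) (fun r => ws r s * ws r s) (2^-1 * (ws r s * f (w r s))).
  apply: (is_derive_eq (is_deriveM (dws r) (dws r))).
  by rewrite /GRing.scale /=; field.
have cd : continuous (fun r => 2^-1 * (ws r s * f (w r s))).
  by move=> y; apply: cvgM; [exact: cvg_cst|apply: cvgM; [exact: cws|exact: cgs]].
by rewrite (FTC2_oint r1 r2 cd dsq) !expr2.
Qed.

(** The same density ws f(w) / 2 is d_s V(w) / 2; in this direction w is only
    absolutely continuous. *)
Lemma pot_increment r c a b :
  oint a b (fun y => 2^-1 * (ws r (y + c) * f (w r (y + c)))) =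
  2^-1 * (V (w r (b + c)) - V (w r (a + c))).
Proof.
have [wsi _] := half_section r hw.
have ki := loc_int_shift c wsi.
have cgr : continuous (fun y => f (w r (y + c))).
  apply: (@jcont_comp R R (fun r s => f (w r s)) (fun _ => r) (fun y => y + c) cg) => y.
    exact: cvg_cst.
  exact: (cvgD cvg_id (cvg_cst _)).
rewrite ointZ; last exact: loc_intMc.
rewrite (@chain_oint R V f (fun y => w r (y + c)) (fun y => ws r (y + c)) a b)//.
by move=> x y; rewrite (half_primitive hw) oint_shift.
Qed.

Lemma loc_int_V w' (p q : R -> R) : jcont w' ->
  continuous p -> continuous q -> loc_int (fun y => V (w' (p y) (q y))).
Proof.
move=> cw' cp cq; apply: continuous_loc_int => y.
apply: (@continuous_comp _ _ _ (fun y => w' (p y) (q y)) V); last exact: cV.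
exact: (jcont_comp cw' cp cq).
Qed.

Lemma continuous_addr (c : R) : continuous (fun y : R => y + c).
Proof. by move=> y; exact: (cvgD cvg_id (cvg_cst _)). Qed.

Lemma continuous_idR : continuous (fun y : R => y).
Proof. by move=> y; exact: cvg_id. Qed.

Lemma continuous_cstR (c : R) : continuous (fun _ : R => c).
Proof. by move=> y; exact: cvg_cst. Qed.

(** The rough factor depends on y alone, so the affine form of Fubini's theorem
    applies. *)
Lemma flux_split c : exists k G H, [/\ loc_int k, jcont G,
  jcont H &
  forall r y, 2^-1 * (ws r (y + c) * f (w r (y + c))) = k y * G r y + H r y].
Proof.
have [phi [h [phii _ ch wsE]]] := half_split hw.
exists (fun y => phi (y + c)), (fun r y => 2^-1 * f (w r (y + c))),
  (fun r y => 2^-1 * (h r (y + c) * f (w r (y + c)))).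
have c2 : continuous (fun z : R * R => z.2 + c).
  by move=> z; exact: (cvgD cvg_snd (cvg_cst _)).
have c1 : continuous (fun z : R * R => z.1) by move=> z; exact: cvg_fst.
have cG := @jcont_comp R _ (fun r s => f (w r s)) _ _ cg c1 c2; have cH := jcont_comp ch c1 c2.
split.
- exact: loc_int_shift.
- by move=> z; apply: cvgM; [exact: cvg_cst|exact: cG].
- move=> z; apply: cvgM; first exact: cvg_cst.
  by apply: cvgM; [exact: cH|exact: cG].
- by move=> r y; rewrite wsE; ring.
Qed.

(** The density ws f(w) / 2 integrated over a rectangle, as d_r (ws^2) and as
    d_s V(w) / 2. *)
Lemma half_rectangle r1 r2 s1 s2 : r1 <= r2 -> s1 <= s2 ->
  oint s1 s2 (fun s => ws r2 s ^+ 2) - oint s1 s2 (fun s => ws r1 s ^+ 2) =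
  2^-1 * (oint r1 r2 (fun r => V (w r s2)) - oint r1 r2 (fun r => V (w r s1))).
Proof.
move=> r12 s12.
have [k [G [H [ki cG cH E]]]] := flux_split 0.
have E0 r s : 2^-1 * (ws r s * f (w r s)) = k s * G r s + H r s by rewrite -E addr0.
have := box_fubini_affine ki cG cH r12 s12.
rewrite (eq_ointT (g := fun r => 2^-1 * (V (w r s2) - V (w r s1)))); last first.
  move=> r; have := pot_increment r 0 s1 s2; rewrite !addr0 => <-.
  by apply: eq_ointT => s; rewrite -E.
rewrite [RHS](eq_ointT (g := fun s => ws r2 s ^+ 2 - ws r1 s ^+ 2)); last first.
  by move=> s; rewrite square_increment; apply: eq_ointT => r; rewrite E0.
have [_ i2] := half_section r2 hw; have [_ i1] := half_section r1 hw.
have v1 := loc_int_V cw continuous_idR (@continuous_cstR s1).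
have v2 := loc_int_V cw continuous_idR (@continuous_cstR s2).
by rewrite ointZ ?ointB//; exact: loc_intB.
Qed.

Lemma loc_int_diag c : loc_int (fun y => ws y (y + c) ^+ 2).
Proof.
have [_] := half_line 1 0 c hw (or_introl erefl).
by rewrite (_ : (fun x => _) = (fun y => ws y (y + c) ^+ 2))//; apply/funext => y; rewrite !mul1r addr0.
Qed.

(** The same computation on the triangle between the slice s = r + c and the
    characteristics r = b and s = a + c, which lie in the past of the slice. *)
Lemma half_past c a b : a <= b ->
  oint a b (fun y => ws y (y + c) ^+ 2) + 2^-1 * oint a b (fun r => V (w r (r + c))) =
  oint (a + c) (b + c) (fun s => ws b s ^+ 2) + 2^-1 * oint a b (fun r => V (w r (a + c))).
Proof.
move=> ab.
have [k [G [H [ki cG cH E]]]] := flux_split c.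
have := tri_fubini_affine ki cG cH ab.
rewrite (eq_ointT (g := fun r => 2^-1 * (V (w r (r + c)) - V (w r (a + c))))); last first.
  by move=> r; rewrite -pot_increment; apply: eq_ointT => y; rewrite -E.
rewrite [RHS](eq_ointT (g := fun y => ws b (y + c) ^+ 2 - ws y (y + c) ^+ 2)); last first.
  by move=> s; rewrite square_increment; apply: eq_ointT => r; rewrite -E.
have [_ ib] := half_section b hw.
have ib' := loc_int_shift c ib.
have v1 := loc_int_V cw continuous_idR (@continuous_cstR (a + c)).
have v2 := loc_int_V cw continuous_idR (@continuous_addr c).
have idg := loc_int_diag c.
rewrite ointZ; last exact: loc_intB.
rewrite ointB// (ointB _ _ ib' idg) (oint_shift _ _ _ ib); lra.
Qed.

(** The triangle between the slice s = r + c and the characteristics r = a and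
    s = b + c is the complement of the previous one in a rectangle. *)
Lemma half_future c a b : a <= b ->
  oint a b (fun y => ws y (y + c) ^+ 2) + 2^-1 * oint a b (fun r => V (w r (r + c))) =
  oint (a + c) (b + c) (fun s => ws a s ^+ 2) + 2^-1 * oint a b (fun r => V (w r (b + c))).
Proof.
move=> ab; rewrite half_past//.
have := @half_rectangle a b (a + c) (b + c) ab ltac:(by rewrite lerD2r); lra.
Qed.

End half.

Section full.
Variables (w ws wr : R -> R -> R).
Hypothesis sol : null_solution f w ws wr.

Let cw := null_continuous sol.
Let hs := null_s sol.
Let hr := null_r sol.
Let cw' := @jcont_flip R w cw.

Lemma swap_diag (F : R -> R) (v : R -> R -> R) c a b : loc_int (fun y => F (v y (y + c))) ->
  oint (a + c) (b + c) (fun y => F (v (y + - c) y)) = oint a b (fun y => F (v y (y + c))).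
Proof.
move=> li.
have li' : loc_int (fun y => F (v (y + - c) y)).
  have := loc_int_shift (- c) li; congr loc_int.
  by apply/funext => y; rewrite subrK.
by rewrite -(oint_shift a b c li'); apply: eq_ointT => y; rewrite addrK.
Qed.

Let loc_int_wr c : loc_int (fun y => wr y (y + c) ^+ 2).
Proof.
have [_] := half_line 1 c 0 hr (or_introl erefl).
rewrite /swap (_ : (fun x => wr _ _ ^+ 2) = (fun y => wr y (y + c) ^+ 2))//.
by apply/funext => y; rewrite !mul1r addr0.
Qed.

Let loc_int_Vdiag c : loc_int (fun y => V (w y (y + c))).
Proof. exact: (loc_int_V cw continuous_idR (@continuous_addr c)). Qed.

(** Exchanging r and s reverses the time (s - r) / 2, so the past triangle for wr
    is a future triangle for its swap. *)
Lemma half_past_r c a b : a <= b ->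
  oint a b (fun y => wr y (y + c) ^+ 2) + 2^-1 * oint a b (fun y => V (w y (y + c))) =
  oint a b (fun r => wr r (a + c) ^+ 2) + 2^-1 * oint (a + c) (b + c) (fun s => V (w b s)).
Proof.
move=> ab; have abc : a + c <= b + c by rewrite lerD2r.
have := half_future cw' hr (- c) abc; rewrite /swap !addrK.
by rewrite (@swap_diag (fun v => v ^+ 2) wr)// (@swap_diag V w).
Qed.

Lemma half_future_r c a b : a <= b ->
  oint a b (fun y => wr y (y + c) ^+ 2) + 2^-1 * oint a b (fun y => V (w y (y + c))) =
  oint a b (fun r => wr r (b + c) ^+ 2) + 2^-1 * oint (a + c) (b + c) (fun s => V (w a s)).
Proof.
move=> ab; have abc : a + c <= b + c by rewrite lerD2r.
have := half_past cw' hr (- c) abc; rewrite /swap !addrK.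
by rewrite (@swap_diag (fun v => v ^+ 2) wr)// (@swap_diag V w).
Qed.

(** At time c / 2 the points have null coordinates (y, y + c), and
    (u_x^2 + u_t^2) / 2 = w_s^2 + w_r^2: this is the energy density, and flux_r and
    flux_s are its fluxes through the lines of constant r and of constant s. *)
Definition slice c y := ws y (y + c) ^+ 2 + wr y (y + c) ^+ 2 + V (w y (y + c)).
Definition flux_r r s := ws r s ^+ 2 + 2^-1 * V (w r s).
Definition flux_s s r := wr r s ^+ 2 + 2^-1 * V (w r s).

Lemma flux_r_ge0 r s : 0 <= flux_r r s.
Proof. by rewrite addr_ge0 ?sqr_ge0// mulr_ge0. Qed.

Lemma flux_s_ge0 s r : 0 <= flux_s s r.
Proof. by rewrite addr_ge0 ?sqr_ge0// mulr_ge0. Qed.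

Lemma loc_int_slice c : loc_int (slice c).
Proof. by apply: loc_intD => //; apply: loc_intD => //; exact: (loc_int_diag hs). Qed.

Let Vr r : loc_int (fun s => V (w r s)).
Proof. exact: (loc_int_V cw (@continuous_cstR r) continuous_idR). Qed.

Let Vs s : loc_int (fun r => V (w r s)).
Proof. exact: (loc_int_V cw continuous_idR (@continuous_cstR s)). Qed.

Let ws2 r : loc_int (fun s => ws r s ^+ 2).
Proof. by have [] := half_section r hs. Qed.

Let wr2 s : loc_int (fun r => wr r s ^+ 2).
Proof. by have [] := half_section s hr. Qed.

Lemma loc_int_flux_r r : loc_int (flux_r r).
Proof. by apply: loc_intD => //; exact: loc_intZ. Qed.

Lemma loc_int_flux_s s : loc_int (flux_s s).
Proof. by apply: loc_intD => //; exact: loc_intZ. Qed.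

Let oint_slice c a b : oint a b (slice c) =
  oint a b (fun y => ws y (y + c) ^+ 2) + oint a b (fun y => wr y (y + c) ^+ 2) +
  oint a b (fun y => V (w y (y + c))).
Proof. by rewrite !ointD//; [exact: (loc_int_diag hs)|apply: loc_intD => //; exact: (loc_int_diag hs)]. Qed.

Let oint_flux_r r a b : oint a b (flux_r r) =
  oint a b (fun s => ws r s ^+ 2) + 2^-1 * oint a b (fun s => V (w r s)).
Proof. by rewrite ointD ?ointZ//; exact: loc_intZ. Qed.

Let oint_flux_s s a b : oint a b (flux_s s) =
  oint a b (fun r => wr r s ^+ 2) + 2^-1 * oint a b (fun r => V (w r s)).
Proof. by rewrite ointD ?ointZ//; exact: loc_intZ. Qed.

(** All the energy of the slice has entered its past triangle through the two
    characteristics that bound it. *)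
Lemma energy_past c a b : a <= b ->
  oint a b (slice c) = oint (a + c) (b + c) (flux_r b) + oint a b (flux_s (a + c)).
Proof.
move=> ab; rewrite oint_slice oint_flux_r oint_flux_s.
have := half_past cw hs c ab; have := half_past_r c ab; lra.
Qed.

(** All the energy of the slice leaves its future triangle through the two
    characteristics that bound it. *)
Lemma energy_future c a b : a <= b ->
  oint a b (slice c) = oint (a + c) (b + c) (flux_r a) + oint a b (flux_s (b + c)).
Proof.
move=> ab; rewrite oint_slice oint_flux_r oint_flux_s.
have := half_future cw hs c ab; have := half_future_r c ab; lra.
Qed.

End full.
End energy.

(** * Averaging, uniqueness for the Goursat problem, monotone limits *)

Section uniqueness.
Context {R : realType}.

(** A positive value of g would persist on a subsegment and contribute there a
    positive amount. *)
Lemma continuous_oint_eq0 (g : R -> R) a b : continuous g -> (forall x, 0 <= g x) ->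
  a < b -> oint a b g <= 0 -> forall x, a <= x <= b -> g x = 0.
Proof.
move=> cg g0 ab I0 x xab; apply/eqP; rewrite eq_le g0 andbT leNgt; apply/negP => gx.
have gx2 : 0 < g x / 2 by lra.
have [d d0 hd] := heine a b cg gx2.
have [l [r [lr al rb lrx]]] : exists l r, [/\ l < r, a <= l, r <= b &
    forall y, l <= y <= r -> `|x - y| < d].
  have [xb|xb] := ltP x b.
    exists x, (Num.min b (x + d / 2)); split=> //.
    - by rewrite lt_min xb; lra.
    - by lra.
    - by rewrite ge_min lexx.
    - by move=> y; rewrite le_min => /and3P[xy _ yx]; rewrite ltr_norml; lra.
  exists (Num.max a (x - d / 2)), x; split=> //.
  - by rewrite gt_max; lra.
  - by rewrite le_max lexx.
  - by lra.
  - by move=> y; rewrite ge_max => /andP[/andP[_ xy] yx]; rewrite ltr_norml; lra.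
have gi := continuous_loc_int cg.
have : g x / 2 * (r - l) <= oint l r g.
  rewrite -oint_cst; apply: le_oint => //; [lra|exact: loc_int_cst|].
  move=> y yl; have := hd x y xab ltac:(lra) (lrx y yl); rewrite ltr_norml; lra.
have := @oint_subset R l r a b g gi g0 al (ltW lr) rb.
have : 0 < g x / 2 * (r - l) by rewrite mulr_gt0//; lra.
lra.
Qed.

(** Integrate the lower bound over a segment of length q in y: the result is at
    least k q, and by Fubini's theorem at most |C| (b - a), whatever q is. *)
Lemma averaging (G : R -> R -> R) a b y0 C k : a <= b ->
  jcont G ->
  (forall y, y0 <= y -> k <= oint a b (G ^~ y)) ->
  (forall x y, a <= x <= b -> y0 <= y -> oint y0 y (G x) <= C) ->
  k <= 0.
Proof.
move=> ab cG kG GC; rewrite leNgt; apply/negP => k0.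
pose D := `|C| * (b - a).
have D0 : 0 <= D by rewrite mulr_ge0//; lra.
(* the lower bound k q then exceeds the upper bound D by 1 *)
have [q q0 kq] : exists2 q, 0 <= q & k * q = D + 1.
  by exists ((D + 1) / k); [rewrite divr_ge0// ?ltW//; lra|rewrite mulrC divfK// gt_eqF].
pose y := y0 + q.
have y0y : y0 <= y by rewrite /y lerDl.
have cI : continuous (fun y => oint a b (G ^~ y)).
  exact: (@jcont2 R (fun x y => oint a x (G ^~ y)) b (@jcont_oint R G a cG)).
have h1 : k * (y - y0) <= oint y0 y (fun y => oint a b (G ^~ y)).
  rewrite -oint_cst; apply: (le_oint y0y (loc_int_cst _) (continuous_loc_int cI)).
  by move=> z /andP[yz _]; exact: kG.
have c0 : continuous (fun _ : R * R => 0 : R) by move=> z; exact: cvg_cst.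
have E := @box_fubini_affine R (fun=> 0) (fun _ _ => 0) G (loc_int_cst 0) c0 cG a b y0 y ab y0y.
have h2 : oint a b (fun x => oint y0 y (G x)) = oint y0 y (fun y => oint a b (G ^~ y)).
  move: E; rewrite (eq_ointT (g := fun x => oint y0 y (G x))) => [->|x]; apply: eq_ointT => z.
    by apply: eq_ointT => x; rewrite mul0r add0r.
  by rewrite mul0r add0r.
have cI' : continuous (fun x => oint y0 y (G x)).
  exact: (@jcont2 R (fun s x => oint y0 s (G x)) y (@jcont_oint R (fun s x => G x s) y0 (@jcont_flip R G cG))).
have h3 : oint a b (fun x => oint y0 y (G x)) <= D.
  rewrite /D -oint_cst; apply: (le_oint ab (continuous_loc_int cI') (loc_int_cst _)).
  by move=> x xab; apply: le_trans (ler_norm C); exact: GC.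
have yq : y - y0 = q by rewrite /y addrAC subrr add0r.
move: h1; rewrite -h2 yq kq => /le_trans /(_ h3).
by rewrite gerDl leNgt ltr01.
Qed.

(** Integrating an exponential weight gains a factor 1 / l; this is what makes the
    Goursat iteration contract. *)
Lemma exp_weight (F : R -> R) (s0 s B l : R) : loc_int F -> 0 < l -> 0 <= B ->
  (forall y, Num.min s0 s <= y <= Num.max s0 s -> `|F y| <= B * expR (l * `|y - s0|)) ->
  `|oint s0 s F| <= B / l * expR (l * `|s - s0|).
Proof.
move=> Fi l0 B0 FB.
have dE (e d x : R) : is_derive x (1 : R) (fun y => expR (e * y + d)) (e * expR (e * x + d)).
  exact: (is_derive_affine e d (fun x => is_derive_expR x)).
have cE (e d : R) : continuous (fun y => expR (e * y + d)) by exact: continuous_diff (dE e d).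
have key (e d a b : R) : a <= b -> e != 0 -> (forall y, a <= y <= b -> `|F y| <= B * expR (e * y + d)) ->
    `|oint a b F| <= B / e * (expR (e * b + d) - expR (e * a + d)).
  move=> ab e0 h; apply: (le_trans (le_norm_oint ab Fi)).
  have -> : B / e * (expR (e * b + d) - expR (e * a + d)) = oint a b (fun y => B * expR (e * y + d)).
    have cBE : continuous (fun y => B * expR (e * y + d)).
      by move=> y; apply: cvgM; [exact: cvg_cst|exact: cE].
    have dBE (x : R) : is_derive x (1 : R) (fun y => B / e * expR (e * y + d)) (B * expR (e * x + d)).
      apply: (is_derive_eq (is_deriveZ (B / e) (dE e d x))).
      by rewrite /GRing.scale /= mulrA divfK.
    by rewrite (FTC2_oint a b cBE dBE); ring.
  apply: le_oint => //; first exact: loc_int_abs.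
  by apply/loc_intZ/continuous_loc_int.
have [s0s|/ltW ss0] := leP s0 s.
  apply: le_trans (key l (- (l * s0)) s0 s s0s _ _) _; first by rewrite gt_eqF.
    move=> y yy; have := FB y; rewrite minEle maxEle s0s => /(_ yy).
    have -> : `|y - s0| = y - s0 by rewrite ger0_norm//; lra.
    by rewrite mulrBr.
  rewrite ler_wpM2l ?divr_ge0 ?(ltW l0)// ger0_norm ?subr_ge0// mulrBr.
  by have := expR_ge0 (l * s0 + - (l * s0)); lra.
rewrite ointC normrN.
apply: le_trans (key (- l) (l * s0) s s0 ss0 _ _) _; first by rewrite oppr_eq0 gt_eqF.
  move=> y yy; have := FB y; rewrite minEle maxEle; case: (leP s0 s) => s0s.
    have -> : s = s0 by lra.
    have -> : `|y - s0| = - (y - s0) by rewrite ler0_norm//; lra.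
    by move=> /(_ ltac:(lra)); rewrite mulrN mulrBr opprB mulNr addrC.
  have -> : `|y - s0| = - (y - s0) by rewrite ler0_norm//; lra.
  by move=> /(_ yy); rewrite mulrN mulrBr opprB mulNr addrC.
have -> : l * `|s - s0| = - l * s + l * s0 by rewrite ler0_norm ?subr_le0//; ring.
have -> : B / - l * (expR (- l * s0 + l * s0) - expR (- l * s + l * s0)) =
   B / l * (expR (- l * s + l * s0) - expR (- l * s0 + l * s0)) by field; rewrite gt_eqF.
rewrite ler_wpM2l ?divr_ge0 ?(ltW l0)//.
by have := expR_ge0 (- l * s0 + l * s0); lra.
Qed.

(** The function w is the double integral of f(w) / 4 from the two lines on which it
    vanishes.  On a square of half-side N around their crossing |f(w)| <= L |w|, and in
    the norm weighted by exp (l |s - s0|), with l of the order of L N, the double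
    integral is a contraction. *)
Lemma goursat_zero (f : R -> R) w ws (r0 s0 : R) : continuous f ->
  (forall K : R, exists2 L : R, 0 <= L & forall v, `|v| <= K -> `|f v| <= L * `|v|) ->
  jcont w -> half_null f w ws ->
  (forall s, w r0 s = 0) -> (forall r, w r s0 = 0) -> forall r s, w r s = 0.
Proof.
move=> cf fL cw hw w0 w0' r s.
pose N := `|r - r0| + `|s - s0| + 1.
have N0 : 0 < N by rewrite /N ltr_wpDl// addr_ge0.
have [M wM] := jcont_bounded (r0 - N) (r0 + N) (s0 - N) (s0 + N) cw.
have [L L0 LM] := fL M.
(* the ratio of the iteration is L N / (4 l), at most 1 / 2 *)
pose l := L * N / 2 + 1.
have LN0 : 0 <= L * N by rewrite mulr_ge0// ltW.
have l0 : 0 < l by rewrite /l; lra.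
have cg : continuous (fun z : R * R => f (w z.1 z.2)).
  by move=> z; apply: (@continuous_comp _ _ _ (fun z : R * R => w z.1 z.2)); [exact: cw|exact: cf].
have wE x y : w x y = oint s0 y (fun t => 4^-1 * oint r0 x (fun q => f (w q t))).
  have h1 := half_primitive hw x s0 y; have h2 := half_primitive hw r0 s0 y.
  rewrite !w0 subrr in h2; rewrite w0' subr0 in h1.
  rewrite h1 -[LHS]subr0 {1}h2 -ointB.
  - by apply: eq_ointT => t; rewrite (half_source hw).
  - by have [] := half_section x hw.
  - by have [] := half_section r0 hw.
have M0 : 0 <= M.
  by apply: le_trans (normr_ge0 (w r0 s0)) (wM _ _ _ _); lra.
have step (K : R) : 0 <= K ->
    (forall x y, `|x - r0| <= N -> `|y - s0| <= N -> `|w x y| <= K * expR (l * `|y - s0|)) ->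
    (forall x y, `|x - r0| <= N -> `|y - s0| <= N -> `|w x y| <= K / 2 * expR (l * `|y - s0|)).
  move=> K0 H x y xN yN.
  have cI : continuous (fun t => oint r0 x (fun q => f (w q t))).
    exact: (@jcont2 R (fun x t => oint r0 x (fun q => f (w q t))) x (@jcont_oint R (fun q t => f (w q t)) r0 cg)).
  have iI : loc_int (fun t => 4^-1 * oint r0 x (fun q => f (w q t))).
    by apply: loc_intZ; exact: continuous_loc_int.
  have B0 : 0 <= 4^-1 * (L * K * N) by rewrite mulr_ge0 ?invr_ge0// mulr_ge0 ?(ltW N0)// mulr_ge0.
  rewrite wE; apply: (@le_trans _ _ (4^-1 * (L * K * N) / l * expR (l * `|y - s0|))).
    apply: exp_weight => // t ty.
    have tN : `|t - s0| <= N.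
      by move: yN ty; rewrite !ler_norml; case: (leP s0 y) => _; lra.
    rewrite normrM (ger0_norm (_ : 0 <= 4^-1 :> R)) ?invr_ge0//.
    rewrite [leRHS](_ : _ = 4^-1 * (L * K * N * expR (l * `|t - s0|))); last by ring.
    rewrite ler_wpM2l ?invr_ge0//.
    apply: (@le_trans _ _ (L * K * expR (l * `|t - s0|) * `|x - r0|)); last first.
      rewrite [leRHS](_ : _ = L * K * expR (l * `|t - s0|) * N); last by ring.
      by rewrite ler_wpM2l// mulr_ge0 ?expR_ge0// mulr_ge0.
    apply: norm_oint_le.
      exact: (@jcont_loc_int1 R (fun q t => f (w q t)) t cg).
    move=> q qx.
    have qN : `|q - r0| <= N.
      by move: xN qx; rewrite !ler_norml; case: (leP r0 x) => _; lra.
    apply: (@le_trans _ _ (L * `|w q t|)).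
      apply: LM; apply: wM; [move: qN|move: tN]; rewrite ler_norml; lra.
    by rewrite -mulrA ler_wpM2l// H.
  rewrite ler_wpM2r ?expR_ge0// ler_pdivrMr//.
  have : 0 <= K by []. rewrite /l; nra.
have all n : forall x y, `|x - r0| <= N -> `|y - s0| <= N -> `|w x y| <= M / 2 ^+ n * expR (l * `|y - s0|).
  elim: n => [|n IH] x y xN yN.
    rewrite expr0 divr1; apply: (@le_trans _ _ (M * 1)).
      rewrite mulr1; apply: wM; [move: xN|move: yN]; rewrite ler_norml; lra.
    rewrite ler_wpM2l//; apply: le_trans (expR_ge1Dx _).
    by rewrite lerDl mulr_ge0// ltW.
  have := step (M / 2 ^+ n) _ IH x y xN yN; rewrite divr_ge0 ?exprn_ge0// => /(_ isT).
  by rewrite exprSr invfM mulrA.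
apply/eqP; rewrite -normr_le0 leNgt; apply/negP => wp.
pose X := M * expR (l * `|s - s0|) + 1.
have X0 : 0 < X by rewrite /X ltr_wpDl// mulr_ge0// expR_ge0.
have wX : 0 < `|w r s| / X by rewrite divr_gt0.
have [n _ /(_ n (leqnn _)) /= hn] := near_infty_natSinv_expn_lt (PosNum wX).
have := all n r s _ _.
have := normr_ge0 (r - r0); have := normr_ge0 (s - s0) => s1 r1.
move=> /(_ ltac:(rewrite /N; lra) ltac:(rewrite /N; lra)).
rewrite leNgt => /negP; apply.
move: hn; rewrite ltr_pdivlMr//; apply: le_lt_trans.
rewrite /X mulrDr mulr1 div1r mulrAC mulrC.
have : 0 <= (2 ^+ n)^-1 :> R by rewrite invr_ge0 exprn_ge0.
set E := expR _; set q := _^-1; nra.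
Qed.

Lemma monotone_limit (e : R -> R) (t0 C : R) :
  (forall s t, t0 <= s -> s <= t -> e s <= e t) -> (forall t, t0 <= t -> e t <= C) ->
  exists l, e t @[t --> +oo] --> l /\ forall t, t0 <= t -> e t <= l.
Proof.
move=> em eC.
pose A := [set e t | t in [set t | t0 <= t]].
have hs : has_sup A.
  split; first by exists (e t0), t0 => /=.
  by exists C => _ [t /= tt <-]; exact: eC.
have le_sup t : t0 <= t -> e t <= sup A.
  move=> tt; have At : A (e t) by exists t.
  exact: (sup_upper_bound hs At).
exists (sup A); split=> //.
apply/cvgrPdist_lt => eps eps0.
have [_ [t1 /= t01 <-] h] := sup_adherent eps0 hs.
near=> t.
have t1t : t1 <= t by near: t; apply: nbhs_pinfty_ge; exact: num_real.
have := em t1 t t01 t1t; have := le_sup t (le_trans t01 t1t).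
by rewrite ltr_norml; lra.
Unshelve. all: by end_near. Qed.

Lemma ae_eq_oint (g h : R -> R) a b : loc_int g -> loc_int h ->
  {ae leb R, forall x, g x = h x} -> oint a b g = oint a b h.
Proof.
move=> gi hi gh.
have base x y : \int[leb R]_(z in `[x, y]) g z = \int[leb R]_(z in `[x, y]) h z.
  rewrite /Rintegral; congr fine; apply: ae_eq_integral => //.
  - by case/integrableP: (gi x y).
  - by case/integrableP: (hi x y).
  move: gh; apply: filterS; first exact: (ae_filter_ringOfSetsType (leb R)).
  by move=> z -> _.
by rewrite /oriented_integral !base.
Qed.

End uniqueness.

(** * A solution without flux through two characteristics vanishes *)

Section rigidity.
Context {R : realType}.
Variables (f V : R -> R).
Hypotheses (cf : continuous f) (dV : forall x : R, is_derive x (1 : R) V (f x)).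
Hypotheses (V0 : forall v, 0 <= V v) (V00 : forall v, V v = 0 -> v = 0).
Hypothesis fL : forall K : R, exists2 L : R, 0 <= L & forall v, `|v| <= K -> `|f v| <= L * `|v|.
Variables (w ws wr : R -> R -> R).
Hypothesis sol : null_solution f w ws wr.
Variables (r0 s0 C : R).
Hypothesis energy_bound : forall a b, a <= b -> oint a b (slice V w ws wr (s0 - r0)) <= C.

Let cw := null_continuous sol.
Let cw' := @jcont_flip R w cw.
Let cV : continuous V. Proof. exact: continuous_diff dV. Qed.

Let cVw : continuous (fun z : R * R => V (w z.1 z.2)).
Proof. by move=> z; apply: (@continuous_comp _ _ _ (fun z : R * R => w z.1 z.2)); [exact: cw|exact: cV]. Qed.

(** The part of the line of constant r that lies in the future of the slice through
    (r0, s0) is a side of a future triangle whose slice has energy at most C. *)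
Lemma flux_r_bound r a b : r + (s0 - r0) <= a -> a <= b ->
  oint a b (flux_r V w ws r) <= C.
Proof.
move=> ra ab; set c := s0 - r0 in ra *.
have rb : r <= b - c by lra.
have := energy_future cf dV sol c rb; rewrite subrK => E.
have := energy_bound rb; rewrite -/c E.
have F0 := flux_s_ge0 V0 w wr b.
have := @oint_ge0 R r (b - c) (flux_s V w wr b) rb (fun x _ => F0 x).
have := @oint_subset R a b (r + c) b (flux_r V w ws r) (loc_int_flux_r dV sol r)
  (fun x => flux_r_ge0 V0 w ws r x) ra ab (lexx _).
lra.
Qed.

Lemma flux_s_bound s a b : a <= b -> b <= s - (s0 - r0) ->
  oint a b (flux_s V w wr s) <= C.
Proof.
move=> ab bs; set c := s0 - r0 in bs *.
have asc : a <= s - c by lra.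
have := energy_future cf dV sol c asc; rewrite subrK => E.
have := energy_bound asc; rewrite -/c E.
have ac : a + c <= s by lra.
have F0 := flux_r_ge0 V0 w ws a.
have := @oint_ge0 R (a + c) s (flux_r V w ws a) ac (fun x _ => F0 x).
have := @oint_subset R a b a (s - c) (flux_s V w wr s) (loc_int_flux_s dV sol s)
  (fun x => flux_s_ge0 V0 w wr s x) (lexx _) ab bs.
lra.
Qed.

Hypothesis zero_r : forall s, s0 <= s -> oint s0 s (flux_r V w ws r0) <= 0.
Hypothesis zero_s : forall r, r <= r0 -> oint r r0 (flux_s V w wr s0) <= 0.

Let Vr r : continuous (fun s => V (w r s)) := @jcont2 R (fun r s => V (w r s)) r cVw.
Let Vs s : continuous (fun r => V (w r s)) := @jcont1 R (fun r s => V (w r s)) s cVw.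
Let ws2 r : loc_int (fun s => ws r s ^+ 2).
Proof. by have [] := half_section r (null_s sol). Qed.
Let wr2 s : loc_int (fun r => wr r s ^+ 2).
Proof. by have [] := half_section s (null_r sol). Qed.

Let zero_flux (v W : R -> R) a b : a <= b -> loc_int (fun x => v x ^+ 2) -> continuous W ->
  (forall x, 0 <= W x) -> oint a b (fun x => v x ^+ 2 + 2^-1 * W x) <= 0 ->
  oint a b (fun x => v x ^+ 2) = 0 /\ oint a b W = 0.
Proof.
move=> ab vi cW W0; have Wi := continuous_loc_int cW.
rewrite ointD ?ointZ//; last exact: loc_intZ.
have := @oint_ge0 R a b (fun x => v x ^+ 2) ab (fun x _ => sqr_ge0 _).
have := @oint_ge0 R a b W ab (fun x _ => W0 x).
by split; lra.
Qed.

Let zero_W (W : R -> R) a b : continuous W -> (forall x, 0 <= W x) ->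
  a < b -> oint a b W = 0 -> forall x, a <= x <= b -> W x = 0.
Proof. by move=> cW W0 ab E; apply: continuous_oint_eq0 => //; rewrite E. Qed.

Lemma vanish_future_r s : s0 <= s -> w r0 s = 0.
Proof.
move=> ss; have s1 : s0 <= s + 1 by lra.
have [_ E] := zero_flux s1 (ws2 r0) (@Vr r0) (fun x => V0 _) (zero_r s1).
by apply: V00; apply: (zero_W (@Vr r0) (fun x => V0 _) _ E); lra.
Qed.

Lemma vanish_past_s r : r <= r0 -> w r s0 = 0.
Proof.
move=> rr; have r1 : r - 1 <= r0 by lra.
have [_ E] := zero_flux r1 (wr2 s0) (@Vs s0) (fun x => V0 _) (zero_s r1).
by apply: V00; apply: (zero_W (@Vs s0) (fun x => V0 _) _ E); lra.
Qed.

(** As no energy crosses r = r0 after s0, the rectangle identity bounds the integral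
    of V(w) over [r0, r + 1] on the line s = s0 by the same integral on every later
    line of constant s.  Along each line of constant r, however, the integral of
    V(w) is at most 2 C, so averaging applies. *)
Lemma vanish_future_s r : r0 <= r -> w r s0 = 0.
Proof.
move=> rr; have r1 : r0 <= r + 1 by lra.
suff E : oint r0 (r + 1) (fun r => V (w r s0)) <= 0.
  apply: V00; apply: (@continuous_oint_eq0 R (fun r => V (w r s0)) r0 (r + 1) (@Vs s0)) => //; lra.
apply: (@averaging R (fun r s => V (w r s)) r0 (r + 1) (r + 1 + (s0 - r0)) (2 * C)) => //.
  move=> s rs; have ss : s0 <= s by lra.
  have := half_rectangle cf dV cw (null_s sol) r1 ss.
  have [-> _] := zero_flux ss (ws2 r0) (@Vr r0) (fun x => V0 _) (zero_r ss).
  have := @oint_ge0 R s0 s (fun s => ws (r + 1) s ^+ 2) ss (fun x _ => sqr_ge0 _).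
  lra.
move=> x y xr yr; have := @flux_r_bound x (r + 1 + (s0 - r0)) y ltac:(lra) yr.
rewrite /flux_r ointD ?ointZ//; [|exact: continuous_loc_int|apply/loc_intZ; exact: continuous_loc_int].
have := @oint_ge0 R (r + 1 + (s0 - r0)) y (fun s => ws x s ^+ 2) yr (fun x _ => sqr_ge0 _).
lra.
Qed.

(** The mirror image of the previous argument, with r decreasing; the variable
    y = - r is introduced to have it increase. *)
Lemma vanish_past_r s : s <= s0 -> w r0 s = 0.
Proof.
move=> ss; have s1 : s - 1 <= s0 by lra.
suff E : oint (s - 1) s0 (fun s => V (w r0 s)) <= 0.
  apply: V00; apply: (@continuous_oint_eq0 R (fun s => V (w r0 s)) (s - 1) s0 (@Vr r0)) => //; lra.
pose G x y := V (w (- y) x).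
have cG : jcont G.
  apply: (@jcont_comp R _ (fun r s => V (w r s)) (fun z : R * R => - z.2) (fun z : R * R => z.1) cVw) => z.
    exact: (cvgN cvg_snd).
  exact: cvg_fst.
apply: (@averaging R G (s - 1) s0 (s0 - r0 - (s - 1)) (2 * C)) => //.
  move=> y ys; have yr : - y <= r0 by lra.
  have := half_rectangle cf dV cw' (null_r sol) s1 yr; rewrite /swap.
  have [-> _] := zero_flux yr (wr2 s0) (@Vs s0) (fun x => V0 _) (zero_s yr).
  have := @oint_ge0 R (- y) r0 (fun r => wr r (s - 1) ^+ 2) yr (fun x _ => sqr_ge0 _).
  rewrite /G; lra.
move=> x y xs yy.
have yy' : - y <= - (s0 - r0 - (s - 1)) by lra.
have := @flux_s_bound x (- y) (- (s0 - r0 - (s - 1))) yy' ltac:(lra).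
rewrite /flux_s ointD ?ointZ//; [|exact: continuous_loc_int|apply/loc_intZ; exact: continuous_loc_int].
have := @oint_ge0 R (- y) (- (s0 - r0 - (s - 1))) (fun r => wr r x ^+ 2) yy' (fun x _ => sqr_ge0 _).
rewrite /G (oint_opp _ _ (continuous_loc_int (@Vs x))).
lra.
Qed.

Lemma vanish r s : w r s = 0.
Proof.
apply: (@goursat_zero R f w ws r0 s0 cf fL cw (null_s sol)) => [t|q].
  by have [/vanish_past_r|/ltW/vanish_future_r] := leP t s0.
by have [/vanish_past_s|/ltW/vanish_future_s] := leP q r0.
Qed.

End rigidity.

(** * The energy inside a light cone *)

Section light_cone.
Context {R : realType}.
Variables (p : R) (u0 u1 : R -> R) (u ux ut : R -> R -> R).
Hypothesis (hp : 1 < p).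
Hypothesis hu : finite_energy_solution p u0 u1 u ux ut.
Variables ws wr : R -> R -> R.
Hypothesis sol : null_solution (nl p) (in_null u) ws wr.
Let w := in_null u.
Let sl := slice (pot p) w ws wr.

Let cnl := continuous_nl hp.
Let dpot := is_derive_pot hp.

Lemma energy_densityE t : {ae leb R, forall x, energy_density p u ux ut x t = sl (2 * t) (x - t)}.
Proof.
have h1 := ux_identified hp hu sol t; have h2 := ut_identified hp hu sol t.
move: h1; apply: filterS2 h2; first exact: (ae_filter_ringOfSetsType (leb R)).
move=> x E1 E2; rewrite /energy_density E1 E2 /wave_x /wave_t /sl /slice.
rewrite !real_normK ?num_real// (_ : x - t + 2 * t = x + t); last by ring.
by rewrite /w in_nullE -/(pot p (u x t)); field.
Qed.

Lemma loc_int_density t : loc_int (fun x => energy_density p u ux ut x t).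
Proof.
have [_ i1 _] := Lfun2_loc_int ((ux_curve hu).1 t).
have [_ i2 _] := Lfun2_loc_int ((ut_curve hu).1 t).
have -> : (fun x => energy_density p u ux ut x t) =
    (fun x => 2^-1 * ux x t ^+ 2 + 2^-1 * ut x t ^+ 2 + pot p (u x t)).
  by apply/funext => x; rewrite /energy_density !real_normK ?num_real.
apply: loc_intD; first by apply: loc_intD; exact: loc_intZ.
apply: continuous_loc_int => x; apply: (@continuous_comp _ _ _ (u ^~ t)).
  by apply: jcont1; exact: (u_continuous hu).
exact: continuous_pot.
Qed.

Lemma total_energy_bound t : exists C, forall a b, a <= b ->
  oint a b (fun x => energy_density p u ux ut x t) <= C.
Proof.
have [_ i1 [C1 b1]] := Lfun2_loc_int ((ux_curve hu).1 t).
have [_ i2 [C2 b2]] := Lfun2_loc_int ((ut_curve hu).1 t).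
have p1 : 1 <= p + 1 by move: hp; lra.
have [C3 b3] := Lfun_powR_bound p1 ((u_curve hu).1 t).
have cu : continuous (u ^~ t) by apply: jcont1; exact: (u_continuous hu).
have i3 : loc_int (fun x => `|u x t| `^ (p + 1)).
  have : loc_int (fun x => (p + 1) * pot p (u x t)).
    apply/loc_intZ/continuous_loc_int => x; apply: (@continuous_comp _ _ _ (u ^~ t)).
      exact: cu.
    exact: continuous_pot.
  congr loc_int; apply/funext => x; rewrite /pot mulrA divff ?mul1r// gt_eqF//.
  by move: hp; lra.
exists (2^-1 * C1 + 2^-1 * C2 + (p + 1)^-1 * C3) => a b ab.
have -> : (fun x => energy_density p u ux ut x t) =
    (fun x => 2^-1 * ux x t ^+ 2 + 2^-1 * ut x t ^+ 2 + (p + 1)^-1 * `|u x t| `^ (p + 1)).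
  by apply/funext => x; rewrite /energy_density !real_normK ?num_real.
have j1 := loc_intZ 2^-1 i1; have j2 := loc_intZ 2^-1 i2; have j3 := loc_intZ (p + 1)^-1 i3.
rewrite (ointD _ _ (loc_intD j1 j2) j3) (ointD _ _ j1 j2) !ointZ//.
rewrite lerD// ?lerD// ler_wpM2l ?invr_ge0 ?b1 ?b2 ?b3//.
by move: hp; lra.
Qed.

Let loc_sl c : loc_int (sl c). Proof. exact: (loc_int_slice dpot sol). Qed.

Lemma oint_density t a b : oint a b (fun x => energy_density p u ux ut x t) =
  oint (a - t) (b - t) (sl (2 * t)).
Proof.
rewrite (ae_eq_oint a b (loc_int_density t) (loc_int_shift (- t) (loc_sl _)) (energy_densityE t)).
by rewrite oint_shift.
Qed.

Lemma integral_density eta t : eta <= t ->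
  (\int[leb R]_(x in [set x | (`|x| < t - eta)%R]) (energy_density p u ux ut x t)%:E)%E =
  (oint (eta - t) (t - eta) (fun x => energy_density p u ux ut x t))%:E.
Proof.
move=> et.
have di := loc_int_density t.
have -> : [set x : R | `|x| < t - eta] = `](eta - t), (t - eta)[%classic.
  by apply/seteqP; split => x /=; rewrite in_itv/= ltr_norml opprB.
rewrite -EFin_oint//; last lra.
have md : measurable_fun setT (EFin \o (fun x => energy_density p u ux ut x t)).
  by apply/measurable_EFinP; exact: loc_int_meas.
rewrite integral_itv_bndo_bndc; last exact: (measurable_funS measurableT _ md).
by rewrite integral_itv_obnd_cbnd//; exact: (measurable_funS measurableT _ md).
Qed.

(** The flux through the two sides of the cone |x| < t' - eta, from its apex
    (r, s) = (- eta, eta) at time eta up to time t. *)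
Definition cone_flux eta t := oint eta (2 * t - eta) (flux_r (pot p) w ws (- eta)) +
  oint (eta - 2 * t) (- eta) (flux_s (pot p) w wr eta).

(** The slice of the cone at time t has its past triangle bounded by the two sides
    of the cone. *)
Lemma cone_energy eta t : eta <= t ->
  oint (eta - t) (t - eta) (fun x => energy_density p u ux ut x t) = cone_flux eta t.
Proof.
move=> et; rewrite oint_density.
have -> : eta - t - t = eta - 2 * t by ring.
have -> : t - eta - t = - eta by ring.
have ab : eta - 2 * t <= - eta by lra.
rewrite /sl (energy_past cnl dpot sol (2 * t) ab) /cone_flux.
have -> : eta - 2 * t + 2 * t = eta by ring.
by have -> : - eta + 2 * t = 2 * t - eta by ring.
Qed.

Let Fr r := loc_int_flux_r dpot sol r.
Let Fs s := loc_int_flux_s dpot sol s.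
Let Fr0 r s := flux_r_ge0 (pot_ge0 hp) w ws r s.
Let Fs0 s r := flux_s_ge0 (pot_ge0 hp) w wr s r.

Lemma cone_flux_monotone eta s t : eta <= s -> s <= t -> cone_flux eta s <= cone_flux eta t.
Proof.
move=> es st; apply: lerD.
  by apply: (oint_subset (Fr _) (Fr0 _)); lra.
by apply: (oint_subset (Fs _) (Fs0 _)); lra.
Qed.

Lemma cone_flux_limit_gt0 eta : (exists x t, u x t <> 0) -> exists l,
  cone_flux eta t @[t --> +oo] --> l /\ 0 < l.
Proof.
move=> [x1 [t1 unz]].
have [C bC] := total_energy_bound eta.
have bS a b : a <= b -> oint a b (sl (eta - - eta)) <= C.
  move=> ab; have := bC (a + eta) (b + eta) ltac:(lra).
  by rewrite oint_density !addrK; have -> : eta - - eta = 2 * eta by ring.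
have pot0' := pot_ge0 hp.
have bR t : eta <= t -> oint eta (2 * t - eta) (flux_r (pot p) w ws (- eta)) <= C.
  move=> et; apply: (flux_r_bound cnl dpot pot0' sol bS); lra.
have bL t : eta <= t -> oint (eta - 2 * t) (- eta) (flux_s (pot p) w wr eta) <= C.
  move=> et; apply: (flux_s_bound cnl dpot pot0' sol bS); lra.
have [l [lim le_l]] := @monotone_limit R (cone_flux eta) eta (C + C)
  (@cone_flux_monotone eta) (fun t et => lerD (bR t et) (bL t et)).
exists l; split=> //; rewrite ltNge; apply/negP => l0; apply: unz.
rewrite -(in_nullE u).
have posR t : eta <= t -> 0 <= oint eta (2 * t - eta) (flux_r (pot p) w ws (- eta)).
  by move=> et; apply: oint_ge0 => [|y _]; [lra|exact: Fr0].
have posL t : eta <= t -> 0 <= oint (eta - 2 * t) (- eta) (flux_s (pot p) w wr eta).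
  by move=> et; apply: oint_ge0 => [|y _]; [lra|exact: Fs0].
apply: (@vanish R (nl p) (pot p) cnl dpot pot0' (@pot_eq0 _ _ hp) _ w ws wr sol (- eta) eta C bS).
- move=> K; exists (K `^ (p - 1)); first exact: powR_ge0.
  by move=> v vK; exact: nl_bounded.
- move=> s es; have [t [et <-]] : exists t, eta <= t /\ 2 * t - eta = s.
    by exists ((s + eta) / 2); split; [lra|field].
  by apply: le_trans (le_trans (le_l t et) l0); rewrite lerDl posL.
- move=> r re; have [t [et <-]] : exists t, eta <= t /\ eta - 2 * t = r.
    by exists ((eta - r) / 2); split; [lra|field].
  by apply: le_trans (le_trans (le_l t et) l0); rewrite lerDr posR.
Qed.

End light_cone.

Theorem proposition2p3 (R : realType) (p : R) (hp : 1 < p)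
    (u0 u1 : R -> R) (u ux ut : R -> R -> R)
    (hu : finite_energy_solution p u0 u1 u ux ut)
    (hnz : exists x t, u x t <> 0) (eta : R) :
  exists l : R,
    (\int[leb R]_(x in [set x | (`|x| < t - eta)%R])
        (energy_density p u ux ut x t)%:E)%E @[t --> +oo] --> l%:E
    /\ 0 < l.
Proof.
have [ws [wr sol]] := solution_is_null hp hu.
have [l [lim l0]] := cone_flux_limit_gt0 hp hu sol eta hnz.
exists l; split=> //.
have : (cone_flux p u ws wr eta t)%:E @[t --> +oo] --> l%:E by apply: cvg_EFin => //; exact: nearW.
apply: cvg_trans; apply: near_eq_cvg; near=> t.
have et : eta <= t by near: t; apply: nbhs_pinfty_ge; exact: num_real.
by rewrite (integral_density hp hu et) (cone_energy hp hu sol et).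
Unshelve. all: by end_near. Qed.
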